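(* Let $K\ge1$, $p\in(0,1)$, $\lambda>0$ and $m\in\mathbb{N}$. Let $R^*_{K,m,p,\lambda}\in(0,p)$ be the unique root in $(0,p)$ of the equation $$k_p(r^m)+\frac{2K\lambda}{K+1}\,k_p(r)-\frac{p}{(1+p)^2}=0,\qquad k_p(z)=\frac{pz}{(p-z)(1-pz)} .$$ Suppose that $f(z)=h(z)+\overline{g(z)}=\sum_{n=0}^{\infty}a_nz^n+\overline{\sum_{n=1}^{\infty}b_nz^n}$ is a sense-preserving $K$-quasiconformal harmonic mapping in $\mathbb{D}$ (poles allowed, expansions valid in $|z|<p$, as specified in the context) and $h\prec\phi$, where $\phi\in\widehat{C_p}$. Then $$|h(z^m)|+\lambda\sum_{n=1}^{\infty}(|a_n|+|b_n|)r^n\le|\phi(0)|+d(\phi(0),\partial\phi(\mathbb{D}))$$ for $|z|=r\le\min\{1/3,R^*_{K,m,p,\lambda}\}$. Moreover, if $R^*_{K,m,p,\lambda}\le1/3$, the result is sharp, i.e. $R^*_{K,m,p,\lambda}$ cannot be replaced by any larger number in this statement (over all admissible $f$ and $\phi$).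
   Context: $\mathbb{D}=\{z\in\mathbb{C}:|z|<1\}$ and $\widehat{\mathbb{C}}=\mathbb{C}\cup\{\infty\}$. For $p\in(0,1)$, $\widehat{C_p}$ is the family of meromorphic univalent functions $\phi:\mathbb{D}\to\widehat{\mathbb{C}}$ that are analytic in $\mathbb{D}\setminus\{p\}$, have a simple pole at $p$, and are such that $\widehat{\mathbb{C}}\setminus\phi(\mathbb{D})$ is convex. $d(\phi(0),\partial\phi(\mathbb{D}))$ is the Euclidean distance from $\phi(0)$ to the boundary of $\phi(\mathbb{D})$. $h\prec\phi$ ($h$ is subordinate to $\phi$) means $h=\phi\circ w$ for some analytic $w:\mathbb{D}\to\mathbb{D}$ with $w(0)=0$; thus $h$ is meromorphic in $\mathbb{D}$ and analytic in $\{|z|<p\}$. In $f=h+\overline g$, the functions $h$ and $g$ are meromorphic in $\mathbb{D}$ (poles outside $\{|z|<p\}$ are allowed), and their power series expansions are those in $\{|z|<p\}$, with $g(0)=0$. Such an $f$ is sense-preserving $K$-quasiconformal harmonic if, away from the poles, it is locally univalent and sense-preserving (i.e. $h'\neq0$ and $|\omega|<1$, where $\omega=g'/h'$) and $|\omega(z)|\le k<1$, where $K=(1+k)/(1-k)\ge1$, i.e. $k=(K-1)/(K+1)$. *)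

(* Defs.v *)
From Stdlib Require Import Reals.
From Coquelicot Require Import Coquelicot.

Open Scope R_scope.

(** The Riemann sphere; [None] is the point at infinity.  A meromorphic function
    is a map into [Chat] taking the value [None] exactly at its poles. *)
Definition Chat : Type := option C.

(** [fin] has the junk value 0 at infinity. *)
Definition fin (u : Chat) : C :=
  match u with Some c => c | None => RtoC 0 end.

Definition disk (z : C) : Prop := Cmod z < 1.

Definition C_differentiable (f : C -> C) (z : C) : Prop :=
  @ex_derive C_AbsRing C_NormedModule f z.

Definition C_derivative (f : C -> C) (z l : C) : Prop :=
  @is_derive C_AbsRing C_NormedModule f z l.

Definition analytic_at (f : C -> Chat) (z0 : C) : Prop :=
  exists eps : R, 0 < eps /\
    forall z : C, Cmod (z - z0) < eps ->
      f z <> None /\ C_differentiable (fun u => fin (f u)) z.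

Definition pole_of_order (n : nat) (f : C -> Chat) (z0 : C) : Prop :=
  f z0 = None /\
  exists (F : C -> C) (eps : R), 0 < eps /\ F z0 <> RtoC 0 /\
    (forall z : C, Cmod (z - z0) < eps -> C_differentiable F z) /\
    (forall z : C, 0 < Cmod (z - z0) < eps ->
       f z = Some (F z / Cpow (z - z0) n)%C).

Definition simple_pole (f : C -> Chat) (z0 : C) : Prop := pole_of_order 1 f z0.

Definition meromorphic_in_disk (f : C -> Chat) : Prop :=
  forall z : C, disk z ->
    analytic_at f z \/ exists n : nat, (1 <= n)%nat /\ pole_of_order n f z.

Definition univalent_in_disk (f : C -> Chat) : Prop :=
  forall z1 z2 : C, disk z1 -> disk z2 -> f z1 = f z2 -> z1 = z2.

Definition image_disk (f : C -> Chat) (u : Chat) : Prop :=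
  exists z : C, disk z /\ f z = u.

Definition convex (E : C -> Prop) : Prop :=
  forall (x y : C) (t : R), E x -> E y -> 0 <= t <= 1 ->
    E (RtoC t * x + RtoC (1 - t) * y)%C.

(** The class of concave functions with pole [p].  Since [phi p] is infinity,
    the complement of the image in the sphere consists of finite points. *)
Definition concave_class (p : R) (phi : C -> Chat) : Prop :=
  meromorphic_in_disk phi /\
  univalent_in_disk phi /\
  (forall z : C, disk z -> z <> RtoC p -> analytic_at phi z) /\
  simple_pole phi (RtoC p) /\
  convex (fun c => ~ image_disk phi (Some c)).

Definition boundary (E : C -> Prop) (c : C) : Prop :=
  forall eps : R, 0 < eps ->
    (exists u : C, Cmod (u - c) < eps /\ E u) /\
    (exists u : C, Cmod (u - c) < eps /\ ~ E u).

Definition dist_to_set (c : C) (E : C -> Prop) : R :=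
  real (Glb_Rbar (fun x => exists u : C, E u /\ x = Cmod (c - u))).

(** The Euclidean distance from [phi 0] to the boundary of [phi(D)].  When [phi]
    has a pole in the disk, infinity is an interior point of [phi(D)], so the
    boundary on the sphere is that of the finite part of [phi(D)]; it is
    nonempty, so that the infimum is finite. *)
Definition dist_to_boundary (phi : C -> Chat) : R :=
  dist_to_set (fin (phi (RtoC 0)))
    (boundary (fun c => image_disk phi (Some c))).

Definition subordinate (h phi : C -> Chat) : Prop :=
  exists w : C -> C,
    (forall z : C, disk z -> disk (w z) /\ C_differentiable w z) /\
    w (RtoC 0) = RtoC 0 /\
    (forall z : C, disk z -> h z = phi (w z)).

Definition has_expansion (p : R) (f : C -> Chat) (c : nat -> C) : Prop :=
  forall z : C, Cmod z < p ->
    exists s : C, f z = Some s /\ @is_pseries C_AbsRing C_NormedModule c z s.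

(** [f = h + conj g] is sense-preserving [K]-quasiconformal harmonic. *)
Definition sense_preserving_qc_harmonic (K : R) (h g : C -> Chat) : Prop :=
  meromorphic_in_disk h /\
  meromorphic_in_disk g /\
  forall z : C, disk z -> h z <> None -> g z <> None ->
    exists dh dg : C,
      C_derivative (fun u => fin (h u)) z dh /\
      C_derivative (fun u => fin (g u)) z dg /\
      dh <> RtoC 0 /\
      Cmod (dg / dh) < 1 /\
      Cmod (dg / dh) <= (K - 1) / (K + 1).

Definition kp (p x : R) : R := p * x / ((p - x) * (1 - p * x)).

Definition radius_root (K : R) (m : nat) (p lambda r : R) : Prop :=
  0 < r < p /\
  kp p (r ^ m) + 2 * K * lambda / (K + 1) * kp p r - p / (1 + p) ^ 2 = 0.

(** The Bohr-type inequality on the disk of radius [rho], for all admissible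
    mappings.  The points are restricted to [|z| < p], where the expansions are
    valid (so that convergence of the series is automatic there). *)
Definition bohr_inequality (K : R) (m : nat) (p lambda rho : R) : Prop :=
  forall (phi h g : C -> Chat) (a b : nat -> C),
    concave_class p phi ->
    sense_preserving_qc_harmonic K h g ->
    has_expansion p h a ->
    has_expansion p g b ->
    b 0%nat = RtoC 0 ->
    subordinate h phi ->
    forall z : C, Cmod z < p -> Cmod z <= rho ->
      let u := fun n => (Cmod (a (S n)) + Cmod (b (S n))) * Cmod z ^ S n in
      ex_series u /\
      Cmod (fin (h (Cpow z m))) + lambda * Series u
        <= Cmod (fin (phi (RtoC 0))) + dist_to_boundary phi.

(* Main.v *)
Require Import Defs.
From Stdlib Require Import Reals Ranalysis5 Lra Lia Psatz ClassicalEpsilon.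
From Coquelicot Require Import Coquelicot.

Open Scope R_scope.

(** Let [c] be a value omitted by [phi].  The complement of [phi(D)] is convex,
    hence starlike about [c], so [chi = 1/(phi - c)] is holomorphic and univalent,
    vanishes at [p] and has starlike image.  The maps [chi^-1 (t chi)], [0 < t < 1],
    fix [p]; Schwarz-Pick at [p], as [t -> 1], gives
    [Re ((z - p) (1 - p z) chi'/chi) >= 0].  A Cayley transform and Schwarz's lemma
    turn this into [Q' = V (z Q' - 2 Q)] with [|V| <= 1] for
    [Q = (p - z) (1 - p z) chi(0) / (p chi)].  Bohr's inequality for [V] and a comparison
    of coefficients give [sum |q_n| s^n <= (1 + s)^2] for [s <= 1/3], so
    [phi - c = (phi(0) - c) Q / ((1 - z/p) (1 - p z))] has the majorant
    [|phi(0) - c| (1 + (1+p)^2/p k_p(s))], which is inherited by [h = phi o w] since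
    Bohr's inequality also gives [sum |w_n| s^n <= s].  Letting [c] approach the
    boundary point nearest to [phi(0)] bounds [sum |a_n| s^n], [n >= 1], by
    [d (1+p)^2/p k_p(s)].  Since [g' = omega h'] with [|omega| <= k], Bohr's inequality
    for [omega] gives [sum |b_n| s^n <= k sum |a_n| s^n], and [1 + k = 2K/(K+1)].
    Equality holds for [phi = h = k_p] and [g = k k_p]. *)

(** * Complex differentiability *)

(** The majorant [(1 + s)^2] is dictated by the extremal function. For [phi = k_p] and the omitted
    value [c = -p/(1+p)^2], the difference [k_p - c] equals [p/(1+p)^2] times
    [(1+z)^2 / ((1 - z/p) (1 - p z))]. Hence [Q = (1+z)^2], [V = -1], and the bound for [Q] is an
    equality. A difficulty is that the Schwarz-Pick argument lives at the pole [p], whereas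
    coefficients are taken at [0]. The equation for [Q] moves the information: its form does not
    mention [p], and it can be read coefficientwise at the origin. The radius [1/3] is Bohr's
    constant. It enters through the three bounded functions to which Bohr's inequality is applied:
    [V], [w(z)/z] and the dilatation [omega]. The last one is at first defined only off the poles of
    [h] and [g], so it has to be extended across them. Convergence is kept out of the estimates.
    Taylor coefficients come from iterated difference quotients, and every majorant bound is proved
    for truncated sums, uniformly in the order of truncation; infinite series appear only in the
    last step and where given expansions are identified with Taylor coefficients. *)

Lemma Cmod_minus_sym (x y : C) : Cmod (x - y) = Cmod (y - x).
Proof. rewrite <- Cmod_opp. f_equal. ring. Qed.

Lemma Cmod_minus_0 (x : C) : Cmod (x - 0) = Cmod x.
Proof. f_equal. ring. Qed.

Lemma Cmod_reverse (x y : C) : Cmod x - Cmod y <= Cmod (x - y).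
Proof.
  assert (H := Cmod_triangle (x - y) y).
  replace (x - y + y)%C with x in H by ring. lra.
Qed.

Lemma Cmod_small_0 (x : C) : (forall e : R, 0 < e -> Cmod x <= e) -> x = 0.
Proof.
  intros H. apply Cmod_eq_0.
  destruct (Rle_lt_or_eq_dec 0 (Cmod x) (Cmod_ge_0 x)) as [Hx|Hx]; [|now symmetry].
  specialize (H (Cmod x / 2)). lra.
Qed.

Lemma Cminus_neq_0 (x y : C) : x <> y -> (x - y)%C <> 0.
Proof. intros H E. apply H. replace x with (x - y + y)%C by ring. rewrite E. ring. Qed.

Lemma Cminus_eq_0 (x y : C) : (x - y)%C = 0 -> x = y.
Proof. intros E. replace x with (x - y + y)%C by ring. rewrite E. ring. Qed.

Lemma Cmult_integral (x y : C) : (x * y)%C = 0 -> x = 0 \/ y = 0.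
Proof.
  intros H. destruct (Ceq_dec x 0) as [Hx|Hx]; [now left|right].
  replace y with (x * y / x)%C by (field; exact Hx). rewrite H. field. exact Hx.
Qed.

Lemma Cmod_le_sqr (x y : C) : Cmod x ^ 2 <= Cmod y ^ 2 -> Cmod x <= Cmod y.
Proof.
  intros H. assert (Hx := Cmod_ge_0 x). assert (Hy := Cmod_ge_0 y). nra.
Qed.

Lemma Cmod_self (z : C) : Cmod (z - z) = 0.
Proof. replace (z - z)%C with (RtoC 0) by ring. apply Cmod_0. Qed.

(** Neighbourhoods given by balls; [nearC_and] and [nearC_imp] do the bookkeeping of radii in the
    local arguments. *)
Definition nearC (z : C) (P : C -> Prop) : Prop :=
  exists d : R, 0 < d /\ forall w : C, Cmod (w - z) < d -> P w.

Lemma nearC_and (z : C) (P Q : C -> Prop) : nearC z P -> nearC z Q -> nearC z (fun w => P w /\ Q w).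
Proof.
  intros [d1 [H1 P1]] [d2 [H2 P2]]. exists (Rmin d1 d2). split; [now apply Rmin_glb_lt|].
  intros w Hw. assert (L1 := Rmin_l d1 d2). assert (L2 := Rmin_r d1 d2). split; [apply P1|apply P2]; lra.
Qed.

Lemma nearC_imp (z : C) (P Q : C -> Prop) : (forall w, P w -> Q w) -> nearC z P -> nearC z Q.
Proof. intros H [d [Hd Hw]]. exists d. auto. Qed.

Lemma nearC_at (z : C) (P : C -> Prop) : nearC z P -> P z.
Proof.
  intros [d [Hd H]]. apply H. now rewrite Cmod_self.
Qed.

Lemma nearC_nearC (z : C) (P : C -> Prop) : nearC z P -> nearC z (fun w => nearC w P).
Proof.
  intros [d [Hd H]]. exists (d / 2). split; [lra|]. intros w Hw. exists (d / 2). split; [lra|].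
  intros u Hu. apply H. replace (u - z)%C with ((u - w) + (w - z))%C by ring.
  eapply Rle_lt_trans; [apply Cmod_triangle|]. lra.
Qed.

Lemma nearC_all (P : C -> Prop) (z : C) : (forall w, P w) -> nearC z P.
Proof. intros H. exists 1. split; [lra|auto]. Qed.

Definition cont (f : C -> C) (z : C) : Prop :=
  forall e : R, 0 < e -> nearC z (fun w => Cmod (f w - f z) < e).

(** Caratheodory's form of differentiability, equivalent to Coquelicot's
    ([cder_is_derive]), reduces the calculus rules to algebra and continuity. *)
Definition cder (f : C -> C) (z l : C) : Prop :=
  exists q : C -> C, cont q z /\ q z = l /\
    forall w : C, f w = (f z + q w * (w - z))%C.

Definition cdiff (f : C -> C) (z : C) : Prop := exists l : C, cder f z l.

Lemma cont_const (c z : C) : cont (fun _ => c) z.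
Proof. intros e He. apply nearC_all. intros w. now rewrite Cmod_self. Qed.

Lemma cont_id (z : C) : cont (fun w => w) z.
Proof. intros e He. exists e. split; [lra|]. now intros w Hw. Qed.

Lemma cont_local (f g : C -> C) (z : C) (r : R) :
  0 < r -> (forall w : C, Cmod (w - z) < r -> f w = g w) -> cont g z -> cont f z.
Proof.
  intros Hr E Hg e He. assert (N : nearC z (fun w => f w = g w)) by now exists r.
  assert (E0 := nearC_at _ _ N). cbv beta in E0.
  generalize (nearC_and _ _ _ N (Hg e He)). apply nearC_imp.
  intros w [Ew Hw]. now rewrite Ew, E0.
Qed.

Lemma cont_bounded (f : C -> C) (z : C) :
  cont f z -> nearC z (fun w => Cmod (f w) <= Cmod (f z) + 1).
Proof.
  intros H. generalize (H 1 Rlt_0_1). apply nearC_imp.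
  intros w Hw. assert (T := Cmod_reverse (f w) (f z)). lra.
Qed.

Lemma cont_plus (f g : C -> C) (z : C) :
  cont f z -> cont g z -> cont (fun w => f w + g w)%C z.
Proof.
  intros Hf Hg e He. assert (He2 : 0 < e / 2) by lra.
  generalize (nearC_and _ _ _ (Hf _ He2) (Hg _ He2)). apply nearC_imp. intros w [H1 H2].
  replace (f w + g w - (f z + g z))%C with ((f w - f z) + (g w - g z))%C by ring.
  assert (T := Cmod_triangle (f w - f z) (g w - g z)). lra.
Qed.

Lemma cont_mult (f g : C -> C) (z : C) :
  cont f z -> cont g z -> cont (fun w => f w * g w)%C z.
Proof.
  intros Hf Hg e He.
  assert (Pf := Cmod_ge_0 (f z)). assert (Pg := Cmod_ge_0 (g z)).
  assert (E1 : 0 < e / 2 / (Cmod (g z) + 1)) by (apply Rdiv_lt_0_compat; lra).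
  assert (E2 : 0 < e / 2 / (Cmod (f z) + 1)) by (apply Rdiv_lt_0_compat; lra).
  generalize (nearC_and _ _ _ (cont_bounded g z Hg) (nearC_and _ _ _ (Hf _ E1) (Hg _ E2))).
  apply nearC_imp. intros w [H0 [H1 H2]].
  replace (f w * g w - f z * g z)%C
    with ((f w - f z) * g w + f z * (g w - g z))%C by ring.
  eapply Rle_lt_trans; [apply Cmod_triangle|]. rewrite !Cmod_mult.
  assert (P1 := Cmod_ge_0 (f w - f z)). assert (P2 := Cmod_ge_0 (g w - g z)).
  apply Rmult_lt_compat_r with (r := Cmod (g z) + 1) in H1; [|lra].
  apply Rmult_lt_compat_r with (r := Cmod (f z) + 1) in H2; [|lra].
  replace (e / 2 / (Cmod (g z) + 1) * (Cmod (g z) + 1)) with (e / 2) in H1 by (field; lra).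
  replace (e / 2 / (Cmod (f z) + 1) * (Cmod (f z) + 1)) with (e / 2) in H2 by (field; lra).
  assert (Cmod (f w - f z) * Cmod (g w) <= Cmod (f w - f z) * (Cmod (g z) + 1)).
  { apply Rmult_le_compat_l; lra. }
  nra.
Qed.

Lemma cont_opp (f : C -> C) (z : C) : cont f z -> cont (fun w => - f w)%C z.
Proof.
  intros H. apply cont_local with (g := (fun w => (-1) * f w)%C) (r := 1); [lra|intros; ring|].
  apply cont_mult; [apply cont_const|exact H].
Qed.

Lemma cont_minus (f g : C -> C) (z : C) :
  cont f z -> cont g z -> cont (fun w => f w - g w)%C z.
Proof. intros Hf Hg. apply cont_plus; [exact Hf|now apply cont_opp]. Qed.

Lemma nearC_cont (P : C -> Prop) (f : C -> C) (z : C) :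
  cont f z -> nearC (f z) P -> nearC z (fun w => P (f w)).
Proof. intros Hc [d [Hd H]]. generalize (Hc d Hd). apply nearC_imp. auto. Qed.

Lemma cont_comp (f g : C -> C) (z : C) :
  cont g z -> cont f (g z) -> cont (fun w => f (g w)) z.
Proof. intros Hg Hf e He. exact (nearC_cont _ g z Hg (Hf e He)). Qed.

Lemma cont_neq_0 (f : C -> C) (z : C) :
  cont f z -> f z <> 0 -> nearC z (fun w => Cmod (f z) / 2 < Cmod (f w) /\ f w <> 0).
Proof.
  intros H Hz. assert (P := proj1 (Cmod_gt_0 _) Hz).
  assert (P2 : 0 < Cmod (f z) / 2) by lra. generalize (H _ P2). apply nearC_imp.
  intros w Hw. rewrite Cmod_minus_sym in Hw. assert (T := Cmod_reverse (f z) (f w)).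
  split; [lra|]. apply Cmod_gt_0. lra.
Qed.

Lemma nearC_neq_0 (f : C -> C) (z : C) : cont f z -> f z <> 0 -> nearC z (fun w => f w <> 0).
Proof. intros Hc H. generalize (cont_neq_0 f z Hc H). apply nearC_imp. tauto. Qed.

Lemma cont_inv (f : C -> C) (z : C) :
  cont f z -> f z <> 0 -> cont (fun w => / f w)%C z.
Proof.
  intros H Hz e He. assert (P := proj1 (Cmod_gt_0 _) Hz).
  assert (E0 : 0 < e * (Cmod (f z) * (Cmod (f z) / 2))) by (repeat apply Rmult_lt_0_compat; lra).
  generalize (nearC_and _ _ _ (cont_neq_0 f z H Hz) (H _ E0)). apply nearC_imp.
  intros w [[H3 H4] H2].
  replace (/ f w - / f z)%C with ((f z - f w) / (f z * f w))%C by (field; now split).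
  rewrite Cmod_div; [|intros E; destruct (Cmult_integral _ _ E); contradiction].
  rewrite Cmod_mult, Cmod_minus_sym.
  apply Rmult_lt_reg_r with (Cmod (f z) * Cmod (f w)); [apply Rmult_lt_0_compat; lra|].
  unfold Rdiv. rewrite Rmult_assoc, Rinv_l, Rmult_1_r.
  - eapply Rlt_le_trans; [exact H2|]. apply Rmult_le_compat_l; [lra|].
    apply Rmult_le_compat_l; lra.
  - apply Rgt_not_eq. apply Rmult_lt_0_compat; lra.
Qed.

Lemma cont_div (f g : C -> C) (z : C) :
  cont f z -> cont g z -> g z <> 0 -> cont (fun w => f w / g w)%C z.
Proof. intros Hf Hg H. apply cont_mult; [exact Hf|now apply cont_inv]. Qed.

Lemma cont_unique (f g : C -> C) (z : C) (r : R) :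
  0 < r -> cont f z -> cont g z ->
  (forall w : C, 0 < Cmod (w - z) < r -> f w = g w) -> f z = g z.
Proof.
  intros Hr Hf Hg E. apply Cminus_eq_0. apply Cmod_small_0. intros e He.
  assert (Hh := cont_minus f g z Hf Hg).
  destruct (Hh e He) as [d [Hd H]].
  set (s := Rmin d r / 2).
  assert (L1 := Rmin_l d r). assert (L2 := Rmin_r d r).
  assert (Hs : 0 < Rmin d r) by now apply Rmin_glb_lt.
  assert (Hm : Cmod (z + RtoC s - z) = s).
  { replace (z + RtoC s - z)%C with (RtoC s) by ring.
    rewrite Cmod_R, Rabs_pos_eq; unfold s; lra. }
  specialize (H (z + RtoC s)%C ltac:(rewrite Hm; unfold s; lra)). cbv beta in H.
  rewrite E in H by (rewrite Hm; unfold s; lra).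
  replace (g (z + RtoC s) - g (z + RtoC s) - (f z - g z))%C with (- (f z - g z))%C in H by ring.
  rewrite Cmod_opp in H. lra.
Qed.

Lemma cder_cont (f : C -> C) (z l : C) : cder f z l -> cont f z.
Proof.
  intros [q [Hq [_ E]]].
  apply cont_local with (g := fun w => (f z + q w * (w - z))%C) (r := 1); [lra|now intros; rewrite <- E|].
  apply cont_plus; [apply cont_const|]. apply cont_mult; [exact Hq|].
  apply cont_minus; [apply cont_id|apply cont_const].
Qed.

Lemma cdiff_cont (f : C -> C) (z : C) : cdiff f z -> cont f z.
Proof. intros [l H]. exact (cder_cont f z l H). Qed.

(** [cder] asks for a factorization at every [w], but a local one is enough: away from [z] the slope
    can be taken to be the difference quotient, and only its continuity at [z] matters. *)
Lemma cder_intro (f q : C -> C) (z : C) (r : R) :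
  0 < r -> cont q z ->
  (forall w : C, Cmod (w - z) < r -> f w = (f z + q w * (w - z))%C) ->
  cder f z (q z).
Proof.
  intros Hr Hq E.
  exists (fun w => if Ceq_dec w z then q z else (f w - f z) / (w - z))%C.
  split; [|split].
  - apply cont_local with (g := q) (r := r); [exact Hr| |exact Hq].
    intros w Hw. destruct (Ceq_dec w z) as [->|Hn]; [reflexivity|].
    rewrite (E w Hw). field. now apply Cminus_neq_0.
  - now destruct (Ceq_dec z z).
  - intros w. destruct (Ceq_dec w z) as [->|Hn]; [ring|].
    field. now apply Cminus_neq_0.
Qed.

Lemma cder_local (f g : C -> C) (z l : C) (r : R) :
  0 < r -> (forall w : C, Cmod (w - z) < r -> f w = g w) -> cder g z l -> cder f z l.
Proof.
  intros Hr E [q [Hq [<- H]]]. apply cder_intro with (r := r); [exact Hr|exact Hq|].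
  intros w Hw. rewrite !E; [apply H| |exact Hw].
  now rewrite Cmod_self.
Qed.

Lemma cdiff_local (f g : C -> C) (z : C) (r : R) :
  0 < r -> (forall w : C, Cmod (w - z) < r -> f w = g w) -> cdiff g z -> cdiff f z.
Proof. intros Hr E [l H]. exists l. exact (cder_local f g z l r Hr E H). Qed.

Lemma cder_const (c z : C) : cder (fun _ => c) z 0.
Proof.
  exists (fun _ => RtoC 0). split; [apply cont_const|]. split; [reflexivity|].
  intros w. ring.
Qed.

Lemma cder_id (z : C) : cder (fun w => w) z 1.
Proof.
  exists (fun _ => RtoC 1). split; [apply cont_const|]. split; [reflexivity|].
  intros w. ring.
Qed.

Lemma cder_eq (f : C -> C) (z l l' : C) : l = l' -> cder f z l -> cder f z l'.
Proof. now intros ->. Qed.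

Lemma cder_plus (f g : C -> C) (z a b : C) :
  cder f z a -> cder g z b -> cder (fun w => f w + g w)%C z (a + b).
Proof.
  intros [q1 [H1 [<- E1]]] [q2 [H2 [<- E2]]]. exists (fun w => q1 w + q2 w)%C.
  split; [now apply cont_plus|]. split; [reflexivity|].
  intros w. rewrite (E1 w), (E2 w). ring.
Qed.

Lemma cder_mult (f g : C -> C) (z a b : C) :
  cder f z a -> cder g z b -> cder (fun w => f w * g w)%C z (a * g z + f z * b).
Proof.
  intros Hf Hg. assert (Cg := cder_cont _ _ _ Hg).
  destruct Hf as [q1 [H1 [<- E1]]]. destruct Hg as [q2 [H2 [<- E2]]].
  exists (fun w => q1 w * g w + f z * q2 w)%C.
  split; [|split; [reflexivity|]].
  - apply cont_plus; apply cont_mult; auto using cont_const.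
  - intros w. rewrite (E1 w), (E2 w). ring.
Qed.

Lemma cder_comp (f g : C -> C) (z a b : C) :
  cder f (g z) a -> cder g z b -> cder (fun w => f (g w)) z (a * b).
Proof.
  intros [q1 [H1 [<- E1]]] Hg. assert (Cg := cder_cont _ _ _ Hg).
  destruct Hg as [q2 [H2 [<- E2]]].
  exists (fun w => q1 (g w) * q2 w)%C.
  split; [|split; [reflexivity|]].
  - apply cont_mult; [now apply (cont_comp q1 g)|exact H2].
  - intros w. rewrite (E1 (g w)).
    replace (g w - g z)%C with (q2 w * (w - z))%C by (rewrite (E2 w); ring). ring.
Qed.

Lemma cder_inv (f : C -> C) (z a : C) :
  cder f z a -> f z <> 0 -> cder (fun w => / f w)%C z (- a / (f z * f z)).
Proof.
  intros Hf Hz. assert (Cf := cder_cont _ _ _ Hf).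
  destruct Hf as [q [H [<- E]]].
  destruct (cont_neq_0 f z Cf Hz) as [d [Hd Hn]].
  apply (cder_intro (fun w => / f w)%C (fun w => - q w / (f w * f z))%C z d Hd).
  - apply cont_div; [now apply cont_opp| |].
    + apply cont_mult; [exact Cf|apply cont_const].
    + intros E0. destruct (Cmult_integral _ _ E0); contradiction.
  - intros w Hw. destruct (Hn w Hw) as [_ Hw0].
    replace (/ f w)%C with (/ f z + - (f w - f z) / (f w * f z))%C by (field; now split).
    rewrite (E w) at 1. field. now split.
Qed.

Lemma cder_opp (f : C -> C) (z a : C) : cder f z a -> cder (fun w => - f w)%C z (- a).
Proof.
  intros [q [H [<- E]]]. exists (fun w => - q w)%C. split; [now apply cont_opp|].
  split; [reflexivity|]. intros w. rewrite (E w). ring.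
Qed.

Lemma cder_minus (f g : C -> C) (z a b : C) :
  cder f z a -> cder g z b -> cder (fun w => f w - g w)%C z (a - b).
Proof. intros Hf Hg. apply cder_plus; [exact Hf|now apply cder_opp]. Qed.

Lemma cder_div (f g : C -> C) (z a b : C) :
  cder f z a -> cder g z b -> g z <> 0 ->
  cder (fun w => f w / g w)%C z ((a * g z - f z * b) / (g z * g z)).
Proof.
  intros Hf Hg H. eapply cder_eq; [|exact (cder_mult _ _ _ _ _ Hf (cder_inv _ _ _ Hg H))].
  cbv beta. field. exact H.
Qed.

Lemma cdiff_const (c z : C) : cdiff (fun _ => c) z.
Proof. eexists. apply cder_const. Qed.
Lemma cdiff_id (z : C) : cdiff (fun w => w) z.
Proof. eexists. apply cder_id. Qed.
Lemma cdiff_plus (f g : C -> C) (z : C) :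
  cdiff f z -> cdiff g z -> cdiff (fun w => f w + g w)%C z.
Proof. intros [a Ha] [b Hb]. eexists. apply cder_plus; eassumption. Qed.
Lemma cdiff_opp (f : C -> C) (z : C) : cdiff f z -> cdiff (fun w => - f w)%C z.
Proof. intros [a Ha]. eexists. apply cder_opp; eassumption. Qed.
Lemma cdiff_minus (f g : C -> C) (z : C) :
  cdiff f z -> cdiff g z -> cdiff (fun w => f w - g w)%C z.
Proof. intros [a Ha] [b Hb]. eexists. apply cder_minus; eassumption. Qed.
Lemma cdiff_mult (f g : C -> C) (z : C) :
  cdiff f z -> cdiff g z -> cdiff (fun w => f w * g w)%C z.
Proof. intros [a Ha] [b Hb]. eexists. apply cder_mult; eassumption. Qed.
Lemma cdiff_inv (f : C -> C) (z : C) :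
  cdiff f z -> f z <> 0 -> cdiff (fun w => / f w)%C z.
Proof. intros [a Ha] H. eexists. apply cder_inv; eassumption. Qed.
Lemma cdiff_div (f g : C -> C) (z : C) :
  cdiff f z -> cdiff g z -> g z <> 0 -> cdiff (fun w => f w / g w)%C z.
Proof. intros [a Ha] [b Hb] H. eexists. apply cder_div; eassumption. Qed.
Lemma cdiff_comp (f g : C -> C) (z : C) :
  cdiff f (g z) -> cdiff g z -> cdiff (fun w => f (g w)) z.
Proof. intros [a Ha] [b Hb]. eexists. apply cder_comp; eassumption. Qed.
Lemma cdiff_pow (f : C -> C) (n : nat) (z : C) : cdiff f z -> cdiff (fun w => Cpow (f w) n) z.
Proof. intros H. induction n as [|n IH]; simpl; [apply cdiff_const|now apply cdiff_mult]. Qed.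

Lemma cder_is_derive (f : C -> C) (z l : C) : cder f z l <-> C_derivative f z l.
Proof.
  split.
  - intros [q [Hq [<- E]]]. split; [apply is_linear_scal_l|].
    intros x Hx.
    (* [is_derive] quantifies over every limit [x] of the neighbourhood filter of [z]; separation of
       points leaves only [z] itself. *)
    assert (Ex : x = z).
    { symmetry. apply Cminus_eq_0, Cmod_small_0. intros e He. left.
      destruct (Hx (fun y : C => Cmod (y - x) < e)) as [d Hd].
      - exists (mkposreal e He). intros y Hy. exact Hy.
      - apply Hd. change (Cmod (z - z) < d).
        replace (z - z)%C with (RtoC 0) by ring. rewrite Cmod_0. apply cond_pos. }
    subst x.
    intros [e He]. destruct (Hq e He) as [d [Hd H]]. exists (mkposreal d Hd).
    intros w Hw. change (Cmod (f w - f z - (w - z) * q z) <= e * Cmod (w - z)).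
    rewrite (E w).
    replace (f z + q w * (w - z) - f z - (w - z) * q z)%C
      with ((q w - q z) * (w - z))%C by ring.
    rewrite Cmod_mult. apply Rmult_le_compat_r; [apply Cmod_ge_0|].
    left. apply H. exact Hw.
  - intros [_ H].
    assert (H0 := H z (fun P HP => HP)). clear H.
    set (q := (fun w => if Ceq_dec w z then l else (f w - f z) / (w - z))%C).
    assert (Q : q z = l) by (unfold q; now destruct (Ceq_dec z z)).
    exists q. split; [|split; [exact Q|]].
    + intros e He.
      assert (He2 : 0 < e / 2) by lra.
      destruct (H0 (mkposreal _ He2)) as [[d Hd] H]. exists d. split; [exact Hd|].
      intros w Hw. rewrite Q. unfold q. destruct (Ceq_dec w z) as [->|Hn].
      * replace (l - l)%C with (RtoC 0) by ring. now rewrite Cmod_0.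
      * assert (Hz := Cminus_neq_0 _ _ Hn). assert (P := proj1 (Cmod_gt_0 _) Hz).
        assert (T : Cmod (f w - f z - (w - z) * l) <= e / 2 * Cmod (w - z)) by (apply H; exact Hw).
        replace ((f w - f z) / (w - z) - l)%C
          with ((f w - f z - (w - z) * l) / (w - z))%C by (field; exact Hz).
        rewrite Cmod_div by exact Hz.
        apply Rmult_lt_reg_r with (Cmod (w - z)); [exact P|].
        unfold Rdiv. rewrite Rmult_assoc, Rinv_l, Rmult_1_r by lra. nra.
    + intros w. unfold q. destruct (Ceq_dec w z) as [->|Hn]; [ring|].
      field. now apply Cminus_neq_0.
Qed.

Lemma cder_C_derive (f : C -> C) (z l : C) : cder f z l -> C_derive f z = l.
Proof. intros H. apply is_C_derive_unique. now apply cder_is_derive. Qed.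

Lemma cdiff_C_derive (f : C -> C) (z : C) : cdiff f z -> cder f z (C_derive f z).
Proof. intros [l H]. now rewrite (cder_C_derive _ _ _ H). Qed.

Lemma cdiff_iff (f : C -> C) (z : C) : cdiff f z <-> C_differentiable f z.
Proof.
  split; intros [l H]; exists l; now apply cder_is_derive.
Qed.

(** * Integrals of complex-valued functions of a real variable *)

(** Continuity of a path is read off its extension [z |-> c (Re z)] to the plane. *)
Definition contp (c : R -> C) (t : R) : Prop := cont (fun z => c (Re z)) (RtoC t).

Lemma contp_iff (c : R -> C) (t : R) : contp c t <->
  forall e : R, 0 < e -> exists d : R, 0 < d /\
    forall s : R, Rabs (s - t) < d -> Cmod (c s - c t) < e.
Proof.
  split; intros H e He; destruct (H e He) as [d [Hd Hs]]; exists d; (split; [exact Hd|]).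
  - intros s Hst. apply (Hs (RtoC s)). now rewrite <- RtoC_minus, Cmod_R.
  - intros z Hz. apply Hs. eapply Rle_lt_trans; [|exact Hz].
    replace (Re z - t) with (Re (z - RtoC t)) by (unfold Re, Cminus; simpl; ring). apply re_le_Cmod.
Qed.

(** Stated on the two components, because the fundamental theorem of calculus is applied to the real
    and the imaginary part separately. *)
Definition pder (c : R -> C) (t : R) (l : C) : Prop :=
  is_derive (fun s => Re (c s)) t (Re l) /\ is_derive (fun s => Im (c s)) t (Im l).

Definition Cint (f : R -> C) (a b : R) : C := @RInt C_R_CompleteNormedModule f a b.

Lemma contp_const (z : C) (t : R) : contp (fun _ => z) t.
Proof. apply cont_const. Qed.

Lemma contp_comp (f : C -> C) (c : R -> C) (t : R) :
  contp c t -> cont f (c t) -> contp (fun s => f (c s)) t.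
Proof. apply (cont_comp f (fun z => c (Re z))). Qed.

Lemma contp_plus (f g : R -> C) (t : R) :
  contp f t -> contp g t -> contp (fun s => f s + g s)%C t.
Proof. apply (cont_plus (fun z => f (Re z)) (fun z => g (Re z))). Qed.

Lemma contp_mult (f g : R -> C) (t : R) :
  contp f t -> contp g t -> contp (fun s => f s * g s)%C t.
Proof. apply (cont_mult (fun z => f (Re z)) (fun z => g (Re z))). Qed.

Lemma contp_conj (f : R -> C) (t : R) : contp f t -> contp (fun s => Cconj (f s)) t.
Proof.
  intros H e He. generalize (H e He). apply nearC_imp.
  intros w Hw. now rewrite <- Cminus_conj, Cmod_conj.
Qed.

Lemma contp_pow (f : R -> C) (n : nat) (t : R) : contp f t -> contp (fun s => Cpow (f s) n) t.
Proof. intros H. induction n as [|n IH]; simpl; [apply contp_const|now apply contp_mult]. Qed.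

Lemma contp_minus (f g : R -> C) (t : R) :
  contp f t -> contp g t -> contp (fun s => f s - g s)%C t.
Proof. apply (cont_minus (fun z => f (Re z)) (fun z => g (Re z))). Qed.

Lemma contp_inv (f : R -> C) (t : R) : contp f t -> f t <> 0 -> contp (fun s => / f s)%C t.
Proof. apply (cont_inv (fun z => f (Re z))). Qed.

Lemma contp_div (f g : R -> C) (t : R) :
  contp f t -> contp g t -> g t <> 0 -> contp (fun s => f s / g s)%C t.
Proof. intros Hf Hg H. apply contp_mult; [exact Hf|now apply contp_inv]. Qed.

Lemma contp_continuous (f : R -> C) (t : R) :
  contp f t -> @continuous R_UniformSpace C_R_CompleteNormedModule f t.
Proof.
  intros H. apply filterlim_locally. intros [e He].
  destruct (proj1 (contp_iff f t) H e He) as [d [Hd Hs]]. exists (mkposreal d Hd). intros s Hsd.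
  apply (C_NormedModule_mixin_compat1 (f t) (f s) e). apply Hs. exact Hsd.
Qed.

Lemma contp_re_im (c : R -> C) (t : R) :
  continuous (fun s => Re (c s)) t -> continuous (fun s => Im (c s)) t -> contp c t.
Proof.
  intros H1 H2. apply contp_iff. intros e He.
  assert (He2 : 0 < e / 2) by lra.
  destruct (proj1 (filterlim_locally _ _) H1 (mkposreal _ He2)) as [[d1 Hd1] P1].
  destruct (proj1 (filterlim_locally _ _) H2 (mkposreal _ He2)) as [[d2 Hd2] P2].
  exists (Rmin d1 d2). split; [now apply Rmin_glb_lt|].
  intros s Hs. assert (L1 := Rmin_l d1 d2). assert (L2 := Rmin_r d1 d2).
  assert (Q1 : Rabs (Re (c s) - Re (c t)) < e / 2).
  { apply (P1 s). change (Rabs (s - t) < d1). lra. }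
  assert (Q2 : Rabs (Im (c s) - Im (c t)) < e / 2).
  { apply (P2 s). change (Rabs (s - t) < d2). lra. }
  replace (c s - c t)%C
    with (RtoC (Re (c s) - Re (c t)) + Ci * RtoC (Im (c s) - Im (c t)))%C.
  - eapply Rle_lt_trans; [apply Cmod_triangle|].
    rewrite Cmod_mult, !Cmod_R, Cmod_Ci. lra.
  - apply injective_projections; simpl; unfold Re, Im; ring.
Qed.

Lemma pder_contp (c : R -> C) (t : R) (l : C) : pder c t l -> contp c t.
Proof.
  intros [H1 H2]. apply contp_re_im; apply @ex_derive_continuous; eexists; eassumption.
Qed.

Lemma pder_const (z : C) (t : R) : pder (fun _ => z) t 0.
Proof. split; apply @is_derive_const. Qed.

Lemma pder_plus (c d : R -> C) (t : R) (l m : C) :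
  pder c t l -> pder d t m -> pder (fun s => c s + d s)%C t (l + m).
Proof. intros [H1 H2] [H3 H4]. split; apply @is_derive_plus; assumption. Qed.

Lemma pder_minus (c d : R -> C) (t : R) (l m : C) :
  pder c t l -> pder d t m -> pder (fun s => c s - d s)%C t (l - m).
Proof. intros [H1 H2] [H3 H4]. split; apply (is_derive_minus (V := R_NormedModule)); assumption. Qed.

Lemma pder_eq (c : R -> C) (t : R) (l l' : C) : l = l' -> pder c t l -> pder c t l'.
Proof. now intros ->. Qed.

Lemma pder_mult (c d : R -> C) (t : R) (l m : C) :
  pder c t l -> pder d t m -> pder (fun s => c s * d s)%C t (l * d t + c t * m).
Proof.
  intros [H1 H2] [H3 H4]. split.
  - replace (Re (l * d t + c t * m))
      with ((Re l * Re (d t) + Re (c t) * Re m) - (Im l * Im (d t) + Im (c t) * Im m))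
      by (unfold Re, Im; simpl; ring).
    apply (is_derive_minus (V := R_NormedModule)
      (fun s => Re (c s) * Re (d s)) (fun s => Im (c s) * Im (d s)));
    apply (is_derive_mult (K := R_AbsRing)); auto; intros; apply Rmult_comm.
  - replace (Im (l * d t + c t * m))
      with ((Re l * Im (d t) + Re (c t) * Im m) + (Im l * Re (d t) + Im (c t) * Re m))
      by (unfold Re, Im; simpl; ring).
    apply (is_derive_plus (V := R_NormedModule)
      (fun s => Re (c s) * Im (d s)) (fun s => Im (c s) * Re (d s)));
    apply (is_derive_mult (K := R_AbsRing)); auto; intros; apply Rmult_comm.
Qed.

Lemma pder_R (f : R -> R) (t l : R) : is_derive f t l -> pder (fun s => RtoC (f s)) t (RtoC l).
Proof. intros H. split; [exact H|exact (is_derive_const (V := R_NormedModule) 0 t)]. Qed.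

Lemma pder_RtoC (t : R) : pder (fun s => RtoC s) t 1.
Proof. apply pder_R. exact (is_derive_id (K := R_AbsRing) t). Qed.

Section Integral.

Variables (a b : R).
Hypothesis ab : a <= b.

Definition contI (f : R -> C) : Prop := forall t : R, a <= t <= b -> contp f t.

Lemma ex_Cint (f : R -> C) : contI f -> @ex_RInt C_R_CompleteNormedModule f a b.
Proof.
  intros H. apply (ex_RInt_continuous (V := C_R_CompleteNormedModule)).
  intros t. rewrite Rmin_left, Rmax_right by exact ab. intros Ht.
  now apply contp_continuous, H.
Qed.

Lemma Cint_correct (f : R -> C) : contI f -> @is_RInt C_R_NormedModule f a b (Cint f a b).
Proof. intros H. apply (RInt_correct (V := C_R_CompleteNormedModule)). now apply ex_Cint. Qed.

Lemma Cint_unique (f : R -> C) (l : C) : @is_RInt C_R_NormedModule f a b l -> Cint f a b = l.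
Proof. intros H. now apply (is_RInt_unique (V := C_R_CompleteNormedModule)). Qed.

Lemma Cint_ext (f g : R -> C) :
  (forall t : R, a <= t <= b -> f t = g t) -> Cint f a b = Cint g a b.
Proof.
  intros H. apply (RInt_ext (V := C_R_CompleteNormedModule)).
  rewrite Rmin_left, Rmax_right by exact ab. intros t Ht. apply H. lra.
Qed.

Lemma Cint_plus (f g : R -> C) : contI f -> contI g ->
  Cint (fun t => f t + g t)%C a b = (Cint f a b + Cint g a b)%C.
Proof.
  intros Hf Hg. apply Cint_unique.
  apply (is_RInt_plus (V := C_R_NormedModule)); now apply Cint_correct.
Qed.

Lemma Cint_minus (f g : R -> C) : contI f -> contI g ->
  Cint (fun t => f t - g t)%C a b = (Cint f a b - Cint g a b)%C.
Proof.
  intros Hf Hg. apply Cint_unique.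
  apply (is_RInt_minus (V := C_R_NormedModule)); now apply Cint_correct.
Qed.

Lemma is_RInt_Re (f : R -> C) : contI f ->
  is_RInt (fun t => Re (f t)) a b (Re (Cint f a b)).
Proof.
  intros H. exact (is_RInt_fct_extend_fst (U := R_NormedModule) (V := R_NormedModule)
    f a b (Cint f a b) (Cint_correct f H)).
Qed.

Lemma is_RInt_Im (f : R -> C) : contI f ->
  is_RInt (fun t => Im (f t)) a b (Im (Cint f a b)).
Proof.
  intros H. exact (is_RInt_fct_extend_snd (U := R_NormedModule) (V := R_NormedModule)
    f a b (Cint f a b) (Cint_correct f H)).
Qed.

Lemma Cint_re_im (f : R -> C) (x y : R) :
  is_RInt (fun t => Re (f t)) a b x -> is_RInt (fun t => Im (f t)) a b y ->
  Cint f a b = (x, y).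
Proof.
  intros H1 H2. apply Cint_unique.
  exact (is_RInt_fct_extend_pair (U := R_NormedModule) (V := R_NormedModule) f a b x y H1 H2).
Qed.

(** The module in which [Cint] is formed has real scalars, so a complex factor has to be pulled out
    through the components. *)
Lemma Cint_scal (c : C) (f : R -> C) : contI f ->
  Cint (fun t => c * f t)%C a b = (c * Cint f a b)%C.
Proof.
  intros H. assert (H1 := is_RInt_Re f H). assert (H2 := is_RInt_Im f H).
  rewrite (Cint_re_im (fun t => c * f t)%C
    (Re c * Re (Cint f a b) - Im c * Im (Cint f a b))
    (Re c * Im (Cint f a b) + Im c * Re (Cint f a b))).
  - reflexivity.
  - apply (is_RInt_minus (V := R_NormedModule) (fun t => Re c * Re (f t)) (fun t => Im c * Im (f t)));
    apply (is_RInt_scal (V := R_NormedModule)); assumption.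
  - apply (is_RInt_plus (V := R_NormedModule) (fun t => Re c * Im (f t)) (fun t => Im c * Re (f t)));
    apply (is_RInt_scal (V := R_NormedModule)); assumption.
Qed.

Lemma Cint_conj (f : R -> C) : contI f ->
  Cint (fun t => Cconj (f t)) a b = Cconj (Cint f a b).
Proof.
  intros H. apply Cint_re_im.
  - exact (is_RInt_Re f H).
  - apply (is_RInt_opp (V := R_NormedModule)). exact (is_RInt_Im f H).
Qed.

Lemma Cint_le (f : R -> C) (M : R) : contI f ->
  (forall t : R, a <= t <= b -> Cmod (f t) <= M) -> Cmod (Cint f a b) <= (b - a) * M.
Proof.
  intros H HM. rewrite Cmod_norm.
  apply (norm_RInt_le_const (V := C_R_NormedModule) f a b (Cint f a b) M ab).
  - intros t Ht. change (@norm R_AbsRing C_R_NormedModule (f t) <= M).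
    rewrite <- Cmod_norm. now apply HM.
  - now apply Cint_correct.
Qed.

Lemma Cint_FTC (c dc : R -> C) : (forall t : R, a <= t <= b -> pder c t (dc t)) ->
  contI dc -> Cint dc a b = (c b - c a)%C.
Proof.
  intros H Hc.
  assert (Hre : forall t, a <= t <= b -> continuous (fun s => Re (dc s)) t).
  { intros t Ht. apply (continuous_comp dc (fun z : C => fst z)).
    - exact (contp_continuous _ _ (Hc t Ht)).
    - apply (continuous_fst (U := R_UniformSpace) (V := R_UniformSpace)). }
  assert (Him : forall t, a <= t <= b -> continuous (fun s => Im (dc s)) t).
  { intros t Ht. apply (continuous_comp dc (fun z : C => snd z)).
    - exact (contp_continuous _ _ (Hc t Ht)).
    - apply (continuous_snd (U := R_UniformSpace) (V := R_UniformSpace)). }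
  apply Cint_re_im.
  - apply (is_RInt_derive (V := R_CompleteNormedModule) (fun s => Re (c s)));
    rewrite Rmin_left, Rmax_right by exact ab; [intros t Ht; now apply H|exact Hre].
  - apply (is_RInt_derive (V := R_CompleteNormedModule) (fun s => Im (c s)));
    rewrite Rmin_left, Rmax_right by exact ab; [intros t Ht; now apply H|exact Him].
Qed.

End Integral.

Lemma Cint_Chasles (f : R -> C) (a b c : R) : a <= b <= c -> contI a c f ->
  Cint f a c = (Cint f a b + Cint f b c)%C.
Proof.
  intros H Hf. symmetry.
  apply (RInt_Chasles (V := C_R_CompleteNormedModule)); apply ex_Cint; try lra;
  intros t Ht; apply Hf; lra.
Qed.

(** * Goursat's theorem *)

(** Every left endpoint lies below every right endpoint, so the supremum of the left endpoints
    belongs to all the intervals. *)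
Lemma nested_intervals (x l : nat -> R) :
  (forall n, 0 <= l n) -> (forall n, x n <= x (S n)) ->
  (forall n, x (S n) + l (S n) <= x n + l n) ->
  exists t : R, forall n, x n <= t <= x n + l n.
Proof.
  intros Hl Hx Hy.
  assert (M1 : forall n k, x n <= x (n + k)%nat).
  { intros n k. induction k as [|k IH]; [rewrite Nat.add_0_r; lra|].
    rewrite Nat.add_succ_r. specialize (Hx (n + k)%nat). lra. }
  assert (M2 : forall n k, x (n + k)%nat + l (n + k)%nat <= x n + l n).
  { intros n k. induction k as [|k IH]; [rewrite Nat.add_0_r; lra|].
    rewrite Nat.add_succ_r. specialize (Hy (n + k)%nat). lra. }
  assert (M : forall n m, x m <= x n + l n).
  { intros n m. destruct (Nat.le_ge_cases n m) as [H|H].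
    - replace m with (n + (m - n))%nat by lia. specialize (M2 n (m - n)%nat).
      specialize (Hl (n + (m - n))%nat). lra.
    - assert (E := M1 m (n - m)%nat). replace (m + (n - m))%nat with n in E by lia.
      specialize (Hl n). lra. }
  destruct (completeness (fun y => exists n, y = x n)) as [t [T1 T2]].
  - exists (x 0%nat + l 0%nat). intros y [n ->]. apply M.
  - exists (x 0%nat). now exists 0%nat.
  - exists t. intros n. split; [apply T1; now exists n|].
    apply T2. intros y [m ->]. apply M.
Qed.

Section Bisection.

Variables (W : R -> R -> R -> R -> C) (A B C1 D : R).
Hypothesis AB : A < B.
Hypothesis CD : C1 < D.
Hypothesis add1 : forall a m b c d, A <= a <= m -> m <= b <= B -> C1 <= c <= d -> d <= D ->
  W a b c d = (W a m c d + W m b c d)%C.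
Hypothesis add2 : forall a b c m d, A <= a <= b -> b <= B -> C1 <= c <= m -> m <= d <= D ->
  W a b c d = (W a b c m + W a b m d)%C.
Hypothesis small : forall t s, A <= t <= B -> C1 <= s <= D -> forall e, 0 < e ->
  exists r, 0 < r /\ forall a b c d, A <= a <= t -> t <= b <= B -> C1 <= c <= s -> s <= d <= D ->
    b - a < r -> d - c < r -> Cmod (W a b c d) <= e * ((b - a) + (d - c)) ^ 2.

Let size (n : nat) (x y : R) : R :=
  Cmod (W x (x + (B - A) / 2 ^ n) y (y + (D - C1) / 2 ^ n)).

(** Additivity in both directions writes [W] as a sum over four quarters, and by the triangle
    inequality one of them carries at least a fourth of the modulus. *)
Lemma quarter (n : nat) (x y : R) :
  A <= x -> x + (B - A) / 2 ^ n <= B -> C1 <= y -> y + (D - C1) / 2 ^ n <= D ->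
  exists p : R * R,
    (x <= fst p /\ fst p + (B - A) / 2 ^ S n <= x + (B - A) / 2 ^ n) /\
    (y <= snd p /\ snd p + (D - C1) / 2 ^ S n <= y + (D - C1) / 2 ^ n) /\
    size n x y / 4 <= size (S n) (fst p) (snd p).
Proof.
  intros Hx1 Hx2 Hy1 Hy2.
  assert (P2 : 0 < 2 ^ n) by (apply pow_lt; lra).
  set (l := (B - A) / 2 ^ S n). set (h := (D - C1) / 2 ^ S n).
  assert (El : (B - A) / 2 ^ n = l + l) by (unfold l; simpl; field; lra).
  assert (Eh : (D - C1) / 2 ^ n = h + h) by (unfold h; simpl; field; lra).
  assert (Pl : 0 < l) by (apply Rdiv_lt_0_compat; [lra|apply pow_lt; lra]).
  assert (Ph : 0 < h) by (apply Rdiv_lt_0_compat; [lra|apply pow_lt; lra]).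
  unfold size. fold l h. rewrite El, Eh in *.
  assert (E : W x (x + (l + l)) y (y + (h + h)) =
    ((W x (x + l) y (y + h) + W x (x + l) (y + h) (y + h + h)) +
     (W (x + l) (x + l + l) y (y + h) + W (x + l) (x + l + l) (y + h) (y + h + h)))%C).
  { rewrite (add1 x (x + l)) by lra. f_equal.
    - rewrite (add2 x (x + l) y (y + h)) by lra. f_equal. f_equal; ring.
    - rewrite (add2 (x + l) _ y (y + h)) by lra. f_equal; f_equal; ring. }
  assert (T := Cmod_triangle (W x (x + l) y (y + h) + W x (x + l) (y + h) (y + h + h))
    (W (x + l) (x + l + l) y (y + h) + W (x + l) (x + l + l) (y + h) (y + h + h))).
  rewrite <- E in T.
  assert (T1 := Cmod_triangle (W x (x + l) y (y + h)) (W x (x + l) (y + h) (y + h + h))).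
  assert (T2 := Cmod_triangle (W (x + l) (x + l + l) y (y + h)) (W (x + l) (x + l + l) (y + h) (y + h + h))).
  set (M := Cmod (W x (x + (l + l)) y (y + (h + h)))) in *.
  destruct (Rle_dec (M / 4) (Cmod (W x (x + l) y (y + h)))) as [H1|H1];
    [exists (x, y); cbn [fst snd]; repeat split; lra|].
  destruct (Rle_dec (M / 4) (Cmod (W x (x + l) (y + h) (y + h + h)))) as [H2|H2];
    [exists (x, y + h); cbn [fst snd]; repeat split; lra|].
  destruct (Rle_dec (M / 4) (Cmod (W (x + l) (x + l + l) y (y + h)))) as [H3|H3];
    [exists (x + l, y); cbn [fst snd]; repeat split; lra|].
  exists (x + l, y + h); cbn [fst snd]; repeat split; lra.
Qed.

(** Choosing a heavy quarter again and again leaves a rectangle with sides divided by [2^n] on which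
    the modulus is at least that of [W A B C1 D] divided by [4^n]. At the common point [small]
    bounds it by an arbitrarily small multiple of [1 / 4^n], so the powers of four cancel. *)
Lemma bisection : W A B C1 D = 0.
Proof.
  set (good := fun n (p : R * R) => (A <= fst p /\ fst p + (B - A) / 2 ^ n <= B) /\
    (C1 <= snd p /\ snd p + (D - C1) / 2 ^ n <= D)).
  (* The implication sits under the existential so that choice yields a total function on pairs; a
     pair that is not good is simply returned. *)
  assert (step : forall n (p : R * R), exists q : R * R, good n p ->
    good (S n) q /\ (fst p <= fst q /\ fst q + (B - A) / 2 ^ S n <= fst p + (B - A) / 2 ^ n) /\
    (snd p <= snd q /\ snd q + (D - C1) / 2 ^ S n <= snd p + (D - C1) / 2 ^ n) /\
    size n (fst p) (snd p) / 4 <= size (S n) (fst q) (snd q)).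
  { intros n p. destruct (classic (good n p)) as [[[G1 G2] [G3 G4]]|G]; [|exists p; tauto].
    destruct (quarter n (fst p) (snd p) G1 G2 G3 G4) as [q [H1 [H2 H3]]].
    exists q. intros _. split; [|now split; [|split]]. unfold good. lra. }
  set (f := fun n p => proj1_sig (constructive_indefinite_description _ (step n p))).
  assert (Hf : forall n p, good n p -> good (S n) (f n p) /\
    (fst p <= fst (f n p) /\ fst (f n p) + (B - A) / 2 ^ S n <= fst p + (B - A) / 2 ^ n) /\
    (snd p <= snd (f n p) /\ snd (f n p) + (D - C1) / 2 ^ S n <= snd p + (D - C1) / 2 ^ n) /\
    size n (fst p) (snd p) / 4 <= size (S n) (fst (f n p)) (snd (f n p))).
  { intros n p. exact (proj2_sig (constructive_indefinite_description _ (step n p))). }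
  clearbody f. clear step.
  set (s := nat_rect (fun _ => (R * R)%type) (A, C1) f).
  assert (G : forall n, good n (s n)).
  { induction n as [|n IH]; [unfold good, s; simpl; lra|]. apply Hf. exact IH. }
  assert (Z : forall n, Cmod (W A B C1 D) / 4 ^ n <= size n (fst (s n)) (snd (s n))).
  { induction n as [|n IH].
    - unfold size, s; simpl. right.
      replace (A + (B - A) / 1) with B by field. replace (C1 + (D - C1) / 1) with D by field. field.
    - destruct (Hf n (s n) (G n)) as [_ [_ [_ H]]].
      change (s (S n)) with (f n (s n)). simpl pow.
      replace (Cmod (W A B C1 D) / (4 * 4 ^ n)) with (Cmod (W A B C1 D) / 4 ^ n / 4); [lra|].
      field. apply pow_nonzero. lra. }
  assert (P2 : forall n, 0 < 2 ^ n) by (intros n; apply pow_lt; lra).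
  destruct (nested_intervals (fun n => fst (s n)) (fun n => (B - A) / 2 ^ n)) as [t Ht].
  { intros n. left. apply Rdiv_lt_0_compat; [lra|apply P2]. }
  { intros n. apply (Hf n (s n) (G n)). }
  { intros n. apply (Hf n (s n) (G n)). }
  destruct (nested_intervals (fun n => snd (s n)) (fun n => (D - C1) / 2 ^ n)) as [u Hu].
  { intros n. left. apply Rdiv_lt_0_compat; [lra|apply P2]. }
  { intros n. apply (Hf n (s n) (G n)). }
  { intros n. apply (Hf n (s n) (G n)). }
  set (L := (B - A) + (D - C1)). assert (PL : 0 < L) by (unfold L; lra).
  apply Cmod_small_0. intros e He.
  (* After [n] halvings the half-perimeter is [L / 2^n]; dividing [e] by [L^2] turns the quadratic
     bound into [e / 4^n]. *)
  destruct (small t u) with (e := e / L ^ 2) as [r [Hr H]].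
  { specialize (Ht 0%nat). unfold s in Ht; simpl in Ht. lra. }
  { specialize (Hu 0%nat). unfold s in Hu; simpl in Hu. lra. }
  { apply Rdiv_lt_0_compat; [lra|now apply pow_lt]. }
  destruct (Pow_x_infinity 2) with (b := L / r + 1) as [n Hn]; [rewrite Rabs_pos_eq; lra|].
  specialize (Hn n (le_n n)). rewrite Rabs_pos_eq in Hn by (left; apply P2).
  assert (Hn' : L / 2 ^ n < r).
  { apply Rmult_lt_reg_r with (2 ^ n); [apply P2|].
    unfold Rdiv. rewrite Rmult_assoc, Rinv_l, Rmult_1_r by (apply Rgt_not_eq, P2).
    apply Rmult_lt_reg_r with (/ r); [now apply Rinv_0_lt_compat|].
    replace (r * 2 ^ n * / r) with (2 ^ n) by (field; lra). unfold Rdiv in Hn. lra. }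
  assert (D1 : 0 < (B - A) / 2 ^ n) by (apply Rdiv_lt_0_compat; [lra|apply P2]).
  assert (D2 : 0 < (D - C1) / 2 ^ n) by (apply Rdiv_lt_0_compat; [lra|apply P2]).
  assert (DL : L / 2 ^ n = (B - A) / 2 ^ n + (D - C1) / 2 ^ n) by (unfold L; field; apply Rgt_not_eq, P2).
  specialize (Ht n). specialize (Hu n). destruct (G n) as [G1 G2].
  specialize (H (fst (s n)) (fst (s n) + (B - A) / 2 ^ n) (snd (s n)) (snd (s n) + (D - C1) / 2 ^ n)).
  specialize (H ltac:(lra) ltac:(lra) ltac:(lra) ltac:(lra) ltac:(lra) ltac:(lra)).
  specialize (Z n). unfold size in Z.
  assert (F : Cmod (W A B C1 D) / 4 ^ n <= e / L ^ 2 * (L / 2 ^ n) ^ 2).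
  { eapply Rle_trans; [exact Z|]. eapply Rle_trans; [exact H|]. right. rewrite DL. f_equal. f_equal. ring. }
  replace (e / L ^ 2 * (L / 2 ^ n) ^ 2) with (e / 4 ^ n) in F.
  - apply Rmult_le_reg_r with (/ 4 ^ n); [apply Rinv_0_lt_compat, pow_lt; lra|exact F].
  - replace 4 with (2 * 2) by ring. rewrite Rpow_mult_distr. field. split; [|lra].
    apply Rgt_not_eq, P2.
Qed.

End Bisection.

Section Goursat.

Variables (f : C -> C) (g gt gs : R -> R -> C) (A B C1 D L : R).
Hypothesis AB : A < B.
Hypothesis CD : C1 < D.
Hypothesis L0 : 0 < L.
Hypothesis Dt : forall t s, A <= t <= B -> C1 <= s <= D -> pder (fun t => g t s) t (gt t s).
Hypothesis Ds : forall t s, A <= t <= B -> C1 <= s <= D -> pder (fun s => g t s) s (gs t s).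
Hypothesis Ct : forall t s, A <= t <= B -> C1 <= s <= D -> contp (fun t => gt t s) t.
Hypothesis Cs : forall t s, A <= t <= B -> C1 <= s <= D -> contp (fun s => gs t s) s.
Hypothesis Bt : forall t s, A <= t <= B -> C1 <= s <= D -> Cmod (gt t s) <= L.
Hypothesis Bs : forall t s, A <= t <= B -> C1 <= s <= D -> Cmod (gs t s) <= L.
Hypothesis Lip : forall t s t' s', A <= t <= B -> C1 <= s <= D -> A <= t' <= B -> C1 <= s' <= D ->
  Cmod (g t s - g t' s') <= L * (Rabs (t - t') + Rabs (s - s')).
Hypothesis F : forall t s, A <= t <= B -> C1 <= s <= D -> cdiff f (g t s).

(** The affine function [al + be * u] has the primitive [P], so its integral along the path is an
    increment of [P]; the error is the length of the parameter interval times the distance of [f]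
    from the affine function times the speed. *)
Lemma path_affine_approx (c dc : R -> C) (a b K : R) (al be : C) :
  a <= b ->
  (forall t, a <= t <= b -> pder c t (dc t)) -> (forall t, a <= t <= b -> contp dc t) ->
  (forall t, a <= t <= b -> Cmod (dc t) <= L) ->
  (forall t, a <= t <= b -> cdiff f (c t)) ->
  (forall t, a <= t <= b -> Cmod (f (c t) - (al + be * c t)) <= K) ->
  let P := fun u : C => (al * u + be * (u * u) / RtoC 2)%C in
  Cmod (Cint (fun t => f (c t) * dc t)%C a b - (P (c b) - P (c a))) <= (b - a) * (K * L).
Proof.
  intros ab Hc Hdc HL Hf HK P.
  assert (Cc : forall t, a <= t <= b -> contp c t) by (intros t Ht; eapply pder_contp, Hc, Ht).
  assert (C2 : contI a b (fun t => (al + be * c t) * dc t)%C).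
  { intros t Ht. apply contp_mult; [|now apply Hdc].
    apply contp_plus; [apply contp_const|]. apply contp_mult; [apply contp_const|now apply Cc]. }
  assert (C3 : contI a b (fun t => f (c t) * dc t)%C).
  { intros t Ht. apply contp_mult; [|now apply Hdc].
    apply (contp_comp f c); [now apply Cc|]. now apply cdiff_cont, Hf. }
  rewrite <- (Cint_FTC a b ab (fun t => P (c t)) (fun t => (al + be * c t) * dc t)%C); [| |exact C2].
  - rewrite <- Cint_minus by assumption. apply Cint_le; [exact ab| |].
    + intros t Ht. apply contp_minus; [now apply C3|now apply C2].
    + intros t Ht. replace (f (c t) * dc t - (al + be * c t) * dc t)%C
        with ((f (c t) - (al + be * c t)) * dc t)%C by ring.
      rewrite Cmod_mult. apply Rmult_le_compat; auto using Cmod_ge_0.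
  - intros t Ht. unfold P.
    eapply pder_eq; [|apply pder_plus;
      [apply pder_mult; [apply pder_const|apply Hc, Ht]
      |apply pder_mult; [apply pder_mult; [apply pder_const|apply pder_mult; apply Hc, Ht]
        |apply pder_const]]].
    cbv beta. field.
Qed.

Definition sideT (s a b : R) : C := Cint (fun t => f (g t s) * gt t s)%C a b.
Definition sideS (t c d : R) : C := Cint (fun s => f (g t s) * gs t s)%C c d.

Lemma sideT_cont (s a b : R) : C1 <= s <= D -> A <= a -> b <= B ->
  contI a b (fun t => f (g t s) * gt t s)%C.
Proof.
  intros Hs Ha Hb t Ht. apply contp_mult; [|apply Ct; lra].
  apply (contp_comp f (fun t => g t s)); [eapply pder_contp, Dt; lra|apply cdiff_cont, F; lra].
Qed.

Lemma sideS_cont (t c d : R) : A <= t <= B -> C1 <= c -> d <= D ->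
  contI c d (fun s => f (g t s) * gs t s)%C.
Proof.
  intros Ht Hc Hd s Hs. apply contp_mult; [|apply Cs; lra].
  apply (contp_comp f (fun s => g t s)); [eapply pder_contp, Ds; lra|apply cdiff_cont, F; lra].
Qed.

(** The contour is the image under [g] of the boundary of a parameter rectangle, so homotopies of
    closed curves can be inserted directly. On a small rectangle [f] is close to an affine function,
    whose integral around the image of the boundary vanishes; [bisection] does the rest. *)
Lemma goursat :
  (sideT C1 A B + sideS B C1 D - sideT D A B - sideS A C1 D = 0)%C.
Proof.
  apply (bisection (fun a b c d => sideT c a b + sideS b c d - sideT d a b - sideS a c d)%C A B C1 D AB CD).
  - intros a m b c d H1 H2 H3 H4. unfold sideT.
    rewrite (Cint_Chasles _ a m b) by (try apply sideT_cont; lra).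
    rewrite (Cint_Chasles (fun t => f (g t d) * gt t d)%C a m b) by (try apply sideT_cont; lra).
    ring.
  - intros a b c m d H1 H2 H3 H4. unfold sideS.
    rewrite (Cint_Chasles _ c m d) by (try apply sideS_cont; lra).
    rewrite (Cint_Chasles (fun s => f (g a s) * gs a s)%C c m d) by (try apply sideS_cont; lra).
    ring.
  - intros t0 s0 Ht0 Hs0 e He.
    destruct (F t0 s0 Ht0 Hs0) as [l [q [Hq [Hl E]]]].
    set (u0 := g t0 s0) in *.
    (* With half-perimeter [r], points of the image are within [L * r] of [u0], so [f] is within
       [e / (2 * L) * r] of the affine function. The speed is at most [L] and the four sides have
       total length [2 * r], which gives exactly [e * r^2]. *)
    destruct (Hq (e / (2 * L * L))) as [d [Hd Hqd]].
    { apply Rdiv_lt_0_compat; [lra|]. repeat apply Rmult_lt_0_compat; lra. }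
    (* Both sides below [d / (2 * L)] make [L * r] smaller than [d]. *)
    exists (d / (2 * L)). split; [apply Rdiv_lt_0_compat; lra|].
    intros a b c0 d0 H1 H2 H3 H4 H5 H6.
    set (r := (b - a) + (d0 - c0)).
    assert (Hr : L * r < d).
    { apply Rmult_lt_reg_r with (/ L); [now apply Rinv_0_lt_compat|].
      replace (L * r * / L) with r by (field; lra).
      replace (d * / L) with (d / (2 * L) + d / (2 * L)) by (field; lra). unfold r; lra. }
    set (al := (f u0 - l * u0)%C).
    assert (K : forall t s, a <= t <= b -> c0 <= s <= d0 ->
      Cmod (f (g t s) - (al + l * g t s)) <= e / (2 * L) * r).
    { intros t s Ht Hs.
      assert (N : Cmod (g t s - u0) <= L * r).
      { eapply Rle_trans; [apply Lip; lra|]. apply Rmult_le_compat_l; [lra|].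
        unfold r. apply Rplus_le_compat; apply Rabs_le; lra. }
      unfold al. rewrite (E (g t s)).
      replace (f u0 + q (g t s) * (g t s - u0) - (f u0 - l * u0 + l * g t s))%C
        with ((q (g t s) - q u0) * (g t s - u0))%C by (rewrite Hl; ring).
      rewrite Cmod_mult.
      replace (e / (2 * L) * r) with (e / (2 * L * L) * (L * r)) by (field; lra).
      apply Rmult_le_compat; auto using Cmod_ge_0. left. apply Hqd. lra. }
    set (P := fun u : C => (al * u + l * (u * u) / RtoC 2)%C).
    assert (S1 := path_affine_approx (fun t => g t c0) (fun t => gt t c0) a b (e / (2 * L) * r) al l).
    assert (S3 := path_affine_approx (fun t => g t d0) (fun t => gt t d0) a b (e / (2 * L) * r) al l).
    assert (S2 := path_affine_approx (fun s => g b s) (fun s => gs b s) c0 d0 (e / (2 * L) * r) al l).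
    assert (S4 := path_affine_approx (fun s => g a s) (fun s => gs a s) c0 d0 (e / (2 * L) * r) al l).
    cbv zeta in S1, S2, S3, S4. fold P in S1, S2, S3, S4.
    assert (Z1 : Cmod (sideT c0 a b - (P (g b c0) - P (g a c0))) <= (b - a) * (e / (2 * L) * r * L)).
    { apply S1; [lra|intros t Ht..]; [apply Dt|apply Ct|apply Bt|apply F|apply K]; lra. }
    assert (Z3 : Cmod (sideT d0 a b - (P (g b d0) - P (g a d0))) <= (b - a) * (e / (2 * L) * r * L)).
    { apply S3; [lra|intros t Ht..]; [apply Dt|apply Ct|apply Bt|apply F|apply K]; lra. }
    assert (Z2 : Cmod (sideS b c0 d0 - (P (g b d0) - P (g b c0))) <= (d0 - c0) * (e / (2 * L) * r * L)).
    { apply S2; [lra|intros t Ht..]; [apply Ds|apply Cs|apply Bs|apply F|apply K]; lra. }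
    assert (Z4 : Cmod (sideS a c0 d0 - (P (g a d0) - P (g a c0))) <= (d0 - c0) * (e / (2 * L) * r * L)).
    { apply S4; [lra|intros t Ht..]; [apply Ds|apply Cs|apply Bs|apply F|apply K]; lra. }
    clear S1 S2 S3 S4.
    set (x1 := (sideT c0 a b - (P (g b c0) - P (g a c0)))%C) in *.
    set (x2 := (sideS b c0 d0 - (P (g b d0) - P (g b c0)))%C) in *.
    set (x3 := (sideT d0 a b - (P (g b d0) - P (g a d0)))%C) in *.
    set (x4 := (sideS a c0 d0 - (P (g a d0) - P (g a c0)))%C) in *.
    (* The values of the primitive [P] at the four corners cancel, so only the four errors
       remain. *)
    replace (sideT c0 a b + sideS b c0 d0 - sideT d0 a b - sideS a c0 d0)%C
      with ((x1 + x2) + (- x3 + - x4))%C by (unfold x1, x2, x3, x4; ring).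
    assert (T := Cmod_triangle (x1 + x2) (- x3 + - x4)).
    assert (T1 := Cmod_triangle x1 x2). assert (T2 := Cmod_triangle (- x3) (- x4)).
    rewrite !Cmod_opp in T2.
    replace (e / (2 * L) * r * L) with (e * r / 2) in * by (field; lra).
    replace (e * r ^ 2) with (2 * ((b - a) * (e * r / 2)) + 2 * ((d0 - c0) * (e * r / 2)))
      by (unfold r; field).
    clearbody r x1 x2 x3 x4. clear - T T1 T2 Z1 Z2 Z3 Z4. lra.
Qed.

End Goursat.

(** * Cauchy's formula *)

Definition cis (t : R) : C := (cos t, sin t).
Definition circ (r t : R) : C := (RtoC r * cis t)%C.

Lemma Cmod_cis (t : R) : Cmod (cis t) = 1.
Proof.
  assert (H := sin2_cos2 t). unfold Rsqr in H. unfold Cmod, cis; cbn [fst snd].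
  replace (cos t ^ 2 + sin t ^ 2) with 1 by lra. apply sqrt_1.
Qed.

Lemma Cmod_circ (r t : R) : 0 <= r -> Cmod (circ r t) = r.
Proof. intros H. unfold circ. rewrite Cmod_mult, Cmod_cis, Cmod_R, Rabs_pos_eq; lra. Qed.

Lemma pder_cis (t : R) : pder cis t (Ci * cis t).
Proof.
  split.
  - replace (Re (Ci * cis t)) with (- sin t) by (simpl; ring). apply is_derive_cos.
  - replace (Im (Ci * cis t)) with (cos t) by (simpl; ring). apply is_derive_sin.
Qed.

Lemma contp_cis (t : R) : contp cis t.
Proof. eapply pder_contp, pder_cis. Qed.

Lemma pder_circ (r t : R) : pder (circ r) t (Ci * circ r t).
Proof.
  eapply pder_eq; [|apply pder_mult; [apply pder_const|apply pder_cis]].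
  unfold circ. ring.
Qed.

Lemma contp_circ (r t : R) : contp (circ r) t.
Proof. eapply pder_contp, pder_circ. Qed.

(** The chord is the integral of a tangent of unit length. *)
Lemma cis_lip_le (a b : R) : a <= b -> Cmod (cis b - cis a) <= b - a.
Proof.
  intros H.
  assert (Hc : contI a b (fun t => Ci * cis t)%C).
  { intros t _. apply contp_mult; [apply contp_const|apply contp_cis]. }
  rewrite <- (Cint_FTC a b H cis (fun t => Ci * cis t)%C); [|intros; apply pder_cis|exact Hc].
  rewrite <- (Rmult_1_r (b - a)). apply Cint_le; [exact H|exact Hc|].
  intros t _. rewrite Cmod_mult, Cmod_Ci, Cmod_cis. lra.
Qed.

Lemma cis_lip (a b : R) : Cmod (cis a - cis b) <= Rabs (a - b).
Proof.
  destruct (Rle_dec a b) as [H|H].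
  - rewrite Cmod_minus_sym, Rabs_left1 by lra. assert (T := cis_lip_le a b H). lra.
  - rewrite Rabs_pos_eq by lra. apply cis_lip_le. lra.
Qed.

Lemma circ_lip (r a b : R) : 0 <= r -> Cmod (circ r a - circ r b) <= r * Rabs (a - b).
Proof.
  intros H. unfold circ. replace (RtoC r * cis a - RtoC r * cis b)%C with (RtoC r * (cis a - cis b))%C by ring.
  rewrite Cmod_mult, Cmod_R, Rabs_pos_eq by exact H.
  apply Rmult_le_compat_l; [exact H|apply cis_lip].
Qed.

Lemma cis_2PI : cis (2 * PI) = cis 0.
Proof. unfold cis. now rewrite cos_2PI, sin_2PI, cos_0, sin_0. Qed.

Lemma PI2_pos : 0 < 2 * PI.
Proof. assert (H := PI_RGT_0). lra. Qed.

Lemma PI2_pos' : 0 <= 2 * PI.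
Proof. left. exact PI2_pos. Qed.

Lemma PI2_neq : RtoC (2 * PI) <> 0.
Proof. intros E. apply RtoC_inj in E. assert (H := PI2_pos). lra. Qed.

Definition contP (g : R -> C) : Prop := forall t : R, contp g t.

(** Averages over a full turn: for a centred circle this is integration against [du / (2 pi i u)],
    so that Cauchy's formula and its consequences carry no factors of [Ci]. *)
Definition mean (g : R -> C) : C := (Cint g 0 (2 * PI) / RtoC (2 * PI))%C.

Lemma contP_contI (g : R -> C) (a b : R) : contP g -> contI a b g.
Proof. intros H t _. apply H. Qed.

Lemma mean_ext (f g : R -> C) : (forall t, f t = g t) -> mean f = mean g.
Proof. intros H. unfold mean. f_equal. apply Cint_ext; [apply PI2_pos'|auto]. Qed.

Lemma mean_plus (f g : R -> C) : contP f -> contP g ->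
  mean (fun t => f t + g t)%C = (mean f + mean g)%C.
Proof.
  intros Hf Hg. unfold mean. rewrite Cint_plus by auto using PI2_pos', contP_contI.
  field. apply PI2_neq.
Qed.

Lemma mean_minus (f g : R -> C) : contP f -> contP g ->
  mean (fun t => f t - g t)%C = (mean f - mean g)%C.
Proof.
  intros Hf Hg. unfold mean. rewrite Cint_minus by auto using PI2_pos', contP_contI.
  field. apply PI2_neq.
Qed.

Lemma mean_scal (c : C) (f : R -> C) : contP f ->
  mean (fun t => c * f t)%C = (c * mean f)%C.
Proof.
  intros Hf. unfold mean. rewrite Cint_scal by auto using PI2_pos', contP_contI.
  field. apply PI2_neq.
Qed.

Lemma mean_conj (f : R -> C) : contP f -> mean (fun t => Cconj (f t)) = Cconj (mean f).
Proof.
  intros Hf. unfold mean. rewrite Cint_conj by auto using PI2_pos', contP_contI.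
  rewrite Cdiv_conj by apply PI2_neq. do 2 f_equal.
  apply injective_projections; simpl; ring.
Qed.

Lemma mean_le (f : R -> C) (M : R) : contP f -> (forall t, 0 <= t <= 2 * PI -> Cmod (f t) <= M) -> Cmod (mean f) <= M.
Proof.
  intros Hf H. unfold mean. rewrite Cmod_div by apply PI2_neq.
  assert (P := PI2_pos). rewrite Cmod_R, Rabs_pos_eq by lra.
  apply Rmult_le_reg_r with (2 * PI); [exact P|].
  unfold Rdiv. rewrite Rmult_assoc, Rinv_l, Rmult_1_r by lra.
  apply Rle_trans with ((2 * PI - 0) * M); [|right; ring].
  apply Cint_le; auto using PI2_pos', contP_contI.
Qed.

Lemma mean_Re_ge_0 (f : R -> C) : contP f -> (forall t, 0 <= Re (f t)) -> 0 <= Re (mean f).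
Proof.
  intros Hf H. unfold mean.
  assert (P := PI2_pos).
  replace (Re (Cint f 0 (2 * PI) / RtoC (2 * PI))) with (Re (Cint f 0 (2 * PI)) / (2 * PI)).
  - apply Rdiv_le_0_compat; [|exact P].
    apply Rle_trans with ((2 * PI - 0) * 0); [right; ring|].
    apply (is_RInt_le (fun _ => 0) (fun t => Re (f t)) 0 (2 * PI)); [lra| | |auto].
    + exact (is_RInt_const (V := R_NormedModule) 0 (2 * PI) 0).
    + apply is_RInt_Re; auto using PI2_pos', contP_contI.
  - unfold Re. simpl. field. lra.
Qed.

Lemma mean_const (c : C) : mean (fun _ => c) = c.
Proof.
  unfold mean.
  rewrite (Cint_FTC 0 (2 * PI) PI2_pos' (fun t => RtoC t * c)%C (fun _ => c)).
  - field. apply PI2_neq.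
  - intros t _. eapply pder_eq; [|apply pder_mult; [apply pder_RtoC|apply pder_const]].
    cbv beta. ring.
  - intros t _. apply contp_const.
Qed.

Section Cauchy.

Variables (f : C -> C) (r : R).
Hypothesis r0 : 0 < r.
Hypothesis Hf : forall z : C, Cmod z <= r -> cdiff f z.

Lemma circ_minus_neq_0 (z : C) (t : R) : Cmod z < r -> (circ r t - z)%C <> 0.
Proof.
  intros Hz E. apply Cminus_eq_0 in E. rewrite <- E, Cmod_circ in Hz; lra.
Qed.

Lemma circ_minus_ge (z : C) (t : R) : r - Cmod z <= Cmod (circ r t - z).
Proof. rewrite <- (Cmod_circ r t) at 1 by lra. apply Cmod_reverse. Qed.

Lemma contP_on_circ (g : C -> C) : (forall z, Cmod z = r -> cont g z) -> contP (fun t => g (circ r t)).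
Proof.
  intros H t. apply (contp_comp g (circ r)); [apply contp_circ|]. apply H.
  apply Cmod_circ. lra.
Qed.

Lemma Cint_closed_const (k : C) : Cint (fun _ => k) 0 (2 * PI) = (k * RtoC (2 * PI))%C.
Proof.
  transitivity (mean (fun _ => k) * RtoC (2 * PI))%C; [|now rewrite mean_const].
  unfold mean. field. apply PI2_neq.
Qed.

(** The circles [circ r s - t z] with [0 <= t <= 1] avoid the origin because [z] lies inside.
    Goursat for [1/u] along this homotopy compares [t = 1] with [t = 0], where the integrand is the
    constant [Ci]; the edges [s = 0] and [s = 2 pi] cancel because the curves are closed. *)
Lemma winding_number (z : C) : Cmod z < r ->
  Cint (fun t => / (circ r t - z) * (Ci * circ r t))%C 0 (2 * PI) = (Ci * RtoC (2 * PI))%C.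
Proof.
  intros Hz.
  assert (Hcz : forall t s, 0 <= t <= 1 -> (circ r s - RtoC t * z)%C <> 0).
  { intros t s Ht. apply circ_minus_neq_0. rewrite Cmod_mult, Cmod_R, Rabs_pos_eq by lra.
    assert (P := Cmod_ge_0 z). nra. }
  assert (G := goursat (fun u => / u)%C (fun t s => circ r s - RtoC t * z)%C
    (fun _ _ => - z)%C (fun _ s => Ci * circ r s)%C 0 1 0 (2 * PI) (r + Cmod z)).
  assert (Pz := Cmod_ge_0 z). assert (PP := PI2_pos).
  unfold sideT, sideS in G. rewrite <- (Cint_closed_const Ci).
  apply Cminus_eq_0. rewrite <- G; clear G; try lra.
  - replace (circ r (2 * PI)) with (circ r 0) by (unfold circ; now rewrite cis_2PI).
    rewrite (Cint_ext 0 (2 * PI) PI2_pos' (fun s => / (circ r s - RtoC 0 * z) * (Ci * circ r s))%C (fun _ => Ci)).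
    + rewrite (Cint_ext 0 (2 * PI) PI2_pos' (fun s => / (circ r s - RtoC 1 * z) * (Ci * circ r s))%C
        (fun s => / (circ r s - z) * (Ci * circ r s))%C).
      * ring.
      * intros s _. do 2 f_equal. ring.
    + intros s _. field. assert (E := Hcz 0 s ltac:(lra)).
      intros E'; apply E; rewrite E'; ring.
  - intros t s _ _. eapply pder_eq; [|apply pder_minus; [apply pder_const|
      apply pder_mult; [apply pder_RtoC|apply pder_const]]]. cbv beta. ring.
  - intros t s _ _. eapply pder_eq; [|apply pder_minus; [apply pder_circ|apply pder_const]]. ring.
  - intros. apply contp_const.
  - intros t s _ _. apply contp_mult; [apply contp_const|apply contp_circ].
  - intros. rewrite Cmod_opp. lra.
  - intros. rewrite Cmod_mult, Cmod_Ci, Cmod_circ; lra.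
  - intros t s t' s' _ _ _ _.
    replace (circ r s - RtoC t * z - (circ r s' - RtoC t' * z))%C
      with ((circ r s - circ r s') + (RtoC (t' - t) * z))%C by (rewrite RtoC_minus; ring).
    eapply Rle_trans; [apply Cmod_triangle|]. rewrite Cmod_mult, Cmod_R, (Rabs_minus_sym t' t).
    assert (T := circ_lip r s s' ltac:(lra)).
    assert (Q1 := Rabs_pos (t - t')). assert (Q2 := Rabs_pos (s - s')). nra.
  - intros t s Ht _. apply cdiff_inv; [apply cdiff_id|now apply Hcz].
Qed.

(** The circle is contracted towards [z]. Stopping at [d > 0] stays away from the singularity of
    [f u / (u - z)], and the contraction factor cancels between the speed and the denominator. *)
Lemma cauchy_homotopy (z : C) (d : R) : Cmod z < r -> 0 < d < 1 ->
  Cint (fun t => f (circ r t) / (circ r t - z) * (Ci * circ r t))%C 0 (2 * PI) =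
  Cint (fun t => f (z + RtoC d * (circ r t - z)) / (circ r t - z) * (Ci * circ r t))%C 0 (2 * PI).
Proof.
  intros Hz Hd.
  assert (Pz := Cmod_ge_0 z). assert (PP := PI2_pos).
  assert (G := goursat (fun u => f u / (u - z))%C (fun t s => z + RtoC t * (circ r s - z))%C
    (fun _ s => circ r s - z)%C (fun t s => RtoC t * (Ci * circ r s))%C d 1 0 (2 * PI) (r + Cmod z)).
  unfold sideT, sideS in G.
  assert (N0 : forall t, d <= t -> RtoC t <> 0).
  { intros t Ht E. apply RtoC_inj in E. lra. }
  apply Cminus_eq_0. rewrite <- G; clear G; try lra.
  - replace (circ r (2 * PI)) with (circ r 0) by (unfold circ; now rewrite cis_2PI).
    rewrite (Cint_ext 0 (2 * PI) PI2_pos'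
      (fun s => f (z + RtoC 1 * (circ r s - z)) / (z + RtoC 1 * (circ r s - z) - z) * (RtoC 1 * (Ci * circ r s)))%C
      (fun t => f (circ r t) / (circ r t - z) * (Ci * circ r t))%C).
    + rewrite (Cint_ext 0 (2 * PI) PI2_pos'
        (fun s => f (z + RtoC d * (circ r s - z)) / (z + RtoC d * (circ r s - z) - z) * (RtoC d * (Ci * circ r s)))%C
        (fun t => f (z + RtoC d * (circ r t - z)) / (circ r t - z) * (Ci * circ r t))%C).
      * ring.
      * intros s _. assert (Z := circ_minus_neq_0 z s Hz). assert (Z1 := N0 d ltac:(lra)).
        field. split; [exact Z|].
        replace (z + RtoC d * (circ r s - z) - z)%C with (RtoC d * (circ r s - z))%C by ring.
        intros E; destruct (Cmult_integral _ _ E); contradiction.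
    + intros s _. replace (z + RtoC 1 * (circ r s - z))%C with (circ r s) by ring. ring.
  - intros t s _ _. eapply pder_eq; [|apply pder_plus; [apply pder_const|
      apply pder_mult; [apply pder_RtoC|apply pder_const]]]. cbv beta. ring.
  - intros t s _ _. eapply pder_eq; [|apply pder_plus; [apply pder_const|apply pder_mult;
      [apply pder_const|apply pder_minus; [apply pder_circ|apply pder_const]]]]. cbv beta. ring.
  - intros. apply contp_const.
  - intros t s _ _. apply contp_mult; [apply contp_const|].
    apply contp_mult; [apply contp_const|apply contp_circ].
  - intros t s _ _. assert (T := Cmod_triangle (circ r s) (- z)).
    rewrite Cmod_opp, Cmod_circ in T by lra. exact T.
  - intros t s Ht _. rewrite !Cmod_mult, Cmod_Ci, Cmod_circ, Cmod_R, Rabs_pos_eq by lra. nra.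
  - intros t s t' s' Ht _ Ht' _.
    replace (z + RtoC t * (circ r s - z) - (z + RtoC t' * (circ r s' - z)))%C
      with (RtoC t * (circ r s - circ r s') + RtoC (t - t') * (circ r s' - z))%C
      by (rewrite RtoC_minus; ring).
    eapply Rle_trans; [apply Cmod_triangle|]. rewrite !Cmod_mult, !Cmod_R, (Rabs_pos_eq t) by lra.
    assert (T := circ_lip r s s' ltac:(lra)).
    assert (T' := Cmod_triangle (circ r s') (- z)).
    rewrite Cmod_opp, Cmod_circ in T' by lra. change (circ r s' + - z)%C with (circ r s' - z)%C in T'.
    assert (Q1 := Rabs_pos (t - t')). assert (Q2 := Rabs_pos (s - s')).
    assert (Q3 := Cmod_ge_0 (circ r s - circ r s')).
    assert (t * Cmod (circ r s - circ r s') <= r * Rabs (s - s')) by nra.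
    assert (Rabs (t - t') * Cmod (circ r s' - z) <= Rabs (t - t') * (r + Cmod z))
      by (apply Rmult_le_compat_l; lra).
    nra.
  - intros t s Ht _. apply cdiff_div.
    + apply Hf. replace (z + RtoC t * (circ r s - z))%C
        with (RtoC (1 - t) * z + RtoC t * circ r s)%C by (rewrite RtoC_minus; ring).
      eapply Rle_trans; [apply Cmod_triangle|].
      rewrite !Cmod_mult, !Cmod_R, Cmod_circ, !Rabs_pos_eq by lra. nra.
    + apply cdiff_minus; [apply cdiff_id|apply cdiff_const].
    + replace (z + RtoC t * (circ r s - z) - z)%C with (RtoC t * (circ r s - z))%C by ring.
      intros E; destruct (Cmult_integral _ _ E) as [E1|E1]; [|now apply (circ_minus_neq_0 z s)].
      now apply (N0 t).
Qed.

(** As the contraction factor tends to [0], the values of [f] on the shrunken circle tend to [f z]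
    by continuity, and what is left is the winding integral. The formula is then restated with
    [mean], which absorbs [2 pi i]. *)
Lemma cauchy_formula (z : C) : Cmod z < r ->
  f z = mean (fun t => f (circ r t) * circ r t / (circ r t - z))%C.
Proof.
  intros Hz. assert (PP := PI2_pos). assert (Pz := Cmod_ge_0 z).
  assert (Hc : cont f z) by (apply cdiff_cont, Hf; lra).
  set (I := Cint (fun t => f (circ r t) / (circ r t - z) * (Ci * circ r t))%C 0 (2 * PI)).
  assert (Ck : forall k : R -> C, contP k -> contP (fun t => k t / (circ r t - z) * (Ci * circ r t))%C).
  { intros k Hk t. apply contp_mult.
    - apply contp_div; [apply Hk| |now apply circ_minus_neq_0].
      apply contp_minus; [apply contp_circ|apply contp_const].
    - apply contp_mult; [apply contp_const|apply contp_circ]. }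
  assert (Cf : contP (fun t => f (circ r t))).
  { apply contP_on_circ. intros w Hw. apply cdiff_cont, Hf. lra. }
  assert (E : I = (f z * (Ci * RtoC (2 * PI)))%C).
  { apply Cminus_eq_0, Cmod_small_0. intros e He.
    (* An upper bound for the integral of the modulus of the kernel, since the distance from [z] to
       the circle is at least [r - Cmod z]. *)
    set (K := (2 * PI) * (r / (r - Cmod z))).
    assert (PK : 0 < K) by (apply Rmult_lt_0_compat; [lra|apply Rdiv_lt_0_compat; lra]).
    destruct (Hc (e / K)) as [d0 [Hd0 Hw]]; [now apply Rdiv_lt_0_compat|].
    (* Points of the shrunken circle are within [d * (2 * r)] of [z], hence within [d0 / 2]. *)
    set (d := Rmin (1 / 2) (d0 / (4 * r))).
    assert (D1 : d <= 1 / 2) by apply Rmin_l. assert (D2 : d <= d0 / (4 * r)) by apply Rmin_r.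
    assert (Dp : 0 < d) by (apply Rmin_glb_lt; [lra|apply Rdiv_lt_0_compat; lra]).
    unfold I. rewrite (cauchy_homotopy z d Hz) by lra.
    rewrite <- (winding_number z Hz).
    assert (Cg : contP (fun t => f (z + RtoC d * (circ r t - z)))%C).
    { intros t. apply (contp_comp f (fun t => z + RtoC d * (circ r t - z))%C).
      - apply contp_plus; [apply contp_const|]. apply contp_mult; [apply contp_const|].
        apply contp_minus; [apply contp_circ|apply contp_const].
      - apply cdiff_cont, Hf.
        replace (z + RtoC d * (circ r t - z))%C
          with (RtoC (1 - d) * z + RtoC d * circ r t)%C by (rewrite RtoC_minus; ring).
        eapply Rle_trans; [apply Cmod_triangle|].
        rewrite !Cmod_mult, !Cmod_R, Cmod_circ, !Rabs_pos_eq by lra. nra. }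
    assert (C1' : contP (fun t => / (circ r t - z) * (Ci * circ r t))%C).
    { intros t. apply contp_mult; [apply contp_inv; [|now apply circ_minus_neq_0]|
        apply contp_mult; [apply contp_const|apply contp_circ]].
      apply contp_minus; [apply contp_circ|apply contp_const]. }
    rewrite <- Cint_scal by auto using PI2_pos', contP_contI.
    rewrite <- Cint_minus;
      [|apply PI2_pos'|apply contP_contI, (Ck _ Cg)
       |apply contP_contI; intros t; apply contp_mult; [apply contp_const|apply C1']].
    replace e with ((2 * PI - 0) * (e / K * (r / (r - Cmod z)))).
    2: { unfold K. field. repeat split; lra. }
    apply Cint_le; [lra| |].
    - apply contP_contI. intros t. apply contp_minus; [apply (Ck _ Cg)|].
      apply contp_mult; [apply contp_const|apply C1'].
    - intros t _.
      replace (f (z + RtoC d * (circ r t - z)) / (circ r t - z) * (Ci * circ r t) - f z * (/ (circ r t - z) * (Ci * circ r t)))%C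
        with ((f (z + RtoC d * (circ r t - z)) - f z) * ((Ci * circ r t) / (circ r t - z)))%C
        by (field; now apply circ_minus_neq_0).
      rewrite Cmod_mult, Cmod_div, Cmod_mult, Cmod_Ci, Cmod_circ by (try lra; now apply circ_minus_neq_0).
      apply Rmult_le_compat; try apply Cmod_ge_0.
      + apply Rdiv_le_0_compat; [lra|]. apply Cmod_gt_0. now apply circ_minus_neq_0.
      + left. apply Hw. replace (z + RtoC d * (circ r t - z) - z)%C with (RtoC d * (circ r t - z))%C by ring.
        rewrite Cmod_mult, Cmod_R, Rabs_pos_eq by lra.
        assert (T' := Cmod_triangle (circ r t) (- z)).
        rewrite Cmod_opp, Cmod_circ in T' by lra. change (circ r t + - z)%C with (circ r t - z)%C in T'.
        apply Rle_lt_trans with (d * (2 * r)); [apply Rmult_le_compat_l; lra|].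
        apply Rle_lt_trans with (d0 / (4 * r) * (2 * r)); [apply Rmult_le_compat_r; lra|].
        replace (d0 / (4 * r) * (2 * r)) with (d0 / 2) by (field; lra). lra.
      + rewrite Rmult_1_l. unfold Rdiv. apply Rmult_le_compat_l; [lra|].
        apply Rinv_le_contravar; [lra|apply circ_minus_ge]. }
  assert (E2 : (f z * Ci = Ci * mean (fun t => f (circ r t) * circ r t / (circ r t - z)))%C).
  { rewrite <- mean_scal.
    - unfold mean. rewrite (Cint_ext 0 (2 * PI) PI2_pos'
        (fun t => Ci * (f (circ r t) * circ r t / (circ r t - z)))%C
        (fun t => f (circ r t) / (circ r t - z) * (Ci * circ r t))%C).
      + fold I. rewrite E. field. apply PI2_neq.
      + intros t _. field. now apply circ_minus_neq_0.
    - intros t. apply contp_div; [|apply contp_minus; [apply contp_circ|apply contp_const]|now apply circ_minus_neq_0].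
      apply contp_mult; [apply Cf|apply contp_circ]. }
  assert (Ni : Ci <> 0). { intros E0. assert (A0 := Cmod_Ci). rewrite E0, Cmod_0 in A0. lra. }
  set (m := mean _) in *. replace (f z) with (f z * Ci / Ci)%C by (field; exact Ni).
  rewrite E2. field. exact Ni.
Qed.

Lemma mean_value_property : mean (fun t => f (circ r t)) = f 0.
Proof.
  rewrite (cauchy_formula 0) by (rewrite Cmod_0; exact r0).
  apply mean_ext. intros t. field.
  intros E. apply (circ_minus_neq_0 0 t); [rewrite Cmod_0; exact r0|]. rewrite E. ring.
Qed.

End Cauchy.

(** * Regularity, the maximum principle and Schwarz's lemma *)

Lemma contp_Cmod_continuity_pt (v : R -> C) (t : R) : contp v t -> continuity_pt (fun s => Cmod (v s)) t.
Proof.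
  intros H e He. destruct (proj1 (contp_iff v t) H e He) as [d [Hd Hs]]. exists d. split; [exact Hd|].
  intros s [_ Hst]. unfold R_dist in *. simpl in *. unfold R_dist in *.
  specialize (Hs s Hst). eapply Rle_lt_trans; [|exact Hs].
  apply Rabs_le. assert (T1 := Cmod_reverse (v s) (v t)).
  assert (T2 := Cmod_reverse (v t) (v s)). rewrite Cmod_minus_sym in T2. lra.
Qed.

Lemma contP_bounded (v : R -> C) : contP v ->
  exists M, 0 <= M /\ forall t, 0 <= t <= 2 * PI -> Cmod (v t) <= M.
Proof.
  intros H.
  destruct (continuity_ab_maj (fun s => Cmod (v s)) 0 (2 * PI) PI2_pos') as [x [Hx _]].
  { intros t _. apply contp_Cmod_continuity_pt, H. }
  exists (Cmod (v x)). split; [apply Cmod_ge_0|exact Hx].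
Qed.

Lemma mean_cont (k : C -> R -> C) (a : C) (L d : R) : 0 < d ->
  (forall z, Cmod (z - a) < d -> contP (k z)) ->
  (forall z t, Cmod (z - a) < d -> 0 <= t <= 2 * PI -> Cmod (k z t - k a t) <= L * Cmod (z - a)) ->
  cont (fun z => mean (k z)) a.
Proof.
  intros Hd Hk HL e He. exists (Rmin d (e / (Rabs L + 1))).
  assert (PL := Rabs_pos L).
  split; [apply Rmin_glb_lt; [exact Hd|apply Rdiv_lt_0_compat; lra]|].
  intros z Hz. assert (L1 := Rmin_l d (e / (Rabs L + 1))). assert (L2 := Rmin_r d (e / (Rabs L + 1))).
  assert (Ha : contP (k a)).
  { apply Hk. replace (a - a)%C with (RtoC 0) by ring. now rewrite Cmod_0. }
  rewrite <- mean_minus; [|apply Hk; lra|exact Ha].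
  assert (Q := Cmod_ge_0 (z - a)).
  apply Rle_lt_trans with (Rabs L * Cmod (z - a)).
  - apply mean_le.
    + intros t. apply contp_minus; [apply Hk; lra|apply Ha].
    + intros t Ht. eapply Rle_trans; [apply HL; [lra|exact Ht]|].
      apply Rmult_le_compat_r; [exact Q|apply Rle_abs].
  - apply Rle_lt_trans with ((Rabs L + 1) * Cmod (z - a)); [nra|].
    apply Rlt_le_trans with ((Rabs L + 1) * (e / (Rabs L + 1))); [apply Rmult_lt_compat_l; lra|].
    right. field. lra.
Qed.

(** * Cauchy transforms of densities on a circle *)

Section Kernel.

Variable r : R.
Hypothesis r0 : 0 < r.

(** The Cauchy transform of a density on the circle; [K2] is its derivative. Holomorphic functions
    are locally of this form ([anal_kernel]), so their regularity is reduced to that of these two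
    kernels. *)
Definition K1 (v : R -> C) (z : C) : C := mean (fun t => v t / (circ r t - z))%C.
Definition K2 (v : R -> C) (z : C) : C := mean (fun t => v t / ((circ r t - z) * (circ r t - z)))%C.

Lemma contP_div_circ (v : R -> C) (z : C) : Cmod z < r -> contP v ->
  contP (fun t => v t / (circ r t - z))%C.
Proof.
  intros Hz Hv t. apply contp_div; [apply Hv| |now apply circ_minus_neq_0].
  apply contp_minus; [apply contp_circ|apply contp_const].
Qed.

Lemma contP_div_circ2 (v : R -> C) (z : C) : Cmod z < r -> contP v ->
  contP (fun t => v t / ((circ r t - z) * (circ r t - z)))%C.
Proof.
  intros Hz Hv t. assert (N := circ_minus_neq_0 r r0 z t Hz).
  apply contp_div; [apply Hv|apply contp_mult; apply contp_minus; auto using contp_circ, contp_const|].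
  intros E. destruct (Cmult_integral _ _ E); contradiction.
Qed.

Lemma near_in_disk (a z : C) (d : R) : d = (r - Cmod a) / 2 -> Cmod a < r ->
  Cmod (z - a) < d -> Cmod z < r /\ forall t, d <= Cmod (circ r t - z).
Proof.
  intros -> Ha Hz. assert (T := Cmod_reverse z a).
  split; [lra|]. intros t. assert (T' := circ_minus_ge r r0 z t). lra.
Qed.

Lemma K1_cont (v : R -> C) (a : C) : Cmod a < r -> contP v -> cont (K1 v) a.
Proof.
  intros Ha Hv. set (d := (r - Cmod a) / 2). assert (Hd : 0 < d) by (unfold d; lra).
  destruct (contP_bounded v Hv) as [M [M0 HM]].
  apply mean_cont with (d := d) (L := M / (d * d)); [exact Hd| |].
  - intros z Hz. apply contP_div_circ; [now apply (near_in_disk a z d)|exact Hv].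
  - intros z t Hz Ht. destruct (near_in_disk a z d eq_refl Ha Hz) as [Z1 Z2].
    destruct (near_in_disk a a d eq_refl Ha) as [_ A2].
    { replace (a - a)%C with (RtoC 0) by ring. now rewrite Cmod_0. }
    assert (N1 := circ_minus_neq_0 r r0 z t Z1). assert (N2 := circ_minus_neq_0 r r0 a t Ha).
    replace (v t / (circ r t - z) - v t / (circ r t - a))%C
      with (v t * (z - a) / ((circ r t - z) * (circ r t - a)))%C by (field; now split).
    rewrite Cmod_div, !Cmod_mult by (intros E; destruct (Cmult_integral _ _ E); contradiction).
    replace (M / (d * d) * Cmod (z - a)) with (M * Cmod (z - a) / (d * d)) by (field; lra).
    unfold Rdiv. apply Rmult_le_compat.
    + apply Rmult_le_pos; apply Cmod_ge_0.
    + left. apply Rinv_0_lt_compat. apply Rmult_lt_0_compat; now apply Cmod_gt_0.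
    + apply Rmult_le_compat_r; [apply Cmod_ge_0|now apply HM].
    + apply Rinv_le_contravar; [now apply Rmult_lt_0_compat|].
      apply Rmult_le_compat; try lra; auto.
Qed.

(** The difference quotient at [a] of a Cauchy transform is again a Cauchy transform, with density
    divided by [circ r t - a]; its continuity is therefore already known. *)
Lemma K1_cder (v : R -> C) (a : C) : Cmod a < r -> contP v -> cder (K1 v) a (K2 v a).
Proof.
  intros Ha Hv. set (d := (r - Cmod a) / 2). assert (Hd : 0 < d) by (unfold d; lra).
  assert (Hv' := contP_div_circ v a Ha Hv).
  eapply cder_eq; [|apply (cder_intro (K1 v) (K1 (fun t => v t / (circ r t - a))%C) a d Hd (K1_cont _ a Ha Hv'))].
  - apply mean_ext. intros t. field. now apply circ_minus_neq_0.
  - intros z Hz. destruct (near_in_disk a z d eq_refl Ha Hz) as [Z1 _].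
    unfold K1. rewrite Cmult_comm, <- mean_scal by now apply contP_div_circ.
    rewrite <- mean_plus.
    + apply mean_ext. intros t. field. split; now apply circ_minus_neq_0.
    + now apply contP_div_circ.
    + intros t. apply contp_mult; [apply contp_const|]. now apply contP_div_circ.
Qed.

Lemma K2_cont (v : R -> C) (a : C) : Cmod a < r -> contP v -> cont (K2 v) a.
Proof.
  intros Ha Hv. set (d := (r - Cmod a) / 2). assert (Hd : 0 < d) by (unfold d; lra).
  destruct (contP_bounded v Hv) as [M [M0 HM]].
  apply mean_cont with (d := d) (L := M * 2 / (d * d * d)); [exact Hd| |].
  - intros z Hz. apply contP_div_circ2; [now apply (near_in_disk a z d)|exact Hv].
  - intros z t Hz Ht. destruct (near_in_disk a z d eq_refl Ha Hz) as [Z1 Z2].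
    destruct (near_in_disk a a d eq_refl Ha) as [_ A2].
    { replace (a - a)%C with (RtoC 0) by ring. now rewrite Cmod_0. }
    assert (N1 := circ_minus_neq_0 r r0 z t Z1). assert (N2 := circ_minus_neq_0 r r0 a t Ha).
    replace (v t / ((circ r t - z) * (circ r t - z)) - v t / ((circ r t - a) * (circ r t - a)))%C
      with (v t * (z - a) * (/ ((circ r t - z) * (circ r t - z) * (circ r t - a))
              + / ((circ r t - z) * (circ r t - a) * (circ r t - a))))%C by (field; now split).
    rewrite !Cmod_mult.
    replace (M * 2 / (d * d * d) * Cmod (z - a)) with (M * Cmod (z - a) * (/ (d * d * d) + / (d * d * d)))
      by (field; lra).
    apply Rmult_le_compat; [apply Rmult_le_pos; apply Cmod_ge_0|apply Cmod_ge_0| |].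
    + apply Rmult_le_compat_r; [apply Cmod_ge_0|now apply HM].
    + eapply Rle_trans; [apply Cmod_triangle|].
      assert (NN : forall x y : C, x <> 0 -> y <> 0 -> (x * y)%C <> 0).
      { intros x y Hx Hy E. destruct (Cmult_integral _ _ E); contradiction. }
      rewrite !Cmod_inv by auto. rewrite !Cmod_mult.
      assert (0 < d * d) by now apply Rmult_lt_0_compat.
      assert (B1 := Z2 t). assert (B2 := A2 t).
      apply Rplus_le_compat; (apply Rinv_le_contravar; [now apply Rmult_lt_0_compat|]);
      repeat (apply Rmult_le_compat; try lra).
Qed.

(** The difference quotient of [1 / (u - z)^2] at [a] is [1 / ((u - z)^2 (u - a)) + 1 / ((u - z) (u
    - a)^2)], that is a [K2] term plus a [K1] term, both continuous. *)
Lemma K2_cdiff (v : R -> C) (a : C) : Cmod a < r -> contP v -> cdiff (K2 v) a.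
Proof.
  intros Ha Hv. set (d := (r - Cmod a) / 2). assert (Hd : 0 < d) by (unfold d; lra).
  assert (Hv' := contP_div_circ v a Ha Hv). assert (Hv2 := contP_div_circ2 v a Ha Hv).
  eexists. apply (cder_intro (K2 v) (fun z => K2 (fun t => v t / (circ r t - a)) z
    + K1 (fun t => v t / ((circ r t - a) * (circ r t - a))) z)%C a d Hd).
  - apply cont_plus; [now apply K2_cont|now apply K1_cont].
  - intros z Hz. destruct (near_in_disk a z d eq_refl Ha Hz) as [Z1 _].
    unfold K1, K2. rewrite <- mean_plus; [|now apply contP_div_circ2|now apply contP_div_circ].
    rewrite Cmult_comm, <- mean_scal.
    2: { intros t. apply contp_plus; [now apply contP_div_circ2|now apply contP_div_circ]. }
    rewrite <- mean_plus.
    + apply mean_ext. intros t. field. split; now apply circ_minus_neq_0.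
    + now apply contP_div_circ2.
    + intros t. apply contp_mult; [apply contp_const|].
      apply contp_plus; [now apply contP_div_circ2|now apply contP_div_circ].
Qed.

End Kernel.

(** Division by [z - a] with the removable value filled in. Schwarz's lemma, Taylor coefficients,
    the removal of singularities and the uniqueness of power series all rest on it. *)
Definition dq (f : C -> C) (a z : C) : C :=
  if Ceq_dec z a then C_derive f a else ((f z - f a) / (z - a))%C.

Lemma dq_eq (f : C -> C) (a : C) : dq f a a = C_derive f a.
Proof. unfold dq. now destruct (Ceq_dec a a). Qed.

Lemma dq_neq (f : C -> C) (a z : C) : z <> a -> dq f a z = ((f z - f a) / (z - a))%C.
Proof. intros H. unfold dq. now destruct (Ceq_dec z a). Qed.

Lemma dq_spec (f : C -> C) (a z : C) : f z = (f a + dq f a z * (z - a))%C.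
Proof.
  unfold dq. destruct (Ceq_dec z a) as [->|H]; [ring|]. field. now apply Cminus_neq_0.
Qed.

Lemma dq_unique (f q : C -> C) (a : C) (R : R) : 0 < R -> cont q a ->
  (forall z, Cmod (z - a) < R -> f z = (f a + q z * (z - a))%C) ->
  forall z, Cmod (z - a) < R -> dq f a z = q z.
Proof.
  intros HR Hq E z Hz. unfold dq. destruct (Ceq_dec z a) as [->|H].
  - apply cder_C_derive. now apply cder_intro with (r := R).
  - rewrite (E z Hz). field. now apply Cminus_neq_0.
Qed.

Definition anal (f : C -> C) (z : C) : Prop := nearC z (cdiff f).

Lemma cder_shift (f : C -> C) (z w l : C) : cder f (z + w) l -> cder (fun u => f (z + u)%C) w l.
Proof.
  intros H. eapply cder_eq; [|apply (cder_comp f (fun u => z + u)%C); [exact H|]].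
  2: apply cder_plus; [apply cder_const|apply cder_id]. ring.
Qed.

Lemma cder_unshift (f : C -> C) (z w l : C) : cder (fun u => f (z + u)%C) (w - z) l -> cder f w l.
Proof.
  intros H. apply cder_local with (g := fun x => (fun u => f (z + u)%C) (x - z)%C) (r := 1); [lra| |].
  - intros x _. cbv beta. f_equal. ring.
  - eapply cder_eq; [|apply (cder_comp (fun u => f (z + u)%C) (fun x => x - z)%C); [exact H|]].
    2: apply cder_minus; [apply cder_id|apply cder_const]. ring.
Qed.

Lemma anal_kernel (f : C -> C) (z : C) : anal f z ->
  exists (r : R) (v : R -> C), 0 < r /\ contP v /\
    (forall w, Cmod (w - z) < r -> f w = K1 r v (w - z)).
Proof.
  intros [d [Hd H]]. set (g := fun w => f (z + w)%C). set (r := d / 2).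
  assert (Hg : forall w, Cmod w <= r -> cdiff g w).
  { intros w Hw. destruct (H (z + w)%C) as [l Hl].
    - replace (z + w - z)%C with w by ring. unfold r in Hw. lra.
    - exists l. now apply cder_shift. }
  exists r, (fun t => g (circ r t) * circ r t)%C. repeat split.
  - unfold r; lra.
  - intros t. apply contp_mult; [|apply contp_circ].
    apply (contP_on_circ r ltac:(unfold r; lra) g). intros w Hw. apply cdiff_cont, Hg. lra.
  - intros w Hw. unfold K1. rewrite <- (cauchy_formula g r ltac:(unfold r; lra) Hg) by exact Hw.
    unfold g. f_equal. ring.
Qed.

(** Near [z] the function is a Cauchy transform, so its derivative is a [K2], which is
    differentiable in turn. *)
Lemma C_derive_cdiff (f : C -> C) (z : C) : anal f z -> cdiff (C_derive f) z.
Proof.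
  intros H. destruct (anal_kernel f z H) as [r [v [Hr [Hv E]]]].
  assert (D : forall w, Cmod (w - z) < r -> cder f w (K2 r v (w - z))).
  { intros w Hw. apply cder_unshift with (z := z).
    apply cder_local with (g := K1 r v) (r := r - Cmod (w - z)); [lra| |now apply K1_cder].
    intros u Hu. rewrite E; [f_equal; ring|]. replace (z + u - z)%C with u by ring.
    assert (T := Cmod_reverse u (w - z)). lra. }
  apply cdiff_local with (g := fun w => K2 r v (w - z)%C) (r := r); [exact Hr| |].
  - intros w Hw. now apply cder_C_derive, D.
  - apply (cdiff_comp (K2 r v) (fun w => w - z)%C).
    + apply K2_cdiff; [exact Hr| |exact Hv]. replace (z - z)%C with (RtoC 0) by ring. now rewrite Cmod_0.
    + apply cdiff_minus; [apply cdiff_id|apply cdiff_const].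
Qed.

Lemma anal_C_derive (f : C -> C) (z : C) : anal f z -> anal (C_derive f) z.
Proof.
  intros H. apply (nearC_imp z _ _ (fun w => C_derive_cdiff f w)). now apply nearC_nearC.
Qed.

(** For a Cauchy transform centred at [a], dividing by [z - a] amounts to dividing the density by
    the point of the circle; the result is a Cauchy transform, differentiable at [a] too. *)
Lemma dq_cdiff_self (f : C -> C) (a : C) : anal f a -> cdiff (dq f a) a.
Proof.
  intros H. destruct (anal_kernel f a H) as [r [v [Hr [Hv E]]]].
  assert (Z : Cmod (a - a) < r) by (replace (a - a)%C with (RtoC 0) by ring; now rewrite Cmod_0).
  assert (Z0 : Cmod 0 < r) by now rewrite Cmod_0.
  assert (Hv' := contP_div_circ r Hr v 0 Z0 Hv).
  set (v' := (fun t => v t / (circ r t - 0))%C) in *.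
  set (q := fun w => K1 r v' (w - a)).
  assert (Hq : cdiff q a).
  { apply (cdiff_comp (K1 r v') (fun w => w - a)%C).
    - eexists. apply K1_cder; [exact Hr|exact Z|exact Hv'].
    - apply cdiff_minus; [apply cdiff_id|apply cdiff_const]. }
  apply cdiff_local with (g := q) (r := r); [exact Hr| |exact Hq].
  apply dq_unique; [exact Hr|now apply cdiff_cont|].
  intros w Hw. rewrite (E w Hw), (E a Z). replace (a - a)%C with (RtoC 0) by ring.
  unfold q, K1, v'. rewrite Cmult_comm, <- mean_scal by now apply contP_div_circ.
  rewrite <- mean_plus.
  - apply mean_ext. intros t.
    assert (N1 := circ_minus_neq_0 r Hr _ t Hw). assert (N2 := circ_minus_neq_0 r Hr _ t Z0).
    field. split; [|exact N1]. intros E0. apply N2. rewrite E0. ring.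
  - now apply contP_div_circ.
  - intros t. apply contp_mult; [apply contp_const|]. now apply contP_div_circ.
Qed.

Lemma dq_cdiff (f : C -> C) (a z : C) : anal f a -> cdiff f z -> cdiff (dq f a) z.
Proof.
  intros Ha Hz. destruct (Ceq_dec z a) as [->|N]; [now apply dq_cdiff_self|].
  assert (P := proj1 (Cmod_gt_0 _) (Cminus_neq_0 _ _ N)).
  apply cdiff_local with (g := (fun w => (f w - f a) / (w - a))%C) (r := Cmod (z - a)); [exact P| |].
  - intros w Hw. apply dq_neq. intros ->. rewrite Cmod_minus_sym in Hw. lra.
  - apply cdiff_div; [apply cdiff_minus; [exact Hz|apply cdiff_const]| |now apply Cminus_neq_0].
    apply cdiff_minus; [apply cdiff_id|apply cdiff_const].
Qed.

Lemma anal_dq (f : C -> C) (a : C) : anal f a -> anal (dq f a) a.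
Proof.
  intros H. destruct H as [d [Hd Hw]]. exists d. split; [exact Hd|].
  intros w Hwd. apply dq_cdiff; [exists d; auto|auto].
Qed.

(** Applying Cauchy's formula to the powers [f^n] removes the constant. *)
Lemma max_principle (f : C -> C) (r M : R) : 0 < r ->
  (forall z, Cmod z <= r -> cdiff f z) ->
  (forall t, 0 <= t <= 2 * PI -> Cmod (f (circ r t)) <= M) ->
  forall z, Cmod z < r -> Cmod (f z) <= M.
Proof.
  intros Hr Hf HM z Hlt.
  assert (M0 : 0 <= M).
  { eapply Rle_trans; [apply Cmod_ge_0|apply (HM 0)]. assert (T := PI2_pos). lra. }
  set (K := r / (r - Cmod z)).
  assert (Pz := Cmod_ge_0 z).
  assert (K1 : 0 < K) by (apply Rdiv_lt_0_compat; lra).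
  assert (B : forall n, Cmod (f z) ^ n <= M ^ n * K).
  { intros n. rewrite <- Cmod_pow.
    rewrite (cauchy_formula (fun w => Cpow (f w) n) r Hr) by (auto; intros; now apply cdiff_pow, Hf).
    apply mean_le.
    - intros t. apply contp_div; [|apply contp_minus; [apply contp_circ|apply contp_const]|now apply circ_minus_neq_0].
      apply contp_mult; [|apply contp_circ].
      apply (contP_on_circ r Hr (fun w => Cpow (f w) n)). intros w Hw. apply cdiff_cont, cdiff_pow, Hf. lra.
    - intros t Ht. rewrite Cmod_div, Cmod_mult, Cmod_pow by now apply circ_minus_neq_0.
      assert (Hc := Cmod_circ r t ltac:(lra)).
      assert (G := circ_minus_ge r Hr z t).
      unfold K, Rdiv. rewrite Rmult_assoc. apply Rmult_le_compat.
      + apply pow_le, Cmod_ge_0.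
      + apply Rmult_le_pos; [apply Cmod_ge_0|]. left. apply Rinv_0_lt_compat. lra.
      + apply pow_incr. split; [apply Cmod_ge_0|now apply HM].
      + rewrite Hc. apply Rmult_le_compat_l; [lra|]. apply Rinv_le_contravar; lra. }
  destruct (Rle_dec (Cmod (f z)) M) as [H|H]; [exact H|exfalso].
  destruct (Rle_lt_or_eq_dec 0 M M0) as [Mp|Mz].
  - set (x := Cmod (f z) / M).
    assert (X : 1 < x).
    { unfold x. apply Rmult_lt_reg_r with M; [exact Mp|].
      unfold Rdiv. rewrite Rmult_assoc, Rinv_l by lra. lra. }
    destruct (Pow_x_infinity x) with (b := K + 1) as [n Hn]; [rewrite Rabs_pos_eq; lra|].
    specialize (Hn n (le_n n)). rewrite Rabs_pos_eq in Hn by (apply pow_le; lra).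
    specialize (B n). replace (Cmod (f z)) with (x * M) in B by (unfold x; field; lra).
    rewrite Rpow_mult_distr in B. assert (Pn : 0 < M ^ n) by now apply pow_lt. nra.
  - specialize (B 1%nat). rewrite <- Mz in B, H. simpl in B. lra.
Qed.

(** * Holomorphic functions in the disk and Schwarz's lemma *)

Definition holoD (f : C -> C) : Prop := forall z, disk z -> cdiff f z.

Lemma disk_near (z : C) : disk z -> nearC z disk.
Proof.
  intros H. exists (1 - Cmod z). split; [unfold disk in H; lra|].
  intros w Hw. unfold disk in *. assert (T := Cmod_reverse w z). lra.
Qed.

Lemma holoD_anal (f : C -> C) (z : C) : holoD f -> disk z -> anal f z.
Proof. intros Hf Hz. apply (nearC_imp z disk); [exact Hf|now apply disk_near]. Qed.

(** The identity behind the automorphism [(p - z) / (1 - p z)]: both the bound inside the disk and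
    the nearly unit modulus close to the circle follow from it. *)
Lemma Cmod_sqr_blaschke (p : R) (z : C) :
  Cmod (1 - RtoC p * z) ^ 2 - Cmod (RtoC p - z) ^ 2 = (1 - p ^ 2) * (1 - Cmod z ^ 2).
Proof. rewrite !Cmod2_alt. destruct z as [x y]. simpl. ring. Qed.

Lemma blaschke_le (p : R) (z : C) : 0 <= p <= 1 -> Cmod z <= 1 ->
  Cmod (RtoC p - z) <= Cmod (1 - RtoC p * z).
Proof.
  intros Hp Hz. apply Cmod_le_sqr. assert (B := Cmod_sqr_blaschke p z).
  assert (Q := Cmod_ge_0 z).
  assert (0 <= (1 - p ^ 2) * (1 - Cmod z ^ 2)) by (apply Rmult_le_pos; nra). lra.
Qed.

Lemma one_minus_pz_neq_0 (p : R) (z : C) : 0 <= p < 1 -> Cmod z <= 1 -> (1 - RtoC p * z)%C <> 0.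
Proof.
  intros Hp Hz E. apply Cminus_eq_0 in E.
  assert (A := Cmod_1). rewrite E, Cmod_mult, Cmod_R, Rabs_pos_eq in A by lra.
  assert (P := Cmod_ge_0 z). nra.
Qed.

(** The zero sits at [p], where the pole of [phi] is, and the factorization is multiplied out so
    that it holds for all [z]. On circles of radius close to [1] the Blaschke factor has modulus
    close to [1], so the maximum principle bounds the quotient [v] by any constant above [1]. *)
Lemma schwarz (f : C -> C) (p : R) : 0 <= p < 1 -> holoD f ->
  (forall z, disk z -> Cmod (f z) <= 1) -> f (RtoC p) = 0 ->
  exists v : C -> C, holoD v /\ (forall z, disk z -> Cmod (v z) <= 1) /\
    forall z, (f z * (1 - RtoC p * z) = (RtoC p - z) * v z)%C.
Proof.
  intros Hp Hf Hb H0.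
  assert (Dp : disk (RtoC p)) by (unfold disk; rewrite Cmod_R, Rabs_pos_eq; lra).
  set (v := fun z => (- dq f (RtoC p) z * (1 - RtoC p * z))%C).
  assert (Hv : holoD v).
  { intros z Hz. apply cdiff_mult.
    - apply cdiff_opp, dq_cdiff; [now apply holoD_anal|now apply Hf].
    - apply cdiff_minus; [apply cdiff_const|apply cdiff_mult; [apply cdiff_const|apply cdiff_id]]. }
  assert (E : forall z, (f z * (1 - RtoC p * z) = (RtoC p - z) * v z)%C).
  { intros z. rewrite (dq_spec f (RtoC p) z), H0. unfold v. ring. }
  exists v. split; [exact Hv|]. split; [|exact E].
  intros z Hz. unfold disk in Hz.
  apply Rnot_lt_le. intros Hlt.
  set (e := Cmod (v z) ^ 2 - 1). assert (He : 0 < e) by (unfold e; nra).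
  (* The three lower bounds on [s]: the circle surrounds [z], it stays at distance at least
     [(1 - p) / 2] from [p], and [2 (1 - s)] is at most [((1 - p) / 2)^2 * (e / 2)], which bounds
     the defect in [Cmod_sqr_blaschke]. *)
  set (s := Rmax (Rmax ((1 + Cmod z) / 2) ((1 + p) / 2)) (1 - e * ((1 - p) / 2) ^ 2 / 4)).
  assert (S1' : (1 + Cmod z) / 2 <= s) by (eapply Rle_trans; [apply Rmax_l|apply Rmax_l]).
  assert (S1 : Cmod z < s) by lra.
  assert (S2 : (1 + p) / 2 <= s) by (eapply Rle_trans; [apply Rmax_r|apply Rmax_l]).
  assert (S3 : 1 - e * ((1 - p) / 2) ^ 2 / 4 <= s) by apply Rmax_r.
  assert (Q : 0 < ((1 - p) / 2) ^ 2) by (apply pow_lt; lra).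
  assert (S4 : s < 1).
  { unfold s. repeat apply Rmax_lub_lt; try lra.
    assert (0 < e * ((1 - p) / 2) ^ 2) by now apply Rmult_lt_0_compat. lra. }
  assert (B : Cmod (v z) <= sqrt (1 + e / 2)).
  { apply max_principle with (r := s); [lra| | |exact S1].
    - intros w Hw. apply Hv. unfold disk. lra.
    - intros t _. set (w := circ s t). assert (Hw : Cmod w = s) by (apply Cmod_circ; lra).
      assert (Dw : disk w) by (unfold disk; lra).
      apply Rsqr_incr_0_var; [|apply sqrt_pos]. rewrite Rsqr_sqrt by lra.
      unfold Rsqr. specialize (E w). specialize (Hb w Dw).
      assert (E2 : Cmod (f w) * Cmod (1 - RtoC p * w) = Cmod (RtoC p - w) * Cmod (v w))
        by (rewrite <- !Cmod_mult; now rewrite E).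
      assert (I := Cmod_sqr_blaschke p w). rewrite Hw in I.
      set (X := Cmod (1 - RtoC p * w)) in *. set (Y := Cmod (RtoC p - w)) in *.
      assert (PX : 0 <= X) by apply Cmod_ge_0.
      assert (PY : (1 - p) / 2 <= Y).
      { unfold Y. rewrite Cmod_minus_sym. assert (T := Cmod_reverse w (RtoC p)).
        rewrite Cmod_R, Rabs_pos_eq in T by lra. lra. }
      assert (Pf := Cmod_ge_0 (f w)). assert (Pv := Cmod_ge_0 (v w)).
      assert (F : Y ^ 2 * (Cmod (v w) * Cmod (v w)) <= X ^ 2).
      { replace (Y ^ 2 * (Cmod (v w) * Cmod (v w))) with ((Y * Cmod (v w)) ^ 2) by ring.
        rewrite <- E2. apply pow_incr. nra. }
      assert (G : X ^ 2 <= Y ^ 2 * (1 + e / 2)).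
      { replace (X ^ 2) with (Y ^ 2 + (1 - p ^ 2) * (1 - s ^ 2)) by lra.
        assert (Y2 : ((1 - p) / 2) ^ 2 <= Y ^ 2) by (apply pow_incr; lra).
        assert (R1 : 0 <= 1 - s ^ 2 <= 2 * (1 - s)) by (clear - S2 S4 Hp; nra).
        assert ((1 - p ^ 2) * (1 - s ^ 2) <= 2 * (1 - s)) by (assert (P2 := pow2_ge_0 p); clear - R1 P2; nra).
        assert (2 * (1 - s) <= ((1 - p) / 2) ^ 2 * (e / 2)) by lra.
        assert (((1 - p) / 2) ^ 2 * (e / 2) <= Y ^ 2 * (e / 2)) by (apply Rmult_le_compat_r; lra).
        lra. }
      apply Rmult_le_reg_l with (Y ^ 2); [apply pow_lt; lra|]. lra. }
  assert (B2 : Cmod (v z) ^ 2 <= 1 + e / 2).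
  { rewrite <- (pow2_sqrt (1 + e / 2)) by lra. apply pow_incr. split; [apply Cmod_ge_0|exact B]. }
  unfold e in B2. unfold e in He. lra.
Qed.

(** * Taylor coefficients and Bohr's inequality *)

Definition shift {A : Type} (u : nat -> A) : nat -> A := fun n => u (S n).

(** [Mr N u s] is the partial sum [u 0 + ... + u N * s ^ N] in Horner form. *)
Fixpoint Mr (N : nat) (u : nat -> R) (s : R) : R :=
  match N with O => u O | S N' => u O + s * Mr N' (shift u) s end.

Lemma Mr_ext (N : nat) (u v : nat -> R) (s : R) : (forall n, u n = v n) -> Mr N u s = Mr N v s.
Proof.
  revert u v. induction N as [|N IH]; intros u v H; simpl; [apply H|].
  rewrite H, (IH (shift u) (shift v)); [reflexivity|]. intros n. apply H.
Qed.

Lemma Mr_le (N : nat) (u v : nat -> R) (s : R) : 0 <= s -> (forall n, u n <= v n) -> Mr N u s <= Mr N v s.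
Proof.
  intros Hs. revert u v. induction N as [|N IH]; intros u v H; simpl; [apply H|].
  apply Rplus_le_compat; [apply H|]. apply Rmult_le_compat_l; [exact Hs|].
  apply IH. intros n. apply H.
Qed.

Lemma Mr_ge_0 (N : nat) (u : nat -> R) (s : R) : 0 <= s -> (forall n, 0 <= u n) -> 0 <= Mr N u s.
Proof.
  intros Hs. revert u. induction N as [|N IH]; intros u H; simpl; [apply H|].
  apply Rplus_le_le_0_compat; [apply H|]. apply Rmult_le_pos; [exact Hs|].
  apply IH. intros n. apply H.
Qed.

Lemma Mr_plus (N : nat) (u v : nat -> R) (s : R) : Mr N (fun n => u n + v n) s = Mr N u s + Mr N v s.
Proof.
  revert u v. induction N as [|N IH]; intros u v; simpl; [reflexivity|].
  unfold shift. rewrite (IH (fun n => u (S n)) (fun n => v (S n))). ring.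
Qed.

Lemma Mr_scal (N : nat) (c : R) (u : nat -> R) (s : R) : Mr N (fun n => c * u n) s = c * Mr N u s.
Proof.
  revert u. induction N as [|N IH]; intros u; simpl; [reflexivity|].
  unfold shift. rewrite (IH (fun n => u (S n))). ring.
Qed.

Lemma Mr_S (N : nat) (u : nat -> R) (s : R) : Mr (S N) u s = Mr N u s + u (S N) * s ^ S N.
Proof.
  revert u. induction N as [|N IH]; intros u; [simpl; unfold shift; ring|].
  change (Mr (S (S N)) u s) with (u 0%nat + s * Mr (S N) (shift u) s).
  rewrite IH. simpl. unfold shift. ring.
Qed.

Lemma Mr_mono (N : nat) (u : nat -> R) (s : R) : 0 <= s -> (forall n, 0 <= u n) -> Mr N u s <= Mr (S N) u s.
Proof.
  intros Hs H. rewrite Mr_S. assert (P := pow_le s (S N) Hs). assert (Q := H (S N)). nra.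
Qed.

Lemma Mr_le_const (N : nat) (u : nat -> R) (B s : R) : 0 <= s < 1 -> (forall n, 0 <= u n <= B) ->
  Mr N u s <= B / (1 - s).
Proof.
  intros Hs. revert u. induction N as [|N IH]; intros u H; simpl.
  - destruct (H 0%nat) as [H0 H1]. apply Rmult_le_reg_r with (1 - s); [lra|].
    unfold Rdiv. rewrite Rmult_assoc, Rinv_l by lra. nra.
  - destruct (H 0%nat) as [H0 H1].
    replace (B / (1 - s)) with (B + s * (B / (1 - s))) by (field; lra).
    apply Rplus_le_compat; [exact H1|]. apply Rmult_le_compat_l; [lra|]. apply IH.
    intros n. apply H.
Qed.

(** Cauchy product peeled off the left factor. This matches the rule
    [dq (f g) = f(0) dq g + (dq f) g] at the origin, which makes [tc_mult] a direct induction. *)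
Fixpoint rconv (a b : nat -> R) (n : nat) : R :=
  match n with O => a O * b O | S m => a O * b (S m) + rconv (shift a) b m end.

Fixpoint conv (a b : nat -> C) (n : nat) : C :=
  match n with O => (a O * b O)%C | S m => (a O * b (S m) + conv (shift a) b m)%C end.

(** The product of two truncated sums contains every term of the truncated product, and its further
    terms are nonnegative. Submultiplicativity thus holds at each finite order. *)
Lemma Mr_rconv (N : nat) (a b : nat -> R) (s : R) : 0 <= s -> (forall n, 0 <= a n) -> (forall n, 0 <= b n) ->
  Mr N (rconv a b) s <= Mr N a s * Mr N b s.
Proof.
  intros Hs Ha Hb. revert a Ha. induction N as [|N IH]; intros a Ha; [simpl; lra|].
  change (Mr (S N) (rconv a b) s)
    with (a 0%nat * b 0%nat + s * Mr N (fun m => a 0%nat * b (S m) + rconv (shift a) b m) s).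
  rewrite Mr_plus, Mr_scal.
  assert (Sa : forall n, 0 <= shift a n) by (intros n; apply Ha).
  specialize (IH (shift a) Sa).
  assert (M1 := Mr_mono N b s Hs Hb). assert (M2 := Mr_ge_0 N (shift a) s Hs Sa).
  change (Mr (S N) a s) with (a 0%nat + s * Mr N (shift a) s).
  assert (E : Mr (S N) b s = b 0%nat + s * Mr N (fun m => b (S m)) s) by reflexivity.
  assert (T : s * Mr N (rconv (shift a) b) s <= s * (Mr N (shift a) s * Mr (S N) b s)).
  { apply Rmult_le_compat_l; [exact Hs|]. eapply Rle_trans; [exact IH|].
    now apply Rmult_le_compat_l. }
  rewrite Rmult_plus_distr_r. rewrite E at 1.
  replace (s * Mr N (shift a) s * Mr (S N) b s) with (s * (Mr N (shift a) s * Mr (S N) b s)) by ring.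
  replace (a 0%nat * (b 0%nat + s * Mr N (fun m => b (S m)) s))
    with (a 0%nat * b 0%nat + s * (a 0%nat * Mr N (fun m => b (S m)) s)) by ring.
  lra.
Qed.

(** Bounded weights on one factor come out of the product. With weights [j + 1] up to [n + 1] this
    passes from coefficients of derivatives to coefficients of the functions; with constant weight
    [1] it is the triangle inequality. *)
Lemma Cmod_conv_weighted (a b : nat -> C) (l : nat -> R) (L : R) (n : nat) :
  (forall k, (k <= n)%nat -> 0 <= l k <= L) ->
  Cmod (conv a (fun k => RtoC (l k) * b k)%C n)
    <= L * rconv (fun k => Cmod (a k)) (fun k => Cmod (b k)) n.
Proof.
  revert a. induction n as [|n IH]; intros a H; simpl.
  - destruct (H 0%nat (le_n 0)). rewrite !Cmod_mult, Cmod_R, Rabs_pos_eq by lra.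
    assert (P := Rmult_le_pos _ _ (Cmod_ge_0 (a 0%nat)) (Cmod_ge_0 (b 0%nat))). nra.
  - eapply Rle_trans; [apply Cmod_triangle|]. rewrite Rmult_plus_distr_l.
    apply Rplus_le_compat; [|apply (IH (shift a)); intros k Hk; apply H; lia].
    destruct (H (S n) (le_n _)). rewrite !Cmod_mult, Cmod_R, Rabs_pos_eq by lra.
    assert (P := Rmult_le_pos _ _ (Cmod_ge_0 (a 0%nat)) (Cmod_ge_0 (b (S n)))). nra.
Qed.

Lemma conv_ext (a a' b b' : nat -> C) (n : nat) :
  (forall k, a k = a' k) -> (forall k, b k = b' k) -> conv a b n = conv a' b' n.
Proof.
  intros Ha Hb. revert a a' Ha. induction n as [|n IH]; intros a a' Ha; simpl; rewrite Ha, Hb; [reflexivity|].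
  f_equal. apply IH. intros k. apply Ha.
Qed.

Lemma Cmod_conv (a b : nat -> C) (n : nat) :
  Cmod (conv a b n) <= rconv (fun k => Cmod (a k)) (fun k => Cmod (b k)) n.
Proof.
  rewrite <- (Rmult_1_l (rconv _ _ _)).
  rewrite (conv_ext a a b (fun k => RtoC 1 * b k)%C) by (intros; ring).
  apply (Cmod_conv_weighted a b (fun _ => 1)). intros; lra.
Qed.

(** [dq f 0] drops the constant term of [f] and divides by [z], so iterating it
    yields the Taylor coefficients of [f] at [0]. *)
Fixpoint tc (f : C -> C) (n : nat) : C :=
  match n with O => f 0 | S m => tc (dq f 0) m end.

(** Truncated majorant series of [f] at [0]; the bounds on it are uniform in [N]. *)
Definition MF (N : nat) (f : C -> C) (s : R) : R := Mr N (fun n => Cmod (tc f n)) s.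

Definition eqg (f g : C -> C) : Prop := nearC 0 (fun z => f z = g z).

Lemma anal_local (f g : C -> C) (z : C) : nearC z (fun w => f w = g w) -> anal g z -> anal f z.
Proof.
  intros H Hg. destruct (nearC_and _ _ _ (nearC_nearC _ _ H) Hg) as [d [Hd Hw]].
  exists d. split; [exact Hd|]. intros w Hwd. destruct (Hw w Hwd) as [[r [Hr E]] D].
  exact (cdiff_local f g w r Hr E D).
Qed.

Lemma anal_cdiff (f : C -> C) (z : C) : anal f z -> cdiff f z.
Proof. apply nearC_at. Qed.

Lemma anal_const (c z : C) : anal (fun _ => c) z.
Proof. exists 1. split; [lra|]. intros. apply cdiff_const. Qed.
Lemma anal_id (z : C) : anal (fun w => w) z.
Proof. exists 1. split; [lra|]. intros. apply cdiff_id. Qed.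
Lemma anal_plus (f g : C -> C) (z : C) : anal f z -> anal g z -> anal (fun w => f w + g w)%C z.
Proof.
  intros Hf Hg. apply (nearC_imp _ _ _ (fun w H => cdiff_plus f g w (proj1 H) (proj2 H))). now apply nearC_and.
Qed.
Lemma anal_minus (f g : C -> C) (z : C) : anal f z -> anal g z -> anal (fun w => f w - g w)%C z.
Proof.
  intros Hf Hg. apply (nearC_imp _ _ _ (fun w H => cdiff_minus f g w (proj1 H) (proj2 H))). now apply nearC_and.
Qed.
Lemma anal_mult (f g : C -> C) (z : C) : anal f z -> anal g z -> anal (fun w => f w * g w)%C z.
Proof.
  intros Hf Hg. apply (nearC_imp _ _ _ (fun w H => cdiff_mult f g w (proj1 H) (proj2 H))). now apply nearC_and.
Qed.

Lemma anal_comp (f g : C -> C) (z : C) : anal f (g z) -> anal g z -> anal (fun w => f (g w)) z.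
Proof.
  intros Hf Hg.
  assert (H := nearC_cont _ _ _ (cdiff_cont _ _ (anal_cdiff _ _ Hg)) Hf).
  apply (nearC_imp _ _ _ (fun w H => cdiff_comp f g w (proj1 H) (proj2 H))). now apply nearC_and.
Qed.

Lemma anal_inv (f : C -> C) (z : C) : anal f z -> f z <> 0 -> anal (fun w => / f w)%C z.
Proof.
  intros Hf H.
  apply (nearC_imp _ _ _ (fun w H => cdiff_inv f w (proj1 H) (proj2 H))). apply nearC_and; [exact Hf|].
  apply nearC_neq_0; [|exact H]. now apply cdiff_cont, anal_cdiff.
Qed.

Lemma anal_div (f g : C -> C) (z : C) : anal f z -> anal g z -> g z <> 0 -> anal (fun w => f w / g w)%C z.
Proof. intros Hf Hg H. apply anal_mult; [exact Hf|now apply anal_inv]. Qed.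

Lemma eqg_dq (f q : C -> C) : cont q 0 -> nearC 0 (fun z => f z = (f 0 + z * q z)%C) -> eqg (dq f 0) q.
Proof.
  intros Hq [d [Hd H]]. exists d. split; [exact Hd|].
  apply dq_unique; [exact Hd|exact Hq|]. intros z Hz. rewrite (H z Hz) at 1. ring.
Qed.

Lemma dq_germ (f g : C -> C) : anal g 0 -> eqg f g -> eqg (dq f 0) (dq g 0).
Proof.
  intros Hg H. assert (H0 := nearC_at _ _ H). cbv beta in H0.
  apply eqg_dq.
  - apply cdiff_cont. now apply dq_cdiff_self.
  - destruct H as [d [Hd H]]. exists d. split; [exact Hd|]. intros z Hz.
    rewrite (H z Hz), H0, (dq_spec g 0 z). ring.
Qed.

Lemma tc_germ (f g : C -> C) (n : nat) : anal g 0 -> eqg f g -> tc f n = tc g n.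
Proof.
  revert f g. induction n as [|n IH]; intros f g Hg H; simpl.
  - exact (nearC_at _ _ H).
  - apply IH; [now apply anal_dq|now apply dq_germ].
Qed.

Lemma tc_const (c : C) (n : nat) : tc (fun _ => c) (S n) = 0.
Proof.
  assert (Z : forall n, tc (fun _ => RtoC 0) n = 0).
  { clear n. induction n as [|n IH]; [reflexivity|].
    transitivity (tc (fun _ => RtoC 0) n); [|exact IH]. simpl.
    apply tc_germ; [apply anal_const|]. apply eqg_dq; [apply cont_const|].
    apply nearC_all. intros w. ring. }
  transitivity (tc (fun _ => RtoC 0) n); [|apply Z]. simpl. apply tc_germ; [apply anal_const|]. apply eqg_dq; [apply cont_const|].
  apply nearC_all. intros w. ring.
Qed.

Lemma tc_plus (f g : C -> C) (n : nat) : anal f 0 -> anal g 0 ->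
  tc (fun z => f z + g z)%C n = (tc f n + tc g n)%C.
Proof.
  revert f g. induction n as [|n IH]; intros f g Hf Hg; [reflexivity|].
  assert (Hf' := anal_dq f 0 Hf). assert (Hg' := anal_dq g 0 Hg).
  simpl. rewrite <- (IH (dq f 0) (dq g 0) Hf' Hg').
  apply tc_germ; [now apply anal_plus|]. apply eqg_dq.
  - apply cont_plus; apply cdiff_cont, anal_cdiff; assumption.
  - apply nearC_all. intros z. rewrite (dq_spec f 0 z), (dq_spec g 0 z) at 1. ring.
Qed.

Lemma tc_scal (c : C) (f : C -> C) (n : nat) : anal f 0 -> tc (fun z => c * f z)%C n = (c * tc f n)%C.
Proof.
  revert f. induction n as [|n IHm]; intros h Hh; [reflexivity|].
  assert (Hh' := anal_dq h 0 Hh).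
  simpl. rewrite <- (IHm (dq h 0) Hh'). apply tc_germ; [apply anal_mult; [apply anal_const|exact Hh']|].
  apply eqg_dq.
  - apply cont_mult; [apply cont_const|]. apply cdiff_cont, anal_cdiff; assumption.
  - apply nearC_all. intros z. rewrite (dq_spec h 0 z) at 1. ring.
Qed.

Lemma tc_mult (f g : C -> C) (n : nat) : anal f 0 -> anal g 0 ->
  tc (fun z => f z * g z)%C n = conv (tc f) (tc g) n.
Proof.
  revert f g. induction n as [|n IH]; intros f g Hf Hg; [reflexivity|].
  assert (Hf' := anal_dq f 0 Hf). assert (Hg' := anal_dq g 0 Hg).
  simpl. transitivity (tc (fun z => f 0 * dq g 0 z + dq f 0 z * g z)%C n).
  - apply tc_germ.
    + apply anal_plus; apply anal_mult; auto using anal_const.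
    + apply eqg_dq.
      * apply cont_plus; apply cont_mult; try apply cont_const; apply cdiff_cont, anal_cdiff; assumption.
      * apply nearC_all. intros z. rewrite (dq_spec f 0 z) at 1. rewrite (dq_spec g 0 z) at 1 2. ring.
  - rewrite tc_plus by (apply anal_mult; auto using anal_const).
    rewrite tc_scal by exact Hg'. rewrite IH by assumption. reflexivity.
Qed.

Lemma tc_mul_id (f : C -> C) (n : nat) : anal f 0 -> tc (fun z => z * f z)%C (S n) = tc f n.
Proof.
  intros H. simpl. apply tc_germ; [exact H|]. apply eqg_dq; [now apply cdiff_cont, anal_cdiff|].
  apply nearC_all. intros z. ring.
Qed.

(** Differentiating [f = f(0) + z dq f] gives [f' = dq f + z (dq f)'], to which the induction
    hypothesis applies. *)
Lemma tc_C_derive (f : C -> C) (n : nat) : anal f 0 ->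
  tc (C_derive f) n = (RtoC (INR (S n)) * tc f (S n))%C.
Proof.
  revert f. induction n as [|n IH]; intros f Hf.
  - simpl. rewrite dq_eq. ring.
  - assert (Hf' := anal_dq f 0 Hf).
    transitivity (tc (fun z => dq f 0 z + z * C_derive (dq f 0) z)%C (S n)).
    + apply tc_germ.
      * apply anal_plus; [exact Hf'|]. apply anal_mult; [apply anal_id|now apply anal_C_derive].
      * apply (nearC_imp _ (cdiff (dq f 0))); [|exact Hf'].
        intros z Hz. apply cder_C_derive.
        apply cder_local with (g := (fun w => f 0 + w * dq f 0 w)%C) (r := 1); [lra| |].
        -- intros w _. rewrite (dq_spec f 0 w) at 1. ring.
        -- eapply cder_eq; [|apply cder_plus; [apply cder_const|
             apply cder_mult; [apply cder_id|apply cdiff_C_derive, Hz]]]. cbv beta. ring.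
    + rewrite tc_plus by (try apply anal_mult; auto using anal_id, anal_C_derive).
      rewrite tc_mul_id by now apply anal_C_derive.
      rewrite IH by exact Hf'. rewrite (S_INR (S n)), RtoC_plus.
      change (tc f (S (S n))) with (tc (dq f 0) (S n)). ring.
Qed.

Lemma MF_ge_0 (N : nat) (f : C -> C) (s : R) : 0 <= s -> 0 <= MF N f s.
Proof. intros H. apply Mr_ge_0; [exact H|]. intros. apply Cmod_ge_0. Qed.

Lemma MF_S (N : nat) (f : C -> C) (s : R) : MF (S N) f s = Cmod (f 0) + s * MF N (dq f 0) s.
Proof. reflexivity. Qed.

Lemma MF_germ (N : nat) (f g : C -> C) (s : R) : anal g 0 -> eqg f g -> MF N f s = MF N g s.
Proof. intros Hg H. apply Mr_ext. intros n. f_equal. now apply tc_germ. Qed.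

Lemma MF_mult (N : nat) (f g : C -> C) (s : R) : 0 <= s -> anal f 0 -> anal g 0 ->
  MF N (fun z => f z * g z)%C s <= MF N f s * MF N g s.
Proof.
  intros Hs Hf Hg. eapply Rle_trans; [|apply Mr_rconv; auto using Cmod_ge_0].
  apply Mr_le; [exact Hs|]. intros n. rewrite tc_mult by assumption. apply Cmod_conv.
Qed.

Lemma MF_scal (N : nat) (c : C) (f : C -> C) (s : R) : anal f 0 ->
  MF N (fun z => c * f z)%C s = Cmod c * MF N f s.
Proof.
  intros H. unfold MF. rewrite <- Mr_scal. apply Mr_ext. intros n.
  rewrite tc_scal by exact H. apply Cmod_mult.
Qed.

(** The subordination principle for majorants: the difference quotient at [0] of [phi (z u)] is [u]
    times [dq phi 0 (z u)], the factor [u] costs at most [1], and the induction goes on with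
    [dq phi 0]. *)
Lemma MF_comp (N : nat) (phi u : C -> C) (s : R) : 0 <= s -> anal phi 0 -> anal u 0 ->
  (forall N, MF N u s <= 1) -> MF N (fun z => phi (z * u z)%C) s <= MF N phi s.
Proof.
  intros Hs Hphi Hu HM. revert phi Hphi. induction N as [|N IH]; intros phi Hphi.
  - unfold MF. simpl. replace (0 * u 0)%C with (RtoC 0) by ring. lra.
  - rewrite !MF_S. replace (0 * u 0)%C with (RtoC 0) by ring.
    apply Rplus_le_compat_l, Rmult_le_compat_l; [exact Hs|].
    assert (Hphi' := anal_dq phi 0 Hphi).
    assert (Hw : anal (fun z => z * u z)%C 0) by (apply anal_mult; [apply anal_id|exact Hu]).
    assert (Hc : anal (fun z => dq phi 0 (z * u z)%C) 0).
    { apply (anal_comp (dq phi 0) (fun z => z * u z)%C); [|exact Hw].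
      replace (0 * u 0)%C with (RtoC 0) by ring. exact Hphi'. }
    rewrite (MF_germ N _ (fun z => u z * dq phi 0 (z * u z))%C).
    + eapply Rle_trans; [apply MF_mult; assumption|].
      eapply Rle_trans; [|apply IH, Hphi'].
      rewrite <- (Rmult_1_l (MF N (fun z => dq phi 0 (z * u z)%C) s)) at 2.
      apply Rmult_le_compat_r; [now apply MF_ge_0|apply HM].
    + now apply anal_mult.
    + apply eqg_dq.
      * apply cdiff_cont, anal_cdiff. now apply anal_mult.
      * apply nearC_all. intros z. cbv beta. replace (0 * u 0)%C with (RtoC 0) by ring.
        rewrite (dq_spec phi 0 (z * u z)) at 1. ring.
Qed.

(** On the circle [z * Cconj z = r^2], so a conjugate power acts as a negative power and extracts a
    Taylor coefficient. In the induction the constant term of [F] drops out because a positive power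
    has mean [0]. *)
Lemma mean_tc (F : C -> C) (r : R) (n : nat) : 0 < r -> (forall z, Cmod z <= r -> cdiff F z) ->
  mean (fun t => F (circ r t) * Cpow (Cconj (circ r t)) n)%C = (RtoC (r ^ (2 * n)) * tc F n)%C.
Proof.
  intros Hr. revert F. induction n as [|n IH]; intros F HF.
  - rewrite (mean_ext _ (fun t => F (circ r t))) by (intros t; simpl; ring).
    rewrite mean_value_property by assumption. simpl. ring.
  - assert (HF' : forall z, Cmod z <= r -> cdiff (dq F 0) z).
    { intros z Hz. apply dq_cdiff; [|now apply HF]. exists r. split; [exact Hr|].
      intros w Hw. apply HF. rewrite Cmod_minus_0 in Hw. lra. }
    assert (Cj : forall n, contP (fun t => Cpow (Cconj (circ r t)) n)).
    { intros m t. now apply contp_pow, contp_conj, contp_circ. }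
    rewrite (mean_ext _ (fun t => F 0 * Cpow (Cconj (circ r t)) (S n)
      + RtoC (r ^ 2) * (dq F 0 (circ r t) * Cpow (Cconj (circ r t)) n))%C).
    + assert (C1 : contP (fun t => dq F 0 (circ r t) * Cpow (Cconj (circ r t)) n)%C).
      { intros t. apply contp_mult; [|apply Cj].
        apply (contP_on_circ r Hr (dq F 0)). intros w Hw. apply cdiff_cont, HF'. lra. }
      rewrite mean_plus;
        [|intros t; apply contp_mult; [apply contp_const|apply Cj]
         |intros t; apply contp_mult; [apply contp_const|apply C1]].
      rewrite (mean_scal (F 0)) by apply Cj. rewrite mean_scal by exact C1. rewrite IH by exact HF'.
      rewrite (mean_ext _ (fun t => Cconj (Cpow (circ r t) (S n)))) by (intros; now rewrite Cpow_conj).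
      rewrite mean_conj.
      2: { intros t. apply contp_pow, contp_circ. }
      rewrite (mean_value_property (fun w => Cpow w (S n)) r Hr) by (intros; apply cdiff_pow, cdiff_id).
      replace (2 * S n)%nat with (2 + 2 * n)%nat by lia. rewrite pow_add, RtoC_mult.
      simpl (Cpow 0 (S n)). simpl (tc F (S n)).
      replace (Cconj (0 * Cpow 0 n)) with (RtoC 0); [ring|].
      apply injective_projections; simpl; ring.
    + intros t. rewrite (dq_spec F 0 (circ r t)) at 1. simpl Cpow.
      assert (E : (circ r t * Cconj (circ r t))%C = RtoC (r ^ 2)).
      { rewrite <- Cmod2_conj, Cmod_circ by lra. reflexivity. }
      rewrite <- E. ring.
Qed.

Lemma Re_mult_le (x y : C) : Re (x * y) <= Cmod x * Cmod y.
Proof.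
  rewrite <- Cmod_mult. eapply Rle_trans; [|apply re_le_Cmod]. apply Rle_abs.
Qed.

Lemma rotation (c : C) : exists e : C, Cmod e = 1 /\ (e * c)%C = RtoC (Cmod c).
Proof.
  destruct (Ceq_dec c 0) as [->|H].
  - exists 1. rewrite Cmod_1, Cmod_0. split; [reflexivity|ring].
  - assert (P := proj1 (Cmod_gt_0 _) H).
    assert (N : RtoC (Cmod c) <> 0) by (intros E; apply RtoC_inj in E; lra).
    exists (Cconj c / RtoC (Cmod c))%C. split.
    + rewrite Cmod_div, Cmod_conj, Cmod_R, Rabs_pos_eq by (auto; lra). field. lra.
    + replace (Cconj c / RtoC (Cmod c) * c)%C with ((c * Cconj c) / RtoC (Cmod c))%C by (field; exact N).
      rewrite <- Cmod2_conj. simpl. rewrite Rmult_1_r, RtoC_mult. field. exact N.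
Qed.

(** Integrate [Re F] against the nonnegative weight [1 + cos (n t - alpha)]. *)
Lemma caratheodory (F : C -> C) (n : nat) : holoD F -> (forall z, disk z -> 0 <= Re (F z)) ->
  Cmod (tc F (S n)) <= 2 * Re (F 0).
Proof.
  intros HF Hre. set (m := S n). set (A := Cmod (tc F m)).
  assert (B : forall r, 0 < r < 1 -> A * r ^ m <= 2 * Re (F 0)).
  { intros r Hr.
    assert (HFr : forall z, Cmod z <= r -> cdiff F z) by (intros z Hz; apply HF; unfold disk; lra).
    assert (CF : contP (fun t => F (circ r t))).
    { apply contP_on_circ; [lra|]. intros w Hw. apply cdiff_cont, HFr. lra. }
    destruct (rotation (- tc F m)) as [e [He1 He2]]. rewrite Cmod_opp in He2. fold A in He2.
    set (X := fun t => (e * Cpow (Cconj (circ r t)) m)%C).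
    assert (CX : contP X).
    { intros t. apply contp_mult; [apply contp_const|]. apply contp_pow, contp_conj, contp_circ. }
    (* [G] equals [2 F (r^m + Re X)], and the weight is nonnegative because [X] has modulus [r^m].
       The rotation [e] makes the contribution of the coefficient a negative real number. *)
    set (G := fun t => (RtoC (2 * r ^ m) * F (circ r t) + (F (circ r t) * X t + F (circ r t) * Cconj (X t)))%C).
    assert (C1 : contP (fun t => F (circ r t) * X t)%C) by (intros t; now apply contp_mult).
    assert (C2 : contP (fun t => F (circ r t) * Cconj (X t))%C).
    { intros t. apply contp_mult; [apply CF|]. apply contp_conj, CX. }
    assert (C3 : contP (fun t => RtoC (2 * r ^ m) * F (circ r t))%C)
      by (intros t; apply contp_mult; [apply contp_const|apply CF]).
    assert (MG : mean G = (RtoC (2 * r ^ m) * F 0 - RtoC (r ^ (2 * m)) * RtoC A)%C).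
    { unfold G. rewrite mean_plus, mean_plus, mean_scal;
        [|exact CF|exact C1|exact C2|exact C3|intros t; apply contp_plus; [apply C1|apply C2]].
      rewrite mean_value_property by (auto; lra).
      rewrite (mean_ext (fun t => F (circ r t) * X t)%C
        (fun t => e * (F (circ r t) * Cpow (Cconj (circ r t)) m))%C) by (intros t; unfold X; ring).
      rewrite mean_scal.
      2: { intros t. apply contp_mult; [apply CF|]. apply contp_pow, contp_conj, contp_circ. }
      rewrite mean_tc by (auto; lra).
      (* This term is the holomorphic function [F w * w^m] up to a constant, so its mean is its
         value [0] at the origin. *)
      rewrite (mean_ext (fun t => F (circ r t) * Cconj (X t))%C
        (fun t => (fun w => Cconj e * (F w * Cpow w m))%C (circ r t))).
      - rewrite (mean_value_property (fun w => Cconj e * (F w * Cpow w m))%C r ltac:(lra)).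
        + replace (e * (RtoC (r ^ (2 * m)) * tc F m))%C
            with (- (RtoC (r ^ (2 * m)) * (e * - tc F m)))%C by ring.
          rewrite He2. cbv beta. replace (Cpow 0 m) with (RtoC 0) by (unfold m; simpl; ring). ring.
        + intros z Hz. apply cdiff_mult; [apply cdiff_const|apply cdiff_mult; [now apply HFr|apply cdiff_pow, cdiff_id]].
      - intros t. unfold X. rewrite Cmult_conj, <- Cpow_conj, Cconj_conj. ring. }
    assert (RG : 0 <= Re (mean G)).
    { apply mean_Re_ge_0.
      - intros t. apply contp_plus; [apply C3|]. apply contp_plus; [apply C1|apply C2].
      - intros t.
        assert (MX : Cmod (X t) = r ^ m).
        { unfold X. rewrite Cmod_mult, Cmod_pow, Cmod_conj, Cmod_circ, He1 by lra. ring. }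
        assert (RX := re_le_Cmod (X t)). rewrite MX in RX. apply Rabs_le_between in RX.
        assert (D : disk (circ r t)) by (unfold disk; rewrite Cmod_circ; lra).
        specialize (Hre _ D). unfold G.
        rewrite !re_plus, re_scal_l, !re_mult, re_conj, im_conj.
        assert (T : 0 <= Re (F (circ r t)) * (r ^ m + Re (X t))) by (apply Rmult_le_pos; lra).
        lra. }
    rewrite MG in RG. unfold Cminus in RG. rewrite re_plus in RG.
    assert (E1 : Re (RtoC (2 * r ^ m) * F 0) = 2 * r ^ m * Re (F 0)) by (rewrite re_scal_l; reflexivity).
    assert (E2 : Re (- (RtoC (r ^ (2 * m)) * RtoC A)) = - (r ^ m * r ^ m * A)).
    { rewrite <- RtoC_mult, <- RtoC_opp. unfold Re, RtoC; cbn [fst].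
      replace (2 * m)%nat with (m + m)%nat by lia. rewrite pow_add. ring. }
    rewrite E1, E2 in RG.
    assert (Pm : 0 < r ^ m) by (apply pow_lt; lra).
    apply Rmult_le_reg_l with (r ^ m); [exact Pm|]. lra. }
  (* The factor [r^m] disappears as [r] tends to [1]; a strict violation would persist for some
     [r < 1]. *)
  apply Rnot_lt_le. intros Hlt.
  assert (PA : 0 <= A) by apply Cmod_ge_0.
  assert (P0 : 0 <= Re (F 0)) by (apply Hre; unfold disk; rewrite Cmod_0; lra).
  assert (Hc : continuity_pt (fun r => A * r ^ m) 1).
  { apply continuity_pt_mult; [apply continuity_pt_const; now intros x y|].
    apply derivable_continuous_pt, derivable_pt_pow. }
  destruct (Hc (A - 2 * Re (F 0))) as [d [Hd Hw]]; [lra|].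
  set (r := 1 - Rmin (d / 2) (1 / 2)).
  assert (M1 := Rmin_l (d / 2) (1 / 2)). assert (M2 := Rmin_r (d / 2) (1 / 2)).
  assert (M3 : 0 < Rmin (d / 2) (1 / 2)) by (apply Rmin_glb_lt; lra).
  specialize (B r ltac:(unfold r; lra)).
  specialize (Hw r). simpl in Hw. unfold R_dist, D_x, no_cond in Hw.
  assert (H : Rabs (A * r ^ m - A * 1 ^ m) < A - 2 * Re (F 0)).
  { apply Hw. split; [split; [exact I|unfold r; lra]|].
    unfold r. rewrite Rabs_left; lra. }
  rewrite pow1 in H. apply Rabs_def2 in H. lra.
Qed.

(** After a rotation [k - e U] has nonnegative real part and the value [k - |U(0)|] at [0], so all
    higher coefficients of [U] are at most [2 (k - |U(0)|)]. Their geometric sum contributes the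
    factor [2 s / (1 - s)], which is at most [1] exactly when [s <= 1/3]. *)
Lemma bohr (U : C -> C) (k s : R) (N : nat) : holoD U -> (forall z, disk z -> Cmod (U z) <= k) ->
  0 <= s <= 1 / 3 -> MF N U s <= k.
Proof.
  intros HU Hk Hs.
  assert (D0 : disk 0) by (unfold disk; rewrite Cmod_0; lra).
  assert (HA := holoD_anal U 0 HU D0).
  destruct (rotation (U 0)) as [e [He1 He2]].
  assert (B : forall n, 0 <= Cmod (tc U (S n)) <= 2 * (k - Cmod (U 0))).
  { intros n. split; [apply Cmod_ge_0|].
    set (F := fun z => (RtoC k + - e * U z)%C).
    assert (E : tc F (S n) = (- e * tc U (S n))%C).
    { unfold F. rewrite tc_plus, tc_const, tc_scal; [ring|exact HA|apply anal_const|].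
      apply anal_mult; [apply anal_const|exact HA]. }
    assert (E0 : Re (F 0) = k - Cmod (U 0)).
    { unfold F. replace (- e * U 0)%C with (- (e * U 0))%C by ring. rewrite He2, re_plus. simpl. ring. }
    rewrite <- E0. replace (Cmod (tc U (S n))) with (Cmod (tc F (S n)))
      by (rewrite E, Cmod_mult, Cmod_opp, He1; ring).
    apply caratheodory.
    - intros z Hz. apply cdiff_plus; [apply cdiff_const|]. apply cdiff_mult; [apply cdiff_const|now apply HU].
    - intros z Hz. unfold F. replace (- e * U z)%C with (- (e * U z))%C by ring.
      rewrite re_plus, re_opp. simpl (Re (RtoC k)).
      assert (T := Re_mult_le e (U z)). rewrite He1 in T. specialize (Hk z Hz). lra. }
  assert (K0 := Hk 0 D0). assert (U0 := Cmod_ge_0 (U 0)).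
  destruct N as [|N]; [exact K0|]. rewrite MF_S.
  assert (T : MF N (dq U 0) s <= 2 * (k - Cmod (U 0)) / (1 - s)).
  { apply Mr_le_const; [lra|]. intros n. apply (B n). }
  assert (Q : s * (2 * (k - Cmod (U 0)) / (1 - s)) <= k - Cmod (U 0)).
  { replace (s * (2 * (k - Cmod (U 0)) / (1 - s))) with ((k - Cmod (U 0)) * (2 * s / (1 - s))) by (field; lra).
    rewrite <- (Rmult_1_r (k - Cmod (U 0))) at 2. apply Rmult_le_compat_l; [lra|].
    apply Rmult_le_reg_r with (1 - s); [lra|]. unfold Rdiv. rewrite Rmult_assoc, Rinv_l; lra. }
  assert (T2 := Rmult_le_compat_l s _ _ (proj1 Hs) T). lra.
Qed.

(** * Univalent functions *)

Lemma max_principle_at (f : C -> C) (a : C) (r M : R) : 0 < r ->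
  (forall z, Cmod (z - a) <= r -> cdiff f z) ->
  (forall t, 0 <= t <= 2 * PI -> Cmod (f (a + circ r t)%C) <= M) -> Cmod (f a) <= M.
Proof.
  intros Hr Hf HM.
  replace (f a) with ((fun w => f (a + w)%C) (RtoC 0)) by (f_equal; ring).
  apply (max_principle (fun w => f (a + w)%C) r); [exact Hr| |exact HM|rewrite Cmod_0; exact Hr].
  intros z Hz. destruct (Hf (a + z)%C) as [l Hl].
  - replace (a + z - a)%C with z by ring. exact Hz.
  - exists l. now apply cder_shift.
Qed.

Lemma circle_min (f : C -> C) (a : C) (r : R) : 0 < r ->
  (forall z, Cmod (z - a) <= r -> cont f z) ->
  (forall z, Cmod (z - a) = r -> f z <> 0) ->
  exists m, 0 < m /\ forall t, 0 <= t <= 2 * PI -> m <= Cmod (f (a + circ r t)%C).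
Proof.
  intros Hr Hf H0.
  assert (E : forall t, Cmod (a + circ r t - a) = r).
  { intros t. replace (a + circ r t - a)%C with (circ r t) by ring. apply Cmod_circ. lra. }
  destruct (continuity_ab_min (fun t => Cmod (f (a + circ r t)%C)) 0 (2 * PI) PI2_pos') as [x [Hx _]].
  - intros t _. apply contp_Cmod_continuity_pt. apply (contp_comp f (fun t => a + circ r t)%C).
    + apply contp_plus; [apply contp_const|apply contp_circ].
    + apply Hf. rewrite E. lra.
  - exists (Cmod (f (a + circ r x)%C)). split; [|exact Hx]. apply Cmod_gt_0, H0, E.
Qed.

Lemma pder_line (f : C -> C) (a b l : C) (t : R) :
  cder f (a + RtoC t * b) l -> pder (fun s => f (a + RtoC s * b)%C) t (l * b).
Proof.
  intros [q [Hq [Hl E]]].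
  assert (Hc : contp (fun s => q (a + RtoC s * b) * b)%C t).
  { apply contp_mult; [|apply contp_const]. apply (contp_comp q (fun s => a + RtoC s * b)%C); [|exact Hq].
    apply contp_plus; [apply contp_const|]. apply contp_mult; [|apply contp_const].
    eapply pder_contp, pder_RtoC. }
  assert (E' : forall h, (f (a + RtoC (t + h) * b) - f (a + RtoC t * b))%C
    = (RtoC h * (q (a + RtoC (t + h) * b) * b))%C).
  { intros h. rewrite (E (a + RtoC (t + h) * b)%C), RtoC_plus. ring. }
  (* Real and imaginary part are treated together as a real-linear functional bounded by the
     modulus. *)
  assert (B : forall g : C -> R, (forall x y, g (x - y)%C = g x - g y) ->
    (forall h x, g (RtoC h * x)%C = h * g x) -> (forall x, Rabs (g x) <= Cmod x) ->
    is_derive (fun s => g (f (a + RtoC s * b)%C)) t (g (l * b)%C)).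
  { intros g G1 G2 G3. apply is_derive_Reals. intros e He.
    destruct (proj1 (contp_iff _ t) Hc e He) as [d [Hd H]]. exists (mkposreal d Hd). intros h Hh Hhd. simpl in Hhd.
    rewrite <- G1, E', G2.
    replace (h * g (q (a + RtoC (t + h) * b)%C * b)%C / h - g (l * b)%C)
      with (g (q (a + RtoC (t + h) * b)%C * b)%C - g (l * b)%C) by (field; exact Hh).
    rewrite <- G1. eapply Rle_lt_trans; [apply G3|]. rewrite <- Hl. apply H.
    replace (t + h - t) with h by ring. exact Hhd. }
  split; apply B.
  - intros. unfold Re, Cminus; simpl. ring.
  - intros. apply re_scal_l.
  - apply re_le_Cmod.
  - intros. unfold Im, Cminus; simpl. ring.
  - intros. unfold Im; simpl. ring.
  - intros x. eapply Rle_trans; [apply Rmax_r|apply Rmax_Cmod].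
Qed.

Lemma constant_of_derivative_0 (f : C -> C) (a : C) (d : R) :
  (forall w, Cmod (w - a) < d -> cder f w 0) -> forall w, Cmod (w - a) < d -> f w = f a.
Proof.
  intros H w Hw.
  assert (F : Cint (fun _ => RtoC 0) 0 1 = (f (a + RtoC 1 * (w - a)) - f (a + RtoC 0 * (w - a)))%C).
  { apply (Cint_FTC 0 1 Rle_0_1 (fun s => f (a + RtoC s * (w - a))%C)).
    - intros t Ht. eapply pder_eq; [|apply pder_line, H].
      + ring.
      + replace (a + RtoC t * (w - a) - a)%C with (RtoC t * (w - a))%C by ring.
        rewrite Cmod_mult, Cmod_R, Rabs_pos_eq by lra. assert (P := Cmod_ge_0 (w - a)). nra.
    - intros t _. apply contp_const. }
  replace (a + RtoC 1 * (w - a))%C with w in F by ring.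
  replace (a + RtoC 0 * (w - a))%C with a in F by ring.
  apply Cminus_eq_0. rewrite <- F. apply Cmod_small_0. intros e He.
  assert (T : Cmod (Cint (fun _ => RtoC 0) 0 1) <= (1 - 0) * 0).
  { apply Cint_le; [lra|intros t _; apply contp_const|]. intros. rewrite Cmod_0. lra. }
  lra.
Qed.

Section Univalent.

Variables (f : C -> C) (a : C) (rho : R).
Hypothesis R0 : 0 < rho.
Hypothesis Hf : forall z, Cmod (z - a) < rho -> cdiff f z.
Hypothesis inj : forall z w, Cmod (z - a) < rho -> Cmod (w - a) < rho -> f z = f w -> z = w.

Lemma ball_anal (z : C) : Cmod (z - a) < rho -> anal f z.
Proof.
  intros Hz. exists (rho - Cmod (z - a)). split; [lra|]. intros w Hw. apply Hf.
  replace (w - a)%C with ((w - z) + (z - a))%C by ring.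
  eapply Rle_lt_trans; [apply Cmod_triangle|]. lra.
Qed.

Lemma circle_gap (r : R) : 0 < r < rho ->
  exists m, 0 < m /\ forall t, 0 <= t <= 2 * PI -> m <= Cmod (f (a + circ r t)%C - f a).
Proof.
  intros Hr. apply (circle_min (fun z => f z - f a)%C); [lra| |].
  - intros z Hz. apply cont_minus; [apply cdiff_cont, Hf; lra|apply cont_const].
  - intros z Hz E. apply Cminus_eq_0 in E. apply inj in E; [|lra|rewrite Cmod_self; lra].
    rewrite E, Cmod_self in Hz. lra.
Qed.

(** As [w] tends to [a], the difference quotients based at points [w] with
    nonzero derivative have no zeros, so the minimum principle keeps them away
    from [0] at [a]. *)
Lemma univalent_derivative_neq_0 : C_derive f a <> 0.
Proof.
  intros H0. set (r := rho / 2). assert (Hr : 0 < r < rho) by (unfold r; lra).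
  destruct (circle_gap r Hr) as [m [Hm Hgap]].
  assert (Da : Cmod (a - a) < rho) by (rewrite Cmod_self; exact R0).
  assert (Ca : cont f a) by (apply cdiff_cont, Hf, Da).
  assert (Cq : cont (dq f a) a) by (apply cdiff_cont, dq_cdiff_self, ball_anal, Da).
  destruct (Ca (m / 2)) as [d1 [Hd1 H1]]; [lra|].
  (* The number [m / (4 * r)] is set against the lower bound [m / (3 * r)] that the minimum
     principle gives below. *)
  destruct (Cq (m / (4 * r))) as [d2 [Hd2 H2]]; [apply Rdiv_lt_0_compat; lra|].
  set (d := Rmin (Rmin d1 d2) (r / 2)).
  assert (Dp : 0 < d) by (repeat apply Rmin_glb_lt; lra).
  assert (L1 : d <= d1) by (eapply Rle_trans; [apply Rmin_l|apply Rmin_l]).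
  assert (L2 : d <= d2) by (eapply Rle_trans; [apply Rmin_l|apply Rmin_r]).
  assert (L3 : d <= r / 2) by apply Rmin_r.
  (* If the derivative vanished on a whole neighbourhood, [f] would be constant there, against
     injectivity. *)
  assert (Hw : exists w, Cmod (w - a) < d /\ C_derive f w <> 0).
  { apply NNPP. intros Hn.
    assert (K : forall w, Cmod (w - a) < d -> f w = f a).
    { apply constant_of_derivative_0. intros w Hw.
      destruct (Ceq_dec (C_derive f w) 0) as [E|E]; [|exfalso; apply Hn; now exists w].
      rewrite <- E. apply cdiff_C_derive, Hf. lra. }
    set (w := (a + RtoC (d / 2))%C).
    assert (W : Cmod (w - a) = d / 2).
    { unfold w. replace (a + RtoC (d / 2) - a)%C with (RtoC (d / 2)) by ring.
      rewrite Cmod_R, Rabs_pos_eq; lra. }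
    assert (E : w = a) by (apply inj; [lra|exact Da|apply K; lra]).
    rewrite E, Cmod_self in W. lra. }
  destruct Hw as [w [Hwd Hw0]].
  assert (Nwa : a <> w) by (intros E; rewrite <- E in Hw0; contradiction).
  assert (Dw : Cmod (w - a) < rho) by lra.
  assert (Nq : forall z, Cmod (z - a) < rho -> dq f w z <> 0).
  { intros z Hz. unfold dq. destruct (Ceq_dec z w) as [->|N]; [exact Hw0|].
    intros E. apply N, inj; [exact Hz|exact Dw|]. apply Cminus_eq_0.
    replace (f z - f w)%C with ((f z - f w) / (z - w) * (z - w))%C by (field; now apply Cminus_neq_0).
    rewrite E. ring. }
  assert (B : Cmod (/ dq f w a) <= 3 * r / m).
  { apply (max_principle_at (fun z => / dq f w z)%C a r); [lra| |].
    - intros z Hz. apply cdiff_inv; [|apply Nq; lra]. apply dq_cdiff; [now apply ball_anal|apply Hf; lra].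
    - intros t Ht. set (z := (a + circ r t)%C).
      assert (Ez : Cmod (z - a) = r).
      { unfold z. replace (a + circ r t - a)%C with (circ r t) by ring. apply Cmod_circ. lra. }
      assert (Nz : z <> w) by (intros E; rewrite E in Ez; lra).
      rewrite Cmod_inv by (apply Nq; lra). rewrite dq_neq by exact Nz.
      rewrite Cmod_div by now apply Cminus_neq_0.
      assert (G : m / 2 <= Cmod (f z - f w)).
      { specialize (Hgap t Ht). fold z in Hgap. specialize (H1 w ltac:(lra)).
        assert (T := Cmod_reverse (f z - f a) (f w - f a)).
        replace (f z - f a - (f w - f a))%C with (f z - f w)%C in T by ring. lra. }
      assert (G2 : Cmod (z - w) <= 3 * r / 2).
      { replace (z - w)%C with ((z - a) - (w - a))%C by ring.
        assert (T := Cmod_triangle (z - a) (- (w - a))). rewrite Cmod_opp in T.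
        unfold Cminus at 1. lra. }
      assert (P := proj1 (Cmod_gt_0 _) (Cminus_neq_0 _ _ Nz)).
      replace (/ (Cmod (f z - f w) / Cmod (z - w))) with (Cmod (z - w) / Cmod (f z - f w)) by (field; lra).
      replace (3 * r / m) with (3 * r / 2 / (m / 2)) by (field; lra).
      unfold Rdiv. apply Rmult_le_compat; try lra.
      + left. apply Rinv_0_lt_compat. lra.
      + apply Rinv_le_contravar; lra. }
  (* The difference quotient is symmetric, so [dq f w a = dq f a w], which is close to [dq f a a],
     the derivative assumed to be [0]. *)
  assert (S : Cmod (dq f w a) < m / (4 * r)).
  { rewrite dq_neq by exact Nwa.
    replace ((f a - f w) / (a - w))%C with (dq f a w - dq f a a)%C; [apply H2; lra|].
    rewrite dq_eq, H0, dq_neq by (intros E; now apply Nwa).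
    field. split; apply Cminus_neq_0; [exact Nwa|]; intros E; now apply Nwa. }
  assert (Na : dq f w a <> 0) by (apply Nq; exact Da).
  assert (Pa := proj1 (Cmod_gt_0 _) Na).
  rewrite Cmod_inv in B by exact Na.
  apply Rinv_lt_contravar in S; [|apply Rmult_lt_0_compat; [exact Pa|apply Rdiv_lt_0_compat; lra]].
  replace (/ (m / (4 * r))) with (4 * (r / m)) in S by (field; lra).
  replace (3 * r / m) with (3 * (r / m)) in B by (field; lra).
  assert (0 < r / m) by (apply Rdiv_lt_0_compat; lra). lra.
Qed.

(** If [u] is missed, [1 / (f - u)] is holomorphic on a closed disk around [a]. On its boundary [f]
    keeps a distance [m] from [f a], so the maximum principle keeps [u] at distance at least [m / 2]
    from [f a]. *)
Lemma open_mapping (e : R) : 0 < e ->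
  exists d, 0 < d /\ forall u, Cmod (u - f a) < d -> exists z, Cmod (z - a) < rho /\ Cmod (z - a) < e /\ f z = u.
Proof.
  intros He. set (r := Rmin e rho / 2).
  assert (L1 := Rmin_l e rho). assert (L2 := Rmin_r e rho).
  assert (L3 : 0 < Rmin e rho) by now apply Rmin_glb_lt.
  assert (Hr : 0 < r < rho) by (unfold r; lra).
  destruct (circle_gap r Hr) as [m [Hm Hgap]].
  exists (m / 2). split; [lra|]. intros u Hu. apply NNPP. intros Hn.
  assert (N : forall z, Cmod (z - a) <= r -> (f z - u)%C <> 0).
  { intros z Hz E. apply Hn. exists z. apply Cminus_eq_0 in E. unfold r in Hz. repeat split; [lra|lra|exact E]. }
  assert (B : Cmod (/ (f a - u)) <= 2 / m).
  { apply (max_principle_at (fun z => / (f z - u))%C a r); [lra| |].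
    - intros z Hz. apply cdiff_inv; [|now apply N].
      apply cdiff_minus; [apply Hf; lra|apply cdiff_const].
    - intros t Ht. assert (Ez : Cmod (a + circ r t - a) = r).
      { replace (a + circ r t - a)%C with (circ r t) by ring. apply Cmod_circ. lra. }
      rewrite Cmod_inv by (apply N; lra). specialize (Hgap t Ht).
      assert (T := Cmod_reverse (f (a + circ r t)%C - f a) (u - f a)).
      replace (f (a + circ r t) - f a - (u - f a))%C with (f (a + circ r t) - u)%C in T by ring.
      replace (2 / m) with (/ (m / 2)) by (field; lra). apply Rinv_le_contravar; lra. }
  assert (Na : (f a - u)%C <> 0) by (apply N; rewrite Cmod_self; lra).
  rewrite Cmod_inv in B by exact Na. assert (Pa := proj1 (Cmod_gt_0 _) Na).
  rewrite Cmod_minus_sym in Hu.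
  apply Rinv_lt_contravar in Hu; [|apply Rmult_lt_0_compat; lra].
  replace (/ (m / 2)) with (2 / m) in Hu by (field; lra). lra.
Qed.

(** The slope of the inverse at [f a] is [1 / dq f a (psi u)]. Openness makes [psi] continuous and
    ensures that all points near [f a] are values of [f]; univalence keeps the slope finite. *)
Lemma inverse_cder (psi : C -> C) : (forall z, Cmod (z - a) < rho -> psi (f z) = z) ->
  cder psi (f a) (/ C_derive f a).
Proof.
  intros Hpsi.
  assert (Da : Cmod (a - a) < rho) by (rewrite Cmod_self; exact R0).
  assert (Cp : cont psi (f a)).
  { intros e He. destruct (open_mapping e He) as [d [Hd H]]. exists d. split; [exact Hd|].
    intros u Hu. destruct (H u Hu) as [z [Z1 [Z2 <-]]]. now rewrite !Hpsi. }
  destruct (open_mapping 1 Rlt_0_1) as [d [Hd H]].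
  replace (/ C_derive f a)%C with (/ dq f a (psi (f a)))%C by (rewrite Hpsi, dq_eq; auto).
  apply (cder_intro psi (fun u => / dq f a (psi u))%C (f a) d Hd).
  - apply cont_inv.
    + apply (cont_comp (dq f a) psi); [exact Cp|]. rewrite Hpsi by exact Da.
      apply cdiff_cont, dq_cdiff_self, ball_anal, Da.
    + rewrite Hpsi, dq_eq by exact Da. exact univalent_derivative_neq_0.
  - intros u Hu. destruct (H u Hu) as [z [Z1 [_ <-]]]. rewrite !Hpsi by assumption.
    rewrite (dq_spec f a z) at 1.
    assert (N : dq f a z <> 0).
    { unfold dq. destruct (Ceq_dec z a) as [->|N]; [exact univalent_derivative_neq_0|].
      intros E. apply N, inj; [exact Z1|exact Da|]. apply Cminus_eq_0.
      replace (f z - f a)%C with ((f z - f a) / (z - a) * (z - a))%C by (field; now apply Cminus_neq_0).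
      rewrite E. ring. }
    field. exact N.
Qed.

End Univalent.

(** * Starlike functions *)

Lemma disk_0 : disk 0.
Proof. unfold disk. rewrite Cmod_0. lra. Qed.

Lemma schwarz_0 (f : C -> C) : holoD f -> (forall z, disk z -> Cmod (f z) <= 1) -> f 0 = 0 ->
  exists v : C -> C, holoD v /\ (forall z, disk z -> Cmod (v z) <= 1) /\ forall z, f z = (z * v z)%C.
Proof.
  intros Hf Hb H0. destruct (schwarz f 0 ltac:(lra) Hf Hb H0) as [v [Hv [Bv E]]].
  exists (fun z => - v z)%C. split; [intros z Hz; now apply cdiff_opp, Hv|].
  split; [intros z Hz; rewrite Cmod_opp; now apply Bv|].
  intros z. replace (f z) with (f z * (1 - 0 * z))%C by ring. rewrite E. ring.
Qed.

(** Schwarz's lemma for [(psi (k z) - psi 0) / 2] gives [|psi u - psi 0| <= 2 |u| / k]; [k] is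
    chosen so large that [u / k] lies in the disk and this bound is at most [e]. *)
Lemma liouville (psi : C -> C) : (forall u, cdiff psi u) -> (forall u, Cmod (psi u) <= 1) ->
  forall u, psi u = psi 0.
Proof.
  intros Hp Hb u. apply Cminus_eq_0, Cmod_small_0. intros e He.
  set (k := Cmod u + 1 + 2 * Cmod u / e).
  assert (Pu := Cmod_ge_0 u).
  assert (0 <= 2 * Cmod u / e) by (apply Rdiv_le_0_compat; lra).
  assert (Hk : 0 < k) by (unfold k; lra).
  assert (Nk : RtoC k <> 0) by (intros E; apply RtoC_inj in E; lra).
  assert (N2 : RtoC 2 <> 0) by (intros E; apply RtoC_inj in E; lra).
  destruct (schwarz_0 (fun z => (psi (RtoC k * z) - psi 0) / RtoC 2)%C) as [v [_ [Bv E]]].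
  - intros z _. apply cdiff_div; [|apply cdiff_const|exact N2].
    apply cdiff_minus; [|apply cdiff_const].
    apply (cdiff_comp psi (fun z => RtoC k * z)%C); [apply Hp|].
    apply cdiff_mult; [apply cdiff_const|apply cdiff_id].
  - intros z _. rewrite Cmod_div, Cmod_R, Rabs_pos_eq by (auto; lra).
    assert (T := Cmod_triangle (psi (RtoC k * z)%C) (- psi 0)). rewrite Cmod_opp in T.
    assert (B1 := Hb (RtoC k * z)%C). assert (B2 := Hb 0). unfold Cminus. lra.
  - replace (RtoC k * 0)%C with (RtoC 0) by ring. field.
  - set (z := (u / RtoC k)%C).
    assert (Mz : Cmod z = Cmod u / k) by (unfold z; rewrite Cmod_div, Cmod_R, Rabs_pos_eq by (auto; lra); reflexivity).
    assert (Lz : Cmod z < 1).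
    { rewrite Mz. apply Rmult_lt_reg_r with k; [exact Hk|]. unfold Rdiv.
      rewrite Rmult_assoc, Rinv_l by lra. unfold k; lra. }
    replace (psi u - psi 0)%C with (RtoC 2 * ((psi (RtoC k * z) - psi 0) / RtoC 2))%C.
    + rewrite E, !Cmod_mult, Cmod_R, Rabs_pos_eq by lra.
      assert (B := Bv z Lz). assert (Pz := Cmod_ge_0 z).
      apply Rle_trans with (2 * Cmod z); [nra|]. rewrite Mz.
      apply Rmult_le_reg_r with k; [exact Hk|].
      replace (2 * (Cmod u / k) * k) with (e * (2 * Cmod u / e)) by (field; lra).
      apply Rmult_le_compat_l; unfold k; lra.
    + replace (RtoC k * z)%C with u by (unfold z; field; exact Nk). field.
Qed.

Section Starlike.

Variables (chi : C -> C) (p : R).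
Hypothesis Hp : 0 < p < 1.
Hypothesis Hchi : holoD chi.
Hypothesis inj : forall z w, disk z -> disk w -> chi z = chi w -> z = w.
Hypothesis Hchip : chi (RtoC p) = 0.
Hypothesis star : forall z t, disk z -> 0 < t < 1 -> exists w, disk w /\ chi w = (RtoC t * chi z)%C.

Lemma disk_p : disk (RtoC p).
Proof. unfold disk. rewrite Cmod_R, Rabs_pos_eq; lra. Qed.

Lemma disk_in (a z : C) : Cmod (z - a) < 1 - Cmod a -> disk z.
Proof. intros H. unfold disk. assert (T := Cmod_reverse z a). lra. Qed.

Lemma chi_neq_0 (z : C) : disk z -> z <> RtoC p -> chi z <> 0.
Proof. intros Hz N E. apply N, inj; [exact Hz|exact disk_p|]. now rewrite Hchip. Qed.

Lemma chi_derivative_neq_0 (z : C) : disk z -> C_derive chi z <> 0.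
Proof.
  intros Hz. apply (univalent_derivative_neq_0 chi z (1 - Cmod z)); [unfold disk in Hz; lra| |].
  - intros w Hw. apply Hchi. eapply disk_in, Hw.
  - intros w u Hw Hu. apply inj; eapply disk_in; eassumption.
Qed.

(** [z |-> chi^{-1} (t chi z)] is a self-map of the disk fixing [p]. *)
Lemma starlike_schwarz_pick (z w : C) (t : R) : disk z -> disk w -> 0 < t < 1 ->
  chi w = (RtoC t * chi z)%C ->
  Cmod (RtoC p - w) * Cmod (1 - RtoC p * z) <= Cmod (RtoC p - z) * Cmod (1 - RtoC p * w).
Proof.
  intros Hz Hw Ht E.
  (* Any [y] satisfies [P u] when [u] has no preimage, so choice produces an inverse of [chi]
     defined on all of [C]. *)
  set (P := fun u y => forall x, disk x -> chi x = u -> y = x).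
  assert (HP : forall u, exists y, P u y).
  { intros u. destruct (classic (exists x, disk x /\ chi x = u)) as [[x [Hx Ex]]|N].
    - exists x. intros x' Hx' Ex'. apply inj; congruence.
    - exists 0. intros x Hx Ex. exfalso. apply N. now exists x. }
  set (psi := fun u => proj1_sig (constructive_indefinite_description _ (HP u))).
  assert (Hpsi : forall x, disk x -> psi (chi x) = x).
  { intros x Hx. apply (proj2_sig (constructive_indefinite_description _ (HP (chi x)))); auto. }
  clearbody psi. clear P HP.
  set (om := fun x => psi (RtoC t * chi x)%C).
  assert (Hom : forall x, disk x -> disk (om x) /\ chi (om x) = (RtoC t * chi x)%C).
  { intros x Hx. destruct (star x t Hx Ht) as [y [Hy Ey]]. unfold om. rewrite <- Ey, Hpsi by exact Hy. auto. }
  assert (Dom : holoD om).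
  { intros x Hx. destruct (Hom x Hx) as [D1 D2].
    apply (cdiff_comp psi (fun x => RtoC t * chi x)%C); [|apply cdiff_mult; [apply cdiff_const|now apply Hchi]].
    rewrite <- D2. eexists. apply (inverse_cder chi (om x) (1 - Cmod (om x))).
    - unfold disk in D1. lra.
    - intros y Hy. apply Hchi. eapply disk_in, Hy.
    - intros y y' Hy Hy'. apply inj; eapply disk_in; eassumption.
    - intros y Hy. apply Hpsi. eapply disk_in, Hy. }
  assert (N : forall x, disk x -> (1 - RtoC p * x)%C <> 0).
  { intros x Hx. apply one_minus_pz_neq_0; [lra|unfold disk in Hx; lra]. }
  (* Schwarz-Pick at [p]: composing with the automorphism that sends [p] to [0] gives a bounded
     function vanishing at [p]. *)
  destruct (schwarz (fun x => (RtoC p - om x) / (1 - RtoC p * om x))%C p) as [v [_ [Bv Ev]]]; [lra| | | |].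
  - intros x Hx. apply cdiff_div; [| |now apply N, Hom];
    (apply cdiff_minus; [apply cdiff_const|]); [now apply Dom|].
    apply cdiff_mult; [apply cdiff_const|now apply Dom].
  - intros x Hx. destruct (Hom x Hx) as [D1 _]. rewrite Cmod_div by now apply N.
    assert (P0 := proj1 (Cmod_gt_0 _) (N _ D1)).
    apply Rmult_le_reg_r with (Cmod (1 - RtoC p * om x)); [exact P0|].
    unfold Rdiv. rewrite Rmult_assoc, Rinv_l, Rmult_1_r, Rmult_1_l by lra.
    apply blaschke_le; [lra|]. unfold disk in D1. lra.
  - assert (Op : om (RtoC p) = RtoC p).
    { unfold om. rewrite Hchip. replace (RtoC t * 0)%C with (chi (RtoC p)) by (rewrite Hchip; ring).
      apply Hpsi, disk_p. }
    rewrite Op. field. apply N, disk_p.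
  - assert (Ew : om z = w) by (unfold om; rewrite <- E; now apply Hpsi).
    specialize (Ev z). cbv beta in Ev. rewrite Ew in Ev. specialize (Bv z Hz).
    assert (Ev' : ((RtoC p - w) * (1 - RtoC p * z) = (RtoC p - z) * v z * (1 - RtoC p * w))%C).
    { rewrite <- Ev. field. now apply N. }
    rewrite <- Cmod_mult, Ev', !Cmod_mult.
    apply Rmult_le_compat_r; [apply Cmod_ge_0|].
    rewrite <- (Rmult_1_r (Cmod (RtoC p - z))) at 2. apply Rmult_le_compat_l; [apply Cmod_ge_0|exact Bv].
Qed.

(** Squaring the Schwarz-Pick inequality, the difference of the two sides is [(1 - p^2)] times twice
    the claimed quantity plus [(1 + p^2 - 2 p Re z) |w - z|^2]. The last term is nonnegative, so the
    first-order inequality holds exactly, with no error term, for every [t]. *)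
Lemma starlike_step (z w : C) (t : R) : disk z -> disk w -> 0 < t < 1 ->
  chi w = (RtoC t * chi z)%C ->
  Re (Cconj ((z - RtoC p) * (1 - RtoC p * z)) * (w - z)) <= 0.
Proof.
  intros Hz Hw Ht E. assert (H := starlike_schwarz_pick z w t Hz Hw Ht E).
  assert (H2 : (Cmod (RtoC p - w) * Cmod (1 - RtoC p * z)) ^ 2 <= (Cmod (RtoC p - z) * Cmod (1 - RtoC p * w)) ^ 2).
  { apply pow_incr. split; [apply Rmult_le_pos; apply Cmod_ge_0|exact H]. }
  rewrite !Rpow_mult_distr, !Cmod2_alt in H2.
  assert (Bz : Re z <= 1).
  { eapply Rle_trans; [apply Rle_abs|]. eapply Rle_trans; [apply re_le_Cmod|]. unfold disk in Hz. lra. }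
  destruct z as [x y], w as [u v]. simpl in *.
  match goal with |- ?G <= 0 => set (g := G) end.
  match type of H2 with ?L <= ?M =>
    assert (I : L - M = (1 - p * p) * (2 * g + (1 + p * p - 2 * p * x) * ((u - x) * (u - x) + (v - y) * (v - y))))
      by (unfold g; ring) end.
  assert (I1 : 0 <= (1 + p * p - 2 * p * x) * ((u - x) * (u - x) + (v - y) * (v - y))).
  { apply Rmult_le_pos; [nra|]. assert (Q1 := Rle_0_sqr (u - x)). assert (Q2 := Rle_0_sqr (v - y)).
    unfold Rsqr in *. lra. }
  assert (I2 : 0 < 1 - p * p) by nra.
  apply Rnot_lt_le. intros Hg.
  assert (0 < (1 - p * p) * (2 * g + (1 + p * p - 2 * p * x) * ((u - x) * (u - x) + (v - y) * (v - y)))).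
  { apply Rmult_lt_0_compat; lra. }
  lra.
Qed.

(** For [chi w = (1 - s) chi z] with small [s], the displacement [w - z] is about [- s chi / chi'];
    [starlike_step] then gives the sign of [Re (conj A chi / chi')], which is also that of
    [Re (A chi' / chi)]. *)
Lemma starlike_Re_ge_0 (z : C) : disk z -> z <> RtoC p ->
  0 <= Re ((z - RtoC p) * (1 - RtoC p * z) * C_derive chi z / chi z).
Proof.
  intros Hz Hn.
  assert (Nc := chi_neq_0 z Hz Hn). assert (Nd := chi_derivative_neq_0 z Hz).
  set (A := ((z - RtoC p) * (1 - RtoC p * z))%C).
  (* With the difference quotient in place of the derivative the relation [conj A (w - z) = - s G w]
     is exact, so only the continuity of [G] at [z] is needed for the limit. *)
  set (G := fun w => (Cconj A * chi z / dq chi z w)%C).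
  assert (CG : cont G z).
  { apply cont_div; [apply cont_const| |now rewrite dq_eq].
    apply cdiff_cont, dq_cdiff_self. now apply holoD_anal. }
  assert (HG : 0 <= Re (G z)).
  { apply Rnot_lt_le. intros Hlt.
    destruct (CG (- Re (G z))) as [d [Hd H]]; [lra|].
    (* The point over [(1 - s) chi z] is taken from the open mapping property, which also places it
       near [z]. *)
    destruct (open_mapping chi z (1 - Cmod z)) with (e := d) as [d' [Hd' Hop]];
      [unfold disk in Hz; lra|intros w Hw; apply Hchi; eapply disk_in, Hw
      |intros w u Hw Hu; apply inj; eapply disk_in; eassumption|exact Hd|].
    assert (Pc := proj1 (Cmod_gt_0 _) Nc).
    set (s := Rmin (1 / 2) (d' / (2 * Cmod (chi z)))).
    assert (S1 : s <= 1 / 2) by apply Rmin_l.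
    assert (S2 : s <= d' / (2 * Cmod (chi z))) by apply Rmin_r.
    assert (S0 : 0 < s) by (apply Rmin_glb_lt; [lra|apply Rdiv_lt_0_compat; lra]).
    destruct (Hop (RtoC (1 - s) * chi z)%C) as [w [W1 [W2 W3]]].
    { replace (RtoC (1 - s) * chi z - chi z)%C with (- (RtoC s * chi z))%C by (rewrite RtoC_minus; ring).
      rewrite Cmod_opp, Cmod_mult, Cmod_R, Rabs_pos_eq by lra.
      apply Rle_lt_trans with (d' / (2 * Cmod (chi z)) * Cmod (chi z)); [apply Rmult_le_compat_r; lra|].
      replace (d' / (2 * Cmod (chi z)) * Cmod (chi z)) with (d' / 2) by (field; lra). lra. }
    assert (Dw := disk_in z w W1).
    assert (St := starlike_step z w (1 - s) Hz Dw ltac:(lra) W3). fold A in St.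
    specialize (H w W2).
    assert (Ed : (- (RtoC s * chi z) = dq chi z w * (w - z))%C).
    { replace (dq chi z w * (w - z))%C with (chi w - chi z)%C by (rewrite (dq_spec chi z w); ring).
      rewrite W3, RtoC_minus. ring. }
    assert (Nq : dq chi z w <> 0).
    { intros E0. rewrite E0 in Ed.
      assert (F : (RtoC s * chi z)%C = 0) by (replace (RtoC s * chi z)%C with (- - (RtoC s * chi z))%C by ring; rewrite Ed; ring).
      destruct (Cmult_integral _ _ F) as [F1|F1]; [apply RtoC_inj in F1; lra|contradiction]. }
    assert (Ew : (Cconj A * (w - z) = RtoC (- s) * G w)%C).
    { unfold G. replace (w - z)%C with (dq chi z w * (w - z) / dq chi z w)%C by (field; exact Nq).
      rewrite <- Ed, RtoC_opp. field. exact Nq. }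
    rewrite Ew, re_scal_l in St.
    assert (R1 := re_le_Cmod (G w - G z)).
    assert (R2 : Re (G w - G z) = Re (G w) - Re (G z)) by (unfold Re, Cminus; simpl; ring).
    rewrite R2 in R1. assert (R3 := Rle_abs (Re (G w) - Re (G z))).
    assert (Re (G w) < 0) by lra. nra. }
  unfold G in HG. rewrite dq_eq in HG.
  assert (NA : A <> 0).
  { intros E. destruct (Cmult_integral _ _ E) as [F|F].
    - now apply (Cminus_neq_0 _ _ Hn).
    - revert F. apply one_minus_pz_neq_0; [lra|unfold disk in Hz; lra]. }
  set (X := (A * C_derive chi z / chi z)%C).
  (* Up to a positive factor, a number and the conjugate of its reciprocal agree. *)
  assert (EX : (Cconj A * chi z / C_derive chi z)%C = (RtoC (Cmod A ^ 2 / Cmod X ^ 2) * Cconj X)%C).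
  { assert (NX : X <> 0).
    { unfold X. intros E. apply NA.
      replace A with (A * C_derive chi z / chi z * chi z / C_derive chi z)%C by (field; split; assumption).
      rewrite E. field. exact Nd. }
    assert (PX := proj1 (Cmod_gt_0 _) NX).
    rewrite RtoC_div by (apply pow_nonzero; lra). rewrite !Cmod2_conj.
    assert (NcX : Cconj X <> 0) by (apply Cmod_gt_0; rewrite Cmod_conj; exact PX).
    replace (A * Cconj A / (X * Cconj X) * Cconj X)%C with (A * Cconj A / X)%C by (field; split; assumption).
    unfold X. field. repeat split; assumption. }
  rewrite EX, re_scal_l, re_conj in HG.
  apply Rnot_lt_le. intros Hlt.
  assert (NX : X <> 0) by (intros E; rewrite E in Hlt; simpl in Hlt; lra).
  assert (0 < Cmod A ^ 2 / Cmod X ^ 2).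
  { apply Rdiv_lt_0_compat; apply pow_lt; now apply Cmod_gt_0. }
  nra.
Qed.

(** With [q = chi / (z - p)], the function [P = (1 - p z) chi' / q] is holomorphic across [p], has
    nonnegative real part, and satisfies [P(p) = 1 - p^2 = a]. Its Cayley transform
    [(P - a) / (P + a)] therefore vanishes at [p] and factors by [schwarz]; the automorphism
    [V = (p - v) / (1 - p v)] of the cofactor [v] brings the relation to the stated form. *)
Lemma starlike_ode : exists V : C -> C, holoD V /\ (forall z, disk z -> Cmod (V z) <= 1) /\
  forall z, disk z -> z <> RtoC p ->
    let Q := fun w => ((RtoC p - w) * (1 - RtoC p * w) / chi w)%C in
    C_derive Q z = (V z * (z * C_derive Q z - RtoC 2 * Q z))%C.
Proof.
  set (a := 1 - p ^ 2). assert (Ha : 0 < a) by (unfold a; nra).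
  set (q := dq chi (RtoC p)).
  assert (Hq : holoD q).
  { intros z Hz. apply dq_cdiff; [|now apply Hchi]. apply holoD_anal; [exact Hchi|exact disk_p]. }
  assert (Eq : forall z, chi z = (q z * (z - RtoC p))%C).
  { intros z. rewrite (dq_spec chi (RtoC p) z), Hchip. unfold q. ring. }
  assert (Nq : forall z, disk z -> q z <> 0).
  { intros z Hz. destruct (Ceq_dec z (RtoC p)) as [->|N].
    - unfold q. rewrite dq_eq. now apply chi_derivative_neq_0.
    - intros E. apply (chi_neq_0 z Hz N). rewrite Eq, E. ring. }
  assert (N1 : forall z, Cmod z <= 1 -> (1 - RtoC p * z)%C <> 0).
  { intros z Hz. apply one_minus_pz_neq_0; lra. }
  set (P := fun z => ((1 - RtoC p * z) * C_derive chi z / q z)%C).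
  assert (HP : holoD P).
  { intros z Hz. apply cdiff_div; [|now apply Hq|now apply Nq].
    apply cdiff_mult.
    - apply cdiff_minus; [apply cdiff_const|apply cdiff_mult; [apply cdiff_const|apply cdiff_id]].
    - apply C_derive_cdiff. now apply holoD_anal. }
  assert (Pp : P (RtoC p) = RtoC a).
  { unfold P, q. rewrite dq_eq.
    replace (RtoC a) with (1 - RtoC p * RtoC p)%C
      by (unfold a; rewrite RtoC_minus, <- RtoC_mult; do 2 f_equal; simpl; f_equal; ring).
    field. apply chi_derivative_neq_0, disk_p. }
  assert (RP : forall z, disk z -> 0 <= Re (P z)).
  { intros z Hz. destruct (Ceq_dec z (RtoC p)) as [->|N].
    - rewrite Pp. simpl. lra.
    - assert (T := starlike_Re_ge_0 z Hz N). rewrite Eq in T.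
      replace (P z) with ((z - RtoC p) * (1 - RtoC p * z) * C_derive chi z / (q z * (z - RtoC p)))%C; [exact T|].
      unfold P. field. split; [now apply Nq|now apply Cminus_neq_0]. }
  assert (NP : forall z, disk z -> (P z + RtoC a)%C <> 0).
  { intros z Hz E. specialize (RP z Hz). assert (F : Re (P z + RtoC a) = 0) by now rewrite E.
    rewrite re_plus in F. change (Re (RtoC a)) with a in F. lra. }
  destruct (schwarz (fun z => (P z - RtoC a) / (P z + RtoC a))%C p) as [v [Hv [Bv Ev]]]; [lra| | | |].
  - intros z Hz. apply cdiff_div; [apply cdiff_minus|apply cdiff_plus|now apply NP];
    first [now apply HP|apply cdiff_const].
  - intros z Hz. rewrite Cmod_div by now apply NP.
    assert (P0 := proj1 (Cmod_gt_0 _) (NP _ Hz)).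
    apply Rmult_le_reg_r with (Cmod (P z + RtoC a)); [exact P0|].
    unfold Rdiv. rewrite Rmult_assoc, Rinv_l, Rmult_1_r, Rmult_1_l by lra.
    apply Cmod_le_sqr. rewrite !Cmod2_alt. specialize (RP z Hz).
    destruct (P z) as [x y]. simpl in *.
    assert (0 <= x * a) by (apply Rmult_le_pos; lra). lra.
  - cbv beta. rewrite Pp. field. intros E. rewrite <- RtoC_plus in E. apply RtoC_inj in E. lra.
  - exists (fun z => (RtoC p - v z) / (1 - RtoC p * v z))%C. split; [|split].
    + intros z Hz. apply cdiff_div; [| |now apply N1, Bv];
      (apply cdiff_minus; [apply cdiff_const|]); [now apply Hv|].
      apply cdiff_mult; [apply cdiff_const|now apply Hv].
    + intros z Hz. specialize (Bv z Hz). assert (Nv := N1 _ Bv). rewrite Cmod_div by exact Nv.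
      assert (P0 := proj1 (Cmod_gt_0 _) Nv).
      apply Rmult_le_reg_r with (Cmod (1 - RtoC p * v z)); [exact P0|].
      unfold Rdiv. rewrite Rmult_assoc, Rinv_l, Rmult_1_r, Rmult_1_l by lra.
      apply blaschke_le; [lra|exact Bv].
    + intros z Hz N Q.
      assert (Nc := chi_neq_0 z Hz N). assert (Dz : Cmod z <= 1) by (unfold disk in Hz; lra).
      assert (Nz := N1 z Dz). assert (Nv := N1 _ (Bv z Hz)).
      assert (Np : (z - RtoC p)%C <> 0) by now apply Cminus_neq_0.
      set (D := C_derive chi z).
      assert (EQ : C_derive Q z = (((- (1 - RtoC p * z) - RtoC p * (RtoC p - z)) * chi z
        - (RtoC p - z) * (1 - RtoC p * z) * D) / (chi z * chi z))%C).
      { apply cder_C_derive. unfold Q. eapply cder_eq; [|apply cder_div; [|apply cdiff_C_derive, Hchi, Hz|exact Nc]].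
        2: apply cder_mult; apply cder_minus; [apply cder_const|apply cder_id|apply cder_const|].
        2: apply cder_mult; [apply cder_const|apply cder_id].
        fold D. cbv beta. f_equal. ring. }
      rewrite EQ. unfold Q.
      assert (EP : (P z * chi z = (z - RtoC p) * (1 - RtoC p * z) * D)%C).
      { unfold P. fold D. rewrite Eq. field. now apply Nq. }
      assert (ED : (D = P z * chi z / ((z - RtoC p) * (1 - RtoC p * z)))%C).
      { rewrite EP. field. split; assumption. }
      specialize (Ev z). cbv beta in Ev.
      assert (Ev' : ((P z - RtoC a) * (1 - RtoC p * z) = (RtoC p - z) * v z * (P z + RtoC a))%C).
      { rewrite <- Ev. field. now apply NP. }
      assert (Ea : RtoC a = (1 - RtoC p * RtoC p)%C).
      { unfold a. rewrite RtoC_minus, <- RtoC_mult. do 2 f_equal. simpl. f_equal. ring. }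
      rewrite Ea in Ev'. clear Ev EP EQ Ea.
      (* In terms of [P], the equation reads [V (L - z P) = M - P]. *)
      set (L := (RtoC 2 * RtoC p - (1 + RtoC p * RtoC p) * z)%C).
      set (M := (1 + RtoC p * RtoC p - RtoC 2 * RtoC p * z)%C).
      assert (K : ((RtoC p - v z) * (L - z * P z) = (1 - RtoC p * v z) * (M - P z))%C).
      { apply Cminus_eq_0. transitivity ((P z - (1 - RtoC p * RtoC p)) * (1 - RtoC p * z)
          - (RtoC p - z) * v z * (P z + (1 - RtoC p * RtoC p)))%C.
        - unfold L, M. ring.
        - rewrite Ev'. ring. }
      rewrite ED.
      transitivity ((1 - RtoC p * v z) * (M - P z) / (1 - RtoC p * v z) / (- chi z))%C.
      { unfold M. field. repeat split; assumption. }
      rewrite <- K. unfold L. field. repeat split; assumption.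
Qed.

End Starlike.

(** * Concave functions *)

(** Comparing coefficients in the equation for [Q] gives
    [sum m |q_m| s^m <= s * sum |m - 2| |q_m| s^m], and the difference of the two
    sides is at least [2 * sum |q_m| s^m - (2 + 2 s + |q_1| s + |q_1| s^2)]. *)
Lemma ode_majorant (V Q : C -> C) (s : R) (N : nat) :
  holoD V -> (forall z, disk z -> Cmod (V z) <= 1) -> anal Q 0 -> Q 0 = 1 ->
  nearC 0 (fun z => C_derive Q z = (V z * (z * C_derive Q z - RtoC 2 * Q z))%C) ->
  0 <= s <= 1 / 3 -> MF N Q s <= (1 + s) ^ 2.
Proof.
  intros HV BV HQ Q0 HE Hs.
  set (W := fun z => (z * C_derive Q z + (- RtoC 2) * Q z)%C).
  assert (HQ' := anal_C_derive Q 0 HQ).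
  assert (A1 : anal (fun z => z * C_derive Q z)%C 0) by (apply anal_mult; [apply anal_id|exact HQ']).
  assert (A2 : anal (fun z => (- RtoC 2) * Q z)%C 0) by (apply anal_mult; [apply anal_const|exact HQ]).
  assert (HW : anal W 0) by now apply anal_plus.
  assert (AV : anal V 0) by (apply holoD_anal; [exact HV|exact disk_0]).
  set (q := fun n => Cmod (tc Q n)).
  assert (TW : forall n, Cmod (tc W n) = Rabs (INR n - 2) * q n).
  { intros n. unfold W. rewrite tc_plus, tc_scal by assumption.
    assert (E : tc (fun z => z * C_derive Q z)%C n = (RtoC (INR n) * tc Q n)%C).
    { destruct n as [|n]; [simpl; ring|]. rewrite tc_mul_id, tc_C_derive by assumption. reflexivity. }
    rewrite E. unfold q. rewrite <- Cmod_R, <- Cmod_mult, RtoC_minus. f_equal. ring. }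
  assert (TQ : forall n, Cmod (tc (C_derive Q) n) = INR (S n) * q (S n)).
  { intros n. rewrite tc_C_derive by exact HQ. rewrite Cmod_mult, Cmod_R, Rabs_pos_eq; [reflexivity|apply pos_INR]. }
  assert (Main : forall N, Mr N (fun n => INR (S n) * q (S n)) s <= Mr N (fun n => Rabs (INR n - 2) * q n) s).
  { intros M. rewrite <- (Mr_ext M _ _ s TQ), <- (Mr_ext M _ _ s TW).
    change (MF M (C_derive Q) s <= MF M W s).
    rewrite (MF_germ M (C_derive Q) (fun z => V z * W z)%C).
    - eapply Rle_trans; [apply MF_mult; [lra|exact AV|exact HW]|].
      rewrite <- (Rmult_1_l (MF M W s)) at 2. apply Rmult_le_compat_r; [apply MF_ge_0; lra|].
      now apply bohr.
    - now apply anal_mult.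
    - revert HE. apply nearC_imp. intros z E. rewrite E at 1. unfold W. f_equal. ring. }
  assert (q0 : q 0%nat = 1) by (unfold q; simpl; rewrite Q0; apply Cmod_1).
  assert (Pq : forall n, 0 <= q n) by (intros; apply Cmod_ge_0).
  (* The comparison of coefficients at order zero: [q 1 <= 2 * q 0]. *)
  assert (q1 : q 1%nat <= 2).
  { assert (H := Main 0%nat). simpl in H. rewrite q0, Rabs_left in H; lra. }
  set (x := q 1%nat) in *.
  set (c := 2 + 2 * s + x * s + x * s ^ 2).
  assert (Px : 0 <= x) by apply Pq.
  (* For [m >= 2] the term [m - s (m - 2)] is at least [2] since [s <= 1]; the indices [0] and [1]
     fall short, and [c] collects the deficit. The summand [INR M * (...)] is kept in reserve
     because the last coefficient meets its negative partner only at the next order. *)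
  assert (K : forall M, 2 * Mr (S (S M)) q s - c + INR M * (q (S (S M)) * s ^ S (S M)) <=
    s * (Mr (S M) (fun n => INR (S n) * q (S n)) s - Mr (S M) (fun n => Rabs (INR n - 2) * q n) s)).
  { induction M as [|M IH].
    - simpl. unfold shift. fold x. rewrite q0. change (INR 1) with 1.
      rewrite (Rabs_left (0 - 2)), (Rabs_left (1 - 2)) by lra. unfold c. right. ring.
    - rewrite (Mr_S (S (S M)) q), (Mr_S (S M) (fun n => INR (S n) * q (S n))),
        (Mr_S (S M) (fun n => Rabs (INR n - 2) * q n)).
      set (t := q (S (S M)) * s ^ S (S M)) in *.
      assert (Pt : 0 <= t) by (apply Rmult_le_pos; [apply Pq|apply pow_le; lra]).
      set (t' := q (S (S (S M))) * s ^ S (S (S M))).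
      assert (EA : Rabs (INR (S (S M)) - 2) = INR M).
      { rewrite !S_INR. replace (INR M + 1 + 1 - 2) with (INR M) by ring. apply Rabs_pos_eq, pos_INR. }
      rewrite EA.
      replace (INR M * q (S (S M)) * s ^ S (S M)) with (INR M * t) by (unfold t; ring).
      assert (EB : s * (INR (S (S (S M))) * q (S (S (S M))) * s ^ S (S M)) = (INR M + 3) * t').
      { unfold t'. rewrite !S_INR. simpl. ring. }
      replace (INR (S M)) with (INR M + 1) by (rewrite S_INR; ring).
      assert (T : s * (INR M * t) <= INR M * t).
      { rewrite <- (Rmult_1_l (INR M * t)) at 2. apply Rmult_le_compat_r; [|lra].
        apply Rmult_le_pos; [apply pos_INR|exact Pt]. }
      lra. }
  assert (B : Mr (S (S N)) q s <= (1 + s) ^ 2).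
  { specialize (K N). specialize (Main (S N)).
    assert (P1 : 0 <= INR N * (q (S (S N)) * s ^ S (S N))).
    { apply Rmult_le_pos; [apply pos_INR|]. apply Rmult_le_pos; [apply Pq|apply pow_le; lra]. }
    assert (P2 : s * (Mr (S N) (fun n => INR (S n) * q (S n)) s - Mr (S N) (fun n => Rabs (INR n - 2) * q n) s) <= 0) by nra.
    (* At [q 1 = 2] the two sides coincide; this is the case [Q = (1 + z)^2]. *)
    assert (P3 : c <= 2 * (1 + s) ^ 2) by (unfold c; nra). lra. }
  unfold MF. fold q.
  assert (M1 := Mr_mono N q s ltac:(lra) Pq). assert (M2 := Mr_mono (S N) q s ltac:(lra) Pq). lra.
Qed.

Lemma inv_linear_neq_0 (al : C) : (1 - al * 0)%C <> 0.
Proof.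
  intros E. assert (H := Cmod_1).
  replace (RtoC 1) with (1 - al * 0)%C in H by ring. rewrite E, Cmod_0 in H. lra.
Qed.

Lemma anal_inv_linear (al : C) : anal (fun z => / (1 - al * z))%C 0.
Proof.
  apply anal_inv; [|apply inv_linear_neq_0].
  apply anal_minus; [apply anal_const|apply anal_mult; [apply anal_const|apply anal_id]].
Qed.

(** The difference quotient at [0] of [1 / (1 - al z)] is [al] times the same function, so the
    geometric bound reproduces itself. *)
Lemma MF_inv_linear (al : C) (s : R) (N : nat) : 0 <= s -> Cmod al * s < 1 ->
  MF N (fun z => / (1 - al * z))%C s <= / (1 - Cmod al * s).
Proof.
  intros Hs Ha. assert (Pa := Cmod_ge_0 al).
  assert (Q : 0 <= Cmod al * s) by now apply Rmult_le_pos.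
  assert (E0 : Cmod (/ (1 - al * 0)) = 1).
  { replace (/ (1 - al * 0))%C with (RtoC 1); [apply Cmod_1|]. field. }
  induction N as [|N IH].
  - unfold MF. simpl. rewrite E0. rewrite <- Rinv_1. apply Rinv_le_contravar; lra.
  - rewrite MF_S, E0. rewrite (MF_germ N _ (fun z => al * / (1 - al * z))%C).
    + rewrite MF_scal by apply anal_inv_linear.
      apply Rle_trans with (1 + s * (Cmod al * / (1 - Cmod al * s))).
      * apply Rplus_le_compat_l, Rmult_le_compat_l; [exact Hs|]. now apply Rmult_le_compat_l.
      * right. field. lra.
    + apply anal_mult; [apply anal_const|apply anal_inv_linear].
    + apply eqg_dq.
      * apply cdiff_cont, anal_cdiff, anal_mult; [apply anal_const|apply anal_inv_linear].
      * apply (nearC_imp _ (fun z => (1 - al * z)%C <> 0)).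
        -- intros z Hz. field. exact Hz.
        -- apply nearC_neq_0; [|apply inv_linear_neq_0].
           apply cont_minus; [apply cont_const|apply cont_mult; [apply cont_const|apply cont_id]].
Qed.

Section Concave.

Variables (p : R) (phi : C -> Chat) (c : C).
Hypothesis Hp : 0 < p < 1.
Hypothesis Hphi : concave_class p phi.
Hypothesis Hc : ~ image_disk phi (Some c).

(** The function [chi] of the starlike section. The value [0] at infinity is the true value at the
    pole, and it makes the function holomorphic there. *)
Definition recip (z : C) : C := match phi z with None => RtoC 0 | Some u => (/ (u - c))%C end.

Lemma phi_omits (z u : C) : disk z -> phi z = Some u -> (u - c)%C <> 0.
Proof.
  intros Hz E E0. apply Hc. exists z. split; [exact Hz|]. rewrite E. f_equal. now apply Cminus_eq_0.
Qed.

Lemma phi_analytic (z : C) : disk z -> z <> RtoC p ->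
  anal (fun w => fin (phi w)) z /\ nearC z (fun w => phi w <> None).
Proof.
  destruct Hphi as [_ [_ [H _]]]. intros Hz N. destruct (H z Hz N) as [e [He Hw]].
  split; exists e; (split; [exact He|]); intros w Hwe; destruct (Hw w Hwe) as [H1 H2]; [|exact H1].
  now apply cdiff_iff.
Qed.

Lemma recip_neq_p (z : C) : disk z -> z <> RtoC p ->
  nearC z (fun w => recip w = (/ (fin (phi w) - c))%C) /\ (fin (phi z) - c)%C <> 0.
Proof.
  intros Hz N. destruct (phi_analytic z Hz N) as [_ H2]. split.
  - revert H2. apply nearC_imp. intros w Hw. unfold recip. destruct (phi w) as [u|]; [reflexivity|contradiction].
  - apply nearC_at in H2. cbv beta in H2. assert (P := phi_omits z).
    destruct (phi z) as [u|]; [|contradiction]. simpl. now apply P.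
Qed.

Lemma recip_holo : holoD recip.
Proof.
  intros z Hz. destruct (Ceq_dec z (RtoC p)) as [->|N].
  - destruct Hphi as [_ [_ [_ [[Pn [F [e [He [F0 [FD FE]]]]]] _]]]].
    set (D := fun w => (F w - c * (w - RtoC p))%C).
    assert (CD : forall w, Cmod (w - RtoC p) < e -> cdiff D w).
    { intros w Hw. apply cdiff_minus; [now apply cdiff_iff, FD|].
      apply cdiff_mult; [apply cdiff_const|]. apply cdiff_minus; [apply cdiff_id|apply cdiff_const]. }
    apply cdiff_local with (g := (fun w => (w - RtoC p) / D w)%C) (r := e); [exact He| |].
    + intros w Hw. unfold recip. destruct (Ceq_dec w (RtoC p)) as [->|Nw].
      * rewrite Pn. replace (RtoC p - RtoC p)%C with (RtoC 0) by ring. unfold Cdiv. ring.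
      * assert (Nz := Cminus_neq_0 _ _ Nw).
        rewrite FE by (split; [now apply Cmod_gt_0|exact Hw]).
        unfold D. simpl.
        (* If the denominator vanishes, both sides are [0] because division by [0] yields [0]; this
           avoids shrinking the neighbourhood. *)
        destruct (Ceq_dec (F w - c * (w - RtoC p)) 0) as [E|E].
        -- rewrite E. replace (F w / ((w - RtoC p) * 1) - c)%C with ((F w - c * (w - RtoC p)) / (w - RtoC p))%C
             by (field; exact Nz).
           rewrite E. unfold Cdiv. rewrite Cmult_0_l.
           assert (I0 : (/ RtoC 0)%C = 0) by (apply injective_projections; simpl; unfold Rdiv; ring).
           rewrite I0. ring.
        -- field. repeat split; assumption.
    + apply cdiff_div; [|apply CD; rewrite Cmod_self; exact He|].
      * apply cdiff_minus; [apply cdiff_id|apply cdiff_const].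
      * unfold D. replace (F (RtoC p) - c * (RtoC p - RtoC p))%C with (F (RtoC p)) by ring. exact F0.
  - destruct (recip_neq_p z Hz N) as [[e [He E]] N0].
    apply cdiff_local with (g := (fun w => / (fin (phi w) - c))%C) (r := e); [exact He|exact E|].
    apply cdiff_inv; [|exact N0]. apply cdiff_minus; [|apply cdiff_const].
    apply anal_cdiff, phi_analytic; assumption.
Qed.

Lemma recip_injective (z w : C) : disk z -> disk w -> recip z = recip w -> z = w.
Proof.
  intros Hz Hw E. assert (U := proj1 (proj2 Hphi)). apply U; [exact Hz|exact Hw|].
  unfold recip in E. assert (Pz := phi_omits z). assert (Pw := phi_omits w).
  assert (NI : forall x : C, x <> 0 -> (/ x)%C <> 0).
  { intros x Hx F. apply Hx. replace x with (/ x * (x * x))%C by (field; exact Hx). rewrite F. ring. }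
  destruct (phi z) as [u|], (phi w) as [v|]; try reflexivity.
  - f_equal. apply Cminus_eq_0.
    specialize (Pz u Hz eq_refl). specialize (Pw v Hw eq_refl).
    replace (u - v)%C with ((u - c) * (v - c) * (/ (v - c) - / (u - c)))%C by (field; split; assumption).
    rewrite E. ring.
  - exfalso. apply (NI (u - c)%C); [now apply Pz|exact E].
  - exfalso. apply (NI (v - c)%C); [now apply Pw|symmetry; exact E].
Qed.

(** Convexity of the complement makes it starlike with respect to [c]. *)
Lemma recip_starlike (z : C) (t : R) : disk z -> 0 < t < 1 ->
  exists w, disk w /\ recip w = (RtoC t * recip z)%C.
Proof.
  intros Hz Ht. unfold recip at 2. destruct (phi z) as [u|] eqn:E.
  - assert (Nt : RtoC t <> 0) by (intros F; apply RtoC_inj in F; lra).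
    (* [v] lies on the ray from [c] through [u], beyond [u]. Were it omitted, convexity would force
       [u = t v + (1 - t) c] to be omitted too. *)
    set (v := (c + (u - c) / RtoC t)%C).
    destruct (classic (image_disk phi (Some v))) as [[w [Hw Ew]]|Nv].
    + exists w. split; [exact Hw|]. unfold recip. rewrite Ew. unfold v.
      assert (N := phi_omits z u Hz E). field. repeat split; assumption.
    + exfalso. destruct Hphi as [_ [_ [_ [_ Cv]]]].
      apply (Cv v c t Nv Hc); [lra|]. exists z. split; [exact Hz|]. rewrite E. f_equal.
      unfold v. rewrite RtoC_minus. field. exact Nt.
  - exists z. split; [exact Hz|]. unfold recip. rewrite E. ring.
Qed.

Lemma concave_majorant (s : R) (N : nat) : 0 <= s <= 1 / 3 -> s < p ->
  MF N (fun z => fin (phi z) - c)%C s <=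
    Cmod (fin (phi 0) - c) * ((1 + s) ^ 2 / ((1 - s / p) * (1 - p * s))).
Proof.
  intros Hs Hsp.
  assert (Np : RtoC p <> 0) by (intros F; apply RtoC_inj in F; lra).
  assert (N0p : RtoC 0 <> RtoC p) by (intros E; now apply Np).
  assert (Rp : recip (RtoC p) = 0).
  { unfold recip. destruct Hphi as [_ [_ [_ [[-> _] _]]]]. reflexivity. }
  destruct (starlike_ode recip p Hp recip_holo recip_injective Rp recip_starlike) as [V [HV [BV HE]]].
  destruct (recip_neq_p 0 disk_0 N0p) as [Er N0].
  assert (Ec : recip 0 = (/ (fin (phi 0) - c))%C) by exact (nearC_at _ _ Er).
  assert (NI : recip 0 <> 0).
  { rewrite Ec. intros F. apply N0.
    set (x := (fin (phi 0) - c)%C) in *. replace x with (/ x * (x * x))%C by (field; exact N0). rewrite F. ring. }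
  set (Q0 := fun w => ((RtoC p - w) * (1 - RtoC p * w) / recip w)%C).
  assert (AQ0 : anal Q0 0).
  { apply anal_div; [|apply holoD_anal; [exact recip_holo|exact disk_0]|exact NI].
    apply anal_mult; apply anal_minus; auto using anal_const, anal_id, anal_mult. }
  (* Normalizes [Q] at the origin to [1]; the equation is linear in [Q] and survives. *)
  set (k := (recip 0 / RtoC p)%C).
  set (Q := fun w => (k * Q0 w)%C).
  assert (AQ : anal Q 0) by (apply anal_mult; [apply anal_const|exact AQ0]).
  assert (BQ : MF N Q s <= (1 + s) ^ 2).
  { apply (ode_majorant V); [exact HV|exact BV|exact AQ| | |exact Hs].
    - unfold Q, Q0, k. field. split; assumption.
    - assert (Hn : nearC 0 (fun z => z <> RtoC p /\ disk z)).
      { apply nearC_and; [|apply disk_near, disk_0].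
        exists p. split; [lra|]. intros w Hw E. rewrite E, Cmod_minus_0, Cmod_R, Rabs_pos_eq in Hw; lra. }
      destruct (nearC_and _ _ _ Hn AQ0) as [e [He H]]. exists e. split; [exact He|].
      intros z Hz. destruct (H z Hz) as [[H1 H2] H3].
      assert (ED : C_derive Q z = (k * C_derive Q0 z)%C).
      { apply cder_C_derive. unfold Q. eapply cder_eq; [|apply cder_mult; [apply cder_const|apply cdiff_C_derive, H3]].
        cbv beta. ring. }
      rewrite ED. unfold Q. assert (T := HE z H2 H1). cbv zeta in T. fold Q0 in T. rewrite T at 1. ring. }
  set (d := Cmod (fin (phi 0) - c)).
  set (X1 := fun z => (/ (1 - RtoC (/ p) * z))%C). set (X2 := fun z => (/ (1 - RtoC p * z))%C).
  assert (A1 : anal X1 0) by apply anal_inv_linear.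
  assert (A2 : anal X2 0) by apply anal_inv_linear.
  rewrite (MF_germ N _ (fun z => (fin (phi 0) - c) * (Q z * (X1 z * X2 z)))%C).
  - rewrite MF_scal by (apply anal_mult; [exact AQ|now apply anal_mult]). fold d.
    apply Rmult_le_compat_l; [apply Cmod_ge_0|].
    assert (M1 : MF N X1 s <= / (1 - s / p)).
    { replace (s / p) with (Cmod (RtoC (/ p)) * s).
      - apply MF_inv_linear; [lra|]. rewrite Cmod_R, Rabs_pos_eq by (left; apply Rinv_0_lt_compat; lra).
        apply Rmult_lt_reg_l with p; [lra|]. rewrite <- Rmult_assoc, Rinv_r; lra.
      - rewrite Cmod_R, Rabs_pos_eq by (left; apply Rinv_0_lt_compat; lra). unfold Rdiv. ring. }
    assert (M2 : MF N X2 s <= / (1 - p * s)).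
    { replace (p * s) with (Cmod (RtoC p) * s) by (rewrite Cmod_R, Rabs_pos_eq; lra).
      apply MF_inv_linear; [lra|]. rewrite Cmod_R, Rabs_pos_eq by lra. nra. }
    assert (Ps : s / p < 1).
    { apply Rmult_lt_reg_r with p; [lra|]. unfold Rdiv. rewrite Rmult_assoc, Rinv_l; lra. }
    assert (Ps2 : p * s < 1) by nra.
    eapply Rle_trans; [apply MF_mult; [lra|exact AQ|now apply anal_mult]|].
    unfold Rdiv. rewrite Rinv_mult. apply Rmult_le_compat; [apply MF_ge_0; lra|apply MF_ge_0; lra|exact BQ|].
    eapply Rle_trans; [apply MF_mult; [lra|exact A1|exact A2]|].
    apply Rmult_le_compat; try (apply MF_ge_0; lra); assumption.
  - apply anal_mult; [apply anal_const|]. apply anal_mult; [exact AQ|now apply anal_mult].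
  - assert (Hn : nearC 0 (fun z => z <> RtoC p /\ disk z)).
    { apply nearC_and; [|apply disk_near, disk_0].
      exists p. split; [lra|]. intros w Hw E. rewrite E, Cmod_minus_0, Cmod_R, Rabs_pos_eq in Hw; lra. }
    destruct (nearC_and _ _ _ Hn Er) as [e [He H]]. exists e. split; [exact He|].
    intros z Hz. destruct (H z Hz) as [[H1 H2] H3].
    destruct (recip_neq_p z H2 H1) as [_ N0z].
    unfold Q, Q0, k, X1, X2. rewrite H3, Ec.
    assert (B1 : (RtoC p - z)%C <> 0) by (apply Cminus_neq_0; auto).
    assert (B2 : (1 - RtoC p * z)%C <> 0) by (apply one_minus_pz_neq_0; [lra|unfold disk in H2; lra]).
    rewrite RtoC_inv by lra. field. repeat split; try assumption.
Qed.

End Concave.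

(** * Omitted values and subordination *)

(** Otherwise the inverse of [phi] would be a bounded entire function. *)
Lemma exists_omitted (p : R) (phi : C -> Chat) : 0 < p < 1 -> concave_class p phi ->
  exists c, ~ image_disk phi (Some c).
Proof.
  intros Hp Hphi. apply NNPP. intros Hn.
  assert (H : forall c, exists z, disk z /\ phi z = Some c).
  { intros c. apply NNPP. intros F. apply Hn. exists c. exact F. }
  set (psi := fun c => proj1_sig (constructive_indefinite_description _ (H c))).
  assert (P : forall c, disk (psi c) /\ phi (psi c) = Some c).
  { intros c. exact (proj2_sig (constructive_indefinite_description _ (H c))). }
  clearbody psi. destruct Hphi as [_ [U [An [[Pp _] _]]]].
  assert (Dp : disk (RtoC p)) by (unfold disk; rewrite Cmod_R, Rabs_pos_eq; lra).
  assert (E : psi 1 = psi 0).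
  { apply liouville; [|intros u; left; apply P]. intros u. destruct (P u) as [D E].
    set (a := psi u) in *. set (f := fun z => fin (phi z)).
    assert (Na : a <> RtoC p) by (intros F; rewrite F, Pp in E; discriminate).
    assert (Pa := proj1 (Cmod_gt_0 _) (Cminus_neq_0 _ _ Na)).
    set (r := Rmin (1 - Cmod a) (Cmod (a - RtoC p))).
    assert (L1 : r <= 1 - Cmod a) by apply Rmin_l.
    assert (L2 : r <= Cmod (a - RtoC p)) by apply Rmin_r.
    assert (Hr : 0 < r) by (apply Rmin_glb_lt; [unfold disk in D; lra|exact Pa]).
    assert (In : forall z, Cmod (z - a) < r -> disk z /\ z <> RtoC p).
    { intros z Hz. split; [apply (disk_in a); lra|]. intros F. rewrite F, Cmod_minus_sym in Hz. lra. }
    assert (Fin : forall z, Cmod (z - a) < r -> phi z = Some (f z) /\ cdiff f z).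
    { intros z Hz. destruct (In z Hz) as [I1 I2]. destruct (An z I1 I2) as [e [He Hw]].
      destruct (Hw z) as [W1 W2]; [rewrite Cmod_self; exact He|].
      split; [|now apply cdiff_iff]. unfold f. destruct (phi z) as [v|]; [reflexivity|contradiction]. }
    assert (Inv : forall z, Cmod (z - a) < r -> psi (f z) = z).
    { intros z Hz. destruct (P (f z)) as [D' E']. apply U; [exact D'|apply In, Hz|].
      rewrite E'. symmetry. apply Fin, Hz. }
    replace u with (f a) by (unfold f; now rewrite E).
    eexists. apply (inverse_cder f a r Hr); [intros z Hz; apply Fin, Hz| |exact Inv].
    intros z w Hz Hw F. rewrite <- (Inv z Hz), <- (Inv w Hw). now rewrite F. }
  assert (E1 := proj2 (P 1)). rewrite E in E1. rewrite (proj2 (P 0)) in E1.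
  assert (E2 : RtoC 0 = RtoC 1) by congruence. apply RtoC_inj in E2. lra.
Qed.

(** The supremum of the parameters at which the segment from [x] to [y] is in [E] gives a boundary
    point. *)
Lemma boundary_on_segment (E : C -> Prop) (x y : C) : E x -> ~ E y -> exists u, boundary E u.
Proof.
  intros Hx Hy. set (pt := fun t => (x + RtoC t * (y - x))%C).
  set (S := fun t => 0 <= t <= 1 /\ E (pt t)).
  destruct (completeness S) as [t [T1 T2]].
  - exists 1. intros s [Hs _]. lra.
  - exists 0. split; [lra|]. unfold pt. replace (x + RtoC 0 * (y - x))%C with x by ring. exact Hx.
  - assert (Ht : 0 <= t <= 1).
    { split; [|apply T2; intros s [Hs _]; lra]. apply T1. split; [lra|].
      unfold pt. replace (x + RtoC 0 * (y - x))%C with x by ring. exact Hx. }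
    set (L := Cmod (y - x) + 1). assert (HL : 0 < L) by (unfold L; assert (T := Cmod_ge_0 (y - x)); lra).
    assert (Lip : forall s, Cmod (pt s - pt t) <= Rabs (s - t) * L).
    { intros s. unfold pt. replace (x + RtoC s * (y - x) - (x + RtoC t * (y - x)))%C with (RtoC (s - t) * (y - x))%C
        by (rewrite RtoC_minus; ring).
      rewrite Cmod_mult, Cmod_R. apply Rmult_le_compat_l; [apply Rabs_pos|unfold L; lra]. }
    exists (pt t). intros e He. assert (HeL : 0 < e / L) by now apply Rdiv_lt_0_compat.
    assert (Near : forall s, Rabs (s - t) < e / L -> Cmod (pt s - pt t) < e).
    { intros s Hs. eapply Rle_lt_trans; [apply Lip|]. replace e with (e / L * L) by (field; lra).
      now apply Rmult_lt_compat_r. }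
    split.
    + apply NNPP. intros Hn. assert (B : t <= t - e / L / 2); [|lra].
      apply T2. intros s Hs. apply Rnot_lt_le. intros Hlt. apply Hn. exists (pt s). split; [|apply Hs].
      apply Near. assert (s <= t) by (apply T1, Hs). apply Rabs_def1; lra.
    (* Slightly larger parameters leave [E]; at the end of the segment [y] itself is the point
       outside. *)
    + destruct (Rle_lt_or_eq_dec t 1 (proj2 Ht)) as [Hlt|Heq].
      * set (s := Rmin 1 (t + e / L / 2)).
        assert (S1 : s <= 1) by apply Rmin_l. assert (S2 : s <= t + e / L / 2) by apply Rmin_r.
        assert (S3 : t < s) by (apply Rmin_glb_lt; lra).
        exists (pt s). split; [apply Near; apply Rabs_def1; lra|]. intros F.
        assert (s <= t) by (apply T1; split; [lra|exact F]). lra.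
      * exists y. split; [|exact Hy]. replace y with (pt t); [rewrite Cmod_self; exact He|].
        unfold pt. rewrite Heq. ring.
Qed.

(** A nonempty [E] keeps the infimum finite, so [real] does not fall back on its default value
    [0]. *)
Lemma dist_to_set_spec (c : C) (E : C -> Prop) : (exists u, E u) ->
  0 <= dist_to_set c E /\ (forall u, E u -> dist_to_set c E <= Cmod (c - u)) /\
  forall e, 0 < e -> exists u, E u /\ Cmod (c - u) < dist_to_set c E + e.
Proof.
  intros [u0 Hu0]. unfold dist_to_set.
  set (S := fun x => exists u, E u /\ x = Cmod (c - u)).
  destruct (Glb_Rbar_correct S) as [G1 G2].
  assert (B0 : Rbar_le 0 (Glb_Rbar S)).
  { apply G2. intros x [u [_ ->]]. apply Cmod_ge_0. }
  assert (B1 : Rbar_le (Glb_Rbar S) (Cmod (c - u0))) by (apply G1; now exists u0).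
  destruct (Glb_Rbar S) as [l| |]; try contradiction. simpl in *.
  split; [exact B0|]. split.
  - intros u Hu. apply (G1 (Cmod (c - u))). now exists u.
  - intros e He. apply NNPP. intros Hn. assert (T : l + e <= l); [|lra].
    apply (G2 (Finite (l + e))). intros x [u [Hu ->]]. simpl. apply Rnot_lt_le. intros Hlt. apply Hn. now exists u.
Qed.

Lemma boundary_image_nonempty (p : R) (phi : C -> Chat) : 0 < p < 1 -> concave_class p phi ->
  exists u, boundary (fun c => image_disk phi (Some c)) u.
Proof.
  intros Hp Hphi. destruct (exists_omitted p phi Hp Hphi) as [c Hc].
  assert (N : RtoC 0 <> RtoC p) by (intros E; apply RtoC_inj in E; lra).
  destruct (phi_analytic p phi Hphi 0 disk_0 N) as [_ H].
  apply nearC_at in H. cbv beta in H.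
  apply (boundary_on_segment _ (fin (phi 0)) c); [|exact Hc].
  exists 0. split; [exact disk_0|]. destruct (phi 0); [reflexivity|contradiction].
Qed.

Lemma dist_to_boundary_ge_0 (p : R) (phi : C -> Chat) : 0 < p < 1 -> concave_class p phi ->
  0 <= dist_to_boundary phi.
Proof. intros Hp Hphi. apply dist_to_set_spec. now apply (boundary_image_nonempty p). Qed.

(** One half of [e] pays for a boundary point that only nearly realizes the distance, the other half
    for an omitted value close to that point. *)
Lemma omitted_near_dist (p : R) (phi : C -> Chat) (e : R) : 0 < p < 1 -> concave_class p phi -> 0 < e ->
  exists c, ~ image_disk phi (Some c) /\ Cmod (fin (phi 0) - c) < dist_to_boundary phi + e.
Proof.
  intros Hp Hphi He. unfold dist_to_boundary.
  destruct (dist_to_set_spec (fin (phi 0)) (boundary (fun c => image_disk phi (Some c)))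
    (boundary_image_nonempty p phi Hp Hphi)) as [_ [_ H]].
  destruct (H (e / 2)) as [u [Hu Hd]]; [lra|].
  destruct (Hu (e / 2)) as [_ [c [Hc1 Hc2]]]; [lra|].
  exists c. split; [exact Hc2|].
  replace (fin (phi 0) - c)%C with ((fin (phi 0) - u) + - (c - u))%C by ring.
  eapply Rle_lt_trans; [apply Cmod_triangle|]. rewrite Cmod_opp. lra.
Qed.

Section Subordination.

Variables (p : R) (h phi : C -> Chat).
Hypothesis Hp : 0 < p < 1.
Hypothesis Hphi : concave_class p phi.
Hypothesis Hsub : subordinate h phi.

(** By Schwarz's lemma [w = z v] with [v] bounded by [1]; Bohr's inequality for [v] is the
    hypothesis of [MF_comp]. *)
Lemma subordinate_majorant (c : C) (s : R) (N : nat) : ~ image_disk phi (Some c) ->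
  0 <= s <= 1 / 3 -> s < p ->
  MF N (fun z => fin (h z) - c)%C s <=
    Cmod (fin (phi 0) - c) * ((1 + s) ^ 2 / ((1 - s / p) * (1 - p * s))).
Proof.
  intros Hc Hs Hsp. destruct Hsub as [w [Hw [w0 Hh]]].
  destruct (schwarz_0 w) as [v [Hv [Bv Ev]]]; [|intros z Hz; left; now apply Hw|exact w0|].
  { intros z Hz. apply cdiff_iff. now apply Hw. }
  assert (Av : anal v 0) by (apply holoD_anal; [exact Hv|exact disk_0]).
  set (F := fun z => (fin (phi z) - c)%C).
  assert (N0 : RtoC 0 <> RtoC p) by (intros E; apply RtoC_inj in E; lra).
  assert (AF : anal F 0).
  { apply anal_minus; [|apply anal_const]. now apply (phi_analytic p phi Hphi 0 disk_0 N0). }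
  rewrite (MF_germ N _ (fun z => F (z * v z)%C)).
  - eapply Rle_trans; [|now apply concave_majorant].
    apply MF_comp; [lra|exact AF|exact Av|]. intros M. now apply bohr.
  - apply (anal_comp F (fun z => z * v z)%C); [|apply anal_mult; [apply anal_id|exact Av]].
    replace (0 * v 0)%C with (RtoC 0) by ring. exact AF.
  - apply (nearC_imp _ disk); [|apply disk_near, disk_0]. intros z Hz. unfold F.
    now rewrite Hh, Ev by exact Hz.
Qed.

Lemma subordinate_analytic : anal (fun z => fin (h z)) 0 /\ fin (h 0) = fin (phi 0).
Proof.
  destruct Hsub as [w [Hw [w0 Hh]]].
  assert (N0 : RtoC 0 <> RtoC p) by (intros E; apply RtoC_inj in E; lra).
  split; [|now rewrite (Hh 0 disk_0), w0].
  apply anal_local with (g := fun z => (fun u => fin (phi u)) (w z)).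
  - apply (nearC_imp _ disk); [|apply disk_near, disk_0]. intros z Hz. now rewrite Hh.
  - apply (anal_comp (fun u => fin (phi u)) w).
    + rewrite w0. now apply (phi_analytic p phi Hphi 0 disk_0 N0).
    + apply (nearC_imp _ disk); [|apply disk_near, disk_0]. intros z Hz. apply cdiff_iff. now apply Hw.
Qed.

(** The bound equals [d (1 + K)] with [d = |phi(0) - c|], and the constant term of [h - c] has
    modulus exactly [d], so the higher terms sum to at most [d K]. Omitted values with [d] near the
    distance finish the argument. *)
Lemma coefficient_bound (s : R) (N : nat) : 0 <= s <= 1 / 3 -> s < p ->
  s * Mr N (fun n => Cmod (tc (fun z => fin (h z)) (S n))) s <=
    dist_to_boundary phi * ((1 + p) ^ 2 / p * kp p s).
Proof.
  intros Hs Hsp. destruct subordinate_analytic as [Ah Eh].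
  set (K := (1 + p) ^ 2 / p * kp p s).
  assert (Ps : 0 < 1 - p * s) by nra.
  assert (HK : 0 <= K).
  { apply Rmult_le_pos; [apply Rdiv_le_0_compat; [apply pow2_ge_0|lra]|].
    unfold kp. apply Rdiv_le_0_compat; [nra|]. apply Rmult_lt_0_compat; lra. }
  apply Rnot_lt_le. intros Hlt.
  set (D := dist_to_boundary phi) in *. set (X := s * _) in *.
  (* With this [e] the bound [(D + e) * K] equals [X - e], which contradicts the lower bound [X]. *)
  set (e := (X - D * K) / (K + 1)).
  assert (He : 0 < e) by (apply Rdiv_lt_0_compat; lra).
  destruct (omitted_near_dist p phi e Hp Hphi He) as [c [Hc Hd]]. fold D in Hd.
  assert (M := subordinate_majorant c s (S N) Hc Hs Hsp).
  rewrite MF_S, Eh in M. set (d := Cmod (fin (phi 0) - c)) in *.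
  assert (Pd : 0 <= d) by apply Cmod_ge_0.
  assert (EX : s * MF N (dq (fun z => fin (h z) - c)%C 0) s = X).
  { unfold X, MF. f_equal. apply Mr_ext. intros n.
    change (Cmod (tc (fun z => fin (h z) - c)%C (S n)) = Cmod (tc (fun z => fin (h z)) (S n))).
    unfold Cminus. rewrite tc_plus, tc_const; [f_equal; ring|exact Ah|apply anal_const]. }
  rewrite EX in M.
  replace ((1 + s) ^ 2 / ((1 - s / p) * (1 - p * s))) with (1 + K) in M.
  2: { unfold K, kp. field. repeat split; lra. }
  assert (T : d * K <= (D + e) * K) by (apply Rmult_le_compat_r; lra).
  assert (T2 : e * (K + 1) = X - D * K) by (unfold e; field; lra).
  nra.
Qed.

End Subordination.

(** * Expansions and the dilatation *)

Fixpoint psum (N : nat) (c : nat -> C) (z : C) : C :=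
  match N with O => c O | S N' => (c O + z * psum N' (shift c) z)%C end.

Lemma psum_S (N : nat) (c : nat -> C) (z : C) : psum (S N) c z = (psum N c z + c (S N) * Cpow z (S N))%C.
Proof.
  revert c. induction N as [|N IH]; intros c; [simpl; unfold shift; ring|].
  change (psum (S (S N)) c z) with (c 0%nat + z * psum (S N) (shift c) z)%C.
  rewrite IH. simpl. unfold shift. ring.
Qed.

Lemma Cmod_psum (N : nat) (c : nat -> C) (z : C) : Cmod (psum N c z) <= Mr N (fun n => Cmod (c n)) (Cmod z).
Proof.
  revert c. induction N as [|N IH]; intros c; simpl; [lra|].
  eapply Rle_trans; [apply Cmod_triangle|]. rewrite Cmod_mult.
  apply Rplus_le_compat_l, Rmult_le_compat_l; [apply Cmod_ge_0|apply IH].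
Qed.

Definition pconv (c : nat -> C) (z l : C) : Prop :=
  forall e, 0 < e -> exists N0, forall N, (N0 <= N)%nat -> Cmod (psum N c z - l) < e.

Lemma pow_n_Cpow (z : C) (n : nat) : @pow_n C_Ring z n = Cpow z n.
Proof. induction n as [|n IH]; [reflexivity|]. simpl. rewrite IH. reflexivity. Qed.

Lemma is_pseries_pconv (c : nat -> C) (z l : C) :
  @is_pseries C_AbsRing C_NormedModule c z l <-> pconv c z l.
Proof.
  assert (E : forall N, @sum_n C_NormedModule (fun k => @scal C_AbsRing C_NormedModule (@pow_n C_AbsRing z k) (c k)) N
    = psum N c z).
  { induction N as [|N IH].
    - rewrite sum_O. change (Cmult (RtoC 1) (c 0%nat) = c 0%nat). ring.
    - rewrite sum_Sn, IH, psum_S.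
      change (psum N c z + @pow_n C_Ring z (S N) * c (S N) = psum N c z + c (S N) * Cpow z (S N))%C.
      rewrite pow_n_Cpow. ring. }
  unfold is_pseries, is_series. split.
  - intros H e He.
    destruct (proj1 (filterlim_locally_ball_norm _ _) H (mkposreal e He)) as [N0 H0].
    exists N0. intros N HN. rewrite <- E. exact (H0 N HN).
  - intros H. apply (filterlim_locally_ball_norm (K := C_AbsRing) (U := C_NormedModule)).
    intros [e He]. destruct (H e He) as [N0 H0]. exists N0. intros N HN. rewrite E. exact (H0 N HN).
Qed.

(** Terms are differences of consecutive partial sums, hence eventually bounded by [2]. *)
Lemma pconv_bounded (c : nat -> C) (z l : C) : pconv c z l ->
  exists M, 0 <= M /\ forall n, Cmod (c n) * Cmod z ^ n <= M.
Proof.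
  intros H. destruct (H 1 Rlt_0_1) as [N0 H0].
  assert (B : exists M, 0 <= M /\ forall n, (n <= S N0)%nat -> Cmod (c n) * Cmod z ^ n <= M).
  { induction (S N0) as [|n [M [M0 HM]]].
    - exists (Cmod (c 0%nat)). split; [apply Cmod_ge_0|]. intros n Hn. replace n with 0%nat by lia. simpl. lra.
    - exists (Rmax M (Cmod (c (S n)) * Cmod z ^ S n)).
      split; [eapply Rle_trans; [exact M0|apply Rmax_l]|]. intros m Hm.
      destruct (Nat.eq_dec m (S n)) as [->|Hne]; [apply Rmax_r|].
      eapply Rle_trans; [apply HM; lia|apply Rmax_l]. }
  destruct B as [M [M0 HM]]. exists (Rmax M 2).
  split; [eapply Rle_trans; [exact M0|apply Rmax_l]|]. intros n.
  destruct (Nat.le_gt_cases n (S N0)) as [Hn|Hn].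
  - eapply Rle_trans; [now apply HM|apply Rmax_l].
  - eapply Rle_trans; [|apply Rmax_r]. destruct n as [|n]; [lia|].
    assert (H1 := H0 n ltac:(lia)). assert (H2 := H0 (S n) ltac:(lia)). rewrite psum_S in H2.
    rewrite <- Cmod_pow, <- Cmod_mult.
    replace (c (S n) * Cpow z (S n))%C
      with ((psum n c z + c (S n) * Cpow z (S n) - l) + - (psum n c z - l))%C by ring.
    eapply Rle_trans; [apply Cmod_triangle|]. rewrite Cmod_opp. lra.
Qed.

Lemma Mr_geometric (N : nat) (u : nat -> R) (M x s : R) : 0 < x -> 0 <= s <= x / 2 -> 0 <= M ->
  (forall n, u n * x ^ n <= M) -> Mr N u s <= 2 * M.
Proof.
  intros Hx Hs. revert u M. induction N as [|N IH]; intros u M HM H; simpl.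
  - specialize (H 0%nat). simpl in H. lra.
  - assert (T : Mr N (shift u) s <= 2 * (M / x)).
    { apply IH; [apply Rdiv_le_0_compat; lra|]. intros n. specialize (H (S n)). unfold shift. simpl in H.
      apply Rmult_le_reg_r with x; [exact Hx|]. unfold Rdiv. rewrite (Rmult_assoc M), Rinv_l by lra. lra. }
    assert (H0 := H 0%nat). simpl in H0.
    assert (T2 : s * Mr N (shift u) s <= x / 2 * (2 * (M / x))).
    { apply Rle_trans with (s * (2 * (M / x))); [apply Rmult_le_compat_l; lra|].
      apply Rmult_le_compat_r; [|lra]. apply Rmult_le_pos; [lra|apply Rdiv_le_0_compat; lra]. }
    replace (x / 2 * (2 * (M / x))) with M in T2 by (field; lra). lra.
Qed.

(** The bound on the coefficients is carried along because it passes to the shifted sequence and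
    gives control of the sum near [0], which convergence at each point does not do directly. *)
Definition expands (F : C -> C) (c : nat -> C) : Prop :=
  exists x M, 0 < x /\ 0 <= M /\ (forall n, Cmod (c n) * x ^ n <= M) /\
    forall z, Cmod z < x -> pconv c z (F z).

Lemma pconv_le (c : nat -> C) (z l a : C) (B : R) : pconv c z l ->
  (forall N, Cmod (psum N c z - a) <= B) -> Cmod (l - a) <= B.
Proof.
  intros H HB. apply Rnot_lt_le. intros Hlt.
  destruct (H (Cmod (l - a) - B)) as [N0 H0]; [lra|]. specialize (H0 N0 (le_n _)). specialize (HB N0).
  assert (T := Cmod_triangle (psum N0 c z - a) (- (psum N0 c z - l))). rewrite Cmod_opp in T.
  replace (psum N0 c z - a + - (psum N0 c z - l))%C with (l - a)%C in T by ring. lra.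
Qed.

Lemma expands_lipschitz (F : C -> C) (c : nat -> C) : expands F c ->
  exists x L, 0 < x /\ forall z, Cmod z < x -> Cmod (F z - c 0%nat) <= L * Cmod z.
Proof.
  intros [x [M [Hx [HM [Hc HF]]]]]. exists (x / 2), (2 * (M / x)). split; [lra|].
  intros z Hz. assert (Pz := Cmod_ge_0 z).
  assert (Q : 0 <= 2 * (M / x)) by (apply Rmult_le_pos; [lra|apply Rdiv_le_0_compat; lra]).
  apply (pconv_le c z (F z)); [apply HF; lra|]. intros [|N]; simpl.
  - rewrite Cmod_self. now apply Rmult_le_pos.
  - replace (c 0%nat + z * psum N (shift c) z - c 0%nat)%C with (psum N (shift c) z * z)%C by ring.
    rewrite Cmod_mult. apply Rmult_le_compat_r; [exact Pz|].
    eapply Rle_trans; [apply Cmod_psum|]. apply Mr_geometric with (x := x); [exact Hx|lra|apply Rdiv_le_0_compat; lra|].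
    intros n. specialize (Hc (S n)). unfold shift. simpl in Hc.
    apply Rmult_le_reg_r with x; [exact Hx|]. unfold Rdiv. rewrite (Rmult_assoc M), Rinv_l by lra. lra.
Qed.

Lemma expands_at_0 (F : C -> C) (c : nat -> C) : expands F c -> F 0 = c 0%nat.
Proof.
  intros H. destruct (expands_lipschitz F c H) as [x [L [Hx HL]]].
  apply Cminus_eq_0, Cmod_small_0. intros e He.
  assert (T := HL 0). rewrite Cmod_0 in T. specialize (T Hx). lra.
Qed.

(** Off the origin the shifted series is the original one divided by [z]. At the origin its value
    has to be compared with the derivative stored in [dq]. *)
Lemma expands_dq (F : C -> C) (c : nat -> C) : anal F 0 -> expands F c -> expands (dq F 0) (shift c).
Proof.
  intros AF H. assert (F0 := expands_at_0 F c H).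
  destruct H as [x [M [Hx [HM [Hc HF]]]]].
  assert (HM' : 0 <= M / x) by (apply Rdiv_le_0_compat; lra).
  assert (Hc' : forall n, Cmod (shift c n) * x ^ n <= M / x).
  { intros n. specialize (Hc (S n)). unfold shift. simpl in Hc.
    apply Rmult_le_reg_r with x; [exact Hx|]. unfold Rdiv. rewrite (Rmult_assoc M), Rinv_l by lra. lra. }
  assert (Hn : forall z, Cmod z < x -> z <> 0 -> pconv (shift c) z (dq F 0 z)).
  { intros z Hz Nz e He. assert (Pz := proj1 (Cmod_gt_0 _) Nz).
    destruct (HF z Hz (e * Cmod z)) as [N0 H0]; [now apply Rmult_lt_0_compat|].
    exists N0. intros N HN. specialize (H0 (S N) ltac:(lia)).
    rewrite dq_neq by exact Nz. rewrite F0.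
    replace (psum N (shift c) z - (F z - c 0%nat) / (z - 0))%C with ((psum (S N) c z - F z) / z)%C
      by (simpl; field; exact Nz).
    rewrite Cmod_div by exact Nz. apply Rmult_lt_reg_r with (Cmod z); [exact Pz|].
    unfold Rdiv. rewrite Rmult_assoc, Rinv_l, Rmult_1_r by lra. exact H0. }
  exists x, (M / x). repeat split; [exact Hx|exact HM'|exact Hc'|].
  intros z Hz. destruct (Ceq_dec z 0) as [->|Nz]; [|now apply Hn].
  (* [G] is the sum of the shifted series. It is continuous at [0] by [expands_lipschitz], [dq F 0]
     is continuous there by analyticity, and they agree elsewhere. *)
  assert (E : dq F 0 0 = shift c 0%nat).
  { set (G := fun w => if Ceq_dec w 0 then shift c 0%nat else dq F 0 w).
    assert (EG : expands G (shift c)).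
    { exists x, (M / x). repeat split; [exact Hx|exact HM'|exact Hc'|].
      intros w Hw. unfold G. destruct (Ceq_dec w 0) as [->|Nw]; [|now apply Hn].
      intros e He. exists 0%nat. intros [|N] _; simpl.
      - rewrite Cmod_self. exact He.
      - replace (shift c 0%nat + 0 * psum N (shift (shift c)) 0 - shift c 0%nat)%C with (RtoC 0) by ring.
        rewrite Cmod_0. exact He. }
    destruct (expands_lipschitz G (shift c) EG) as [y [L [Hy HL]]].
    assert (CG : cont G 0).
    { intros e He. assert (PL := Rabs_pos L).
      exists (Rmin y (e / (Rabs L + 1))). split; [apply Rmin_glb_lt; [exact Hy|apply Rdiv_lt_0_compat; lra]|].
      intros w Hw. assert (L1 := Rmin_l y (e / (Rabs L + 1))). assert (L2 := Rmin_r y (e / (Rabs L + 1))).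
      rewrite Cmod_minus_0 in Hw. assert (Pw := Cmod_ge_0 w).
      rewrite (expands_at_0 G _ EG).
      apply Rle_lt_trans with ((Rabs L + 1) * Cmod w).
      - eapply Rle_trans; [apply HL; lra|]. apply Rmult_le_compat_r; [exact Pw|].
        assert (T := Rle_abs L). lra.
      - apply Rlt_le_trans with ((Rabs L + 1) * (e / (Rabs L + 1))); [apply Rmult_lt_compat_l; lra|].
        right. field. lra. }
    rewrite <- (expands_at_0 G _ EG).
    apply cont_unique with (r := 1); [lra|now apply cdiff_cont, dq_cdiff_self|exact CG|].
    intros w [Hw _]. unfold G. destruct (Ceq_dec w 0) as [->|_]; [|reflexivity].
    rewrite Cmod_self in Hw. lra. }
  rewrite E. intros e He. exists 0%nat. intros [|N] _; simpl.
  - rewrite Cmod_self. exact He.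
  - replace (shift c 0%nat + 0 * psum N (shift (shift c)) 0 - shift c 0%nat)%C with (RtoC 0) by ring.
    rewrite Cmod_0. exact He.
Qed.

(** Uniqueness of the power series; it identifies the sequences [a] and [b] of the theorem with the
    Taylor coefficients used in the estimates. *)
Lemma expands_tc (F : C -> C) (c : nat -> C) (n : nat) : anal F 0 -> expands F c -> tc F n = c n.
Proof.
  revert F c. induction n as [|n IH]; intros F c AF H; simpl.
  - now apply expands_at_0.
  - apply (IH (dq F 0) (shift c)); [now apply anal_dq|now apply expands_dq].
Qed.

Lemma has_expansion_expands (p : R) (f : C -> Chat) (c : nat -> C) : 0 < p -> has_expansion p f c ->
  expands (fun z => fin (f z)) c.
Proof.
  intros Hp H.
  assert (P : forall z, Cmod z < p -> pconv c z (fin (f z))).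
  { intros z Hz. destruct (H z Hz) as [s [-> Hs]]. now apply is_pseries_pconv. }
  assert (B : Cmod (RtoC (p / 2)) = p / 2) by (rewrite Cmod_R, Rabs_pos_eq; lra).
  assert (Q : Cmod (RtoC (p / 2)) < p) by lra.
  destruct (pconv_bounded c (RtoC (p / 2)) _ (P _ Q)) as [M [HM HB]]. rewrite B in HB.
  exists (p / 2), M. repeat split; [lra|exact HM|exact HB|]. intros z Hz. apply P. lra.
Qed.

Lemma has_expansion_bound (p : R) (f : C -> Chat) (c : nat -> C) (z : C) (B : R) :
  has_expansion p f c -> Cmod z < p ->
  (forall N, Cmod z * Mr N (fun n => Cmod (c (S n))) (Cmod z) <= B) ->
  Cmod (fin (f z)) <= Cmod (c 0%nat) + B.
Proof.
  intros H Hz HB. destruct (H z Hz) as [s [-> Hs]]. apply is_pseries_pconv in Hs. simpl.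
  rewrite <- (Cmod_minus_0 s). apply (pconv_le c z s); [exact Hs|]. intros N. rewrite Cmod_minus_0.
  eapply Rle_trans; [apply Cmod_psum|].
  eapply Rle_trans; [apply Mr_mono; [apply Cmod_ge_0|intros; apply Cmod_ge_0]|].
  simpl. apply Rplus_le_compat_l. apply HB.
Qed.

(** Riemann's argument: [(z - a)^2 f], set to [0] at [a], is differentiable at [a] with derivative
    [0], because [f] is bounded. Dividing twice by [z - a] through [dq] gives the extension. *)
Lemma removable (f : C -> C) (a : C) (e k : R) : 0 < e ->
  (forall z, 0 < Cmod (z - a) < e -> cdiff f z /\ Cmod (f z) <= k) ->
  exists F, (forall z, Cmod (z - a) < e -> cdiff F z) /\ forall z, 0 < Cmod (z - a) < e -> F z = f z.
Proof.
  intros He H.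
  assert (Hk : 0 <= k).
  { assert (Z : Cmod (a + RtoC (e / 2) - a) = e / 2).
    { replace (a + RtoC (e / 2) - a)%C with (RtoC (e / 2)) by ring. rewrite Cmod_R, Rabs_pos_eq; lra. }
    destruct (H (a + RtoC (e / 2))%C) as [_ B]; [lra|]. eapply Rle_trans; [apply Cmod_ge_0|exact B]. }
  set (q := fun z => if Ceq_dec z a then RtoC 0 else ((z - a) * f z)%C).
  set (G := fun z => (q z * (z - a))%C).
  assert (q0 : q a = 0) by (unfold q; now destruct (Ceq_dec a a)).
  assert (qn : forall z, z <> a -> q z = ((z - a) * f z)%C).
  { intros z N. unfold q. now destruct (Ceq_dec z a). }
  assert (Cq : cont q a).
  { intros d Hd. exists (Rmin e (d / (k + 1))). split; [apply Rmin_glb_lt; [exact He|apply Rdiv_lt_0_compat; lra]|].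
    intros z Hz. assert (L1 := Rmin_l e (d / (k + 1))). assert (L2 := Rmin_r e (d / (k + 1))).
    rewrite q0, Cmod_minus_0. destruct (Ceq_dec z a) as [->|N]; [rewrite q0, Cmod_0; exact Hd|].
    assert (P := proj1 (Cmod_gt_0 _) (Cminus_neq_0 _ _ N)).
    rewrite qn, Cmod_mult by exact N. destruct (H z) as [_ B]; [lra|].
    apply Rle_lt_trans with (Cmod (z - a) * (k + 1)); [apply Rmult_le_compat_l; lra|].
    replace d with (d / (k + 1) * (k + 1)) by (field; lra). apply Rmult_lt_compat_r; lra. }
  assert (DG : forall z, Cmod (z - a) < e -> cdiff G z).
  { intros z Hz. destruct (Ceq_dec z a) as [->|N].
    - exists (q a). apply cder_intro with (r := 1); [lra|exact Cq|]. intros w _. unfold G. ring.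
    - assert (P := proj1 (Cmod_gt_0 _) (Cminus_neq_0 _ _ N)).
      apply cdiff_local with (g := (fun w => (w - a) * f w * (w - a))%C) (r := Cmod (z - a)); [exact P| |].
      + intros w Hw. unfold G. rewrite qn; [reflexivity|]. intros ->. rewrite Cmod_minus_sym in Hw. lra.
      + assert (D : cdiff (fun w => w - a)%C z) by (apply cdiff_minus; [apply cdiff_id|apply cdiff_const]).
        apply cdiff_mult; [apply cdiff_mult; [exact D|apply H; lra]|exact D]. }
  assert (AG : anal G a) by (exists e; auto).
  assert (E1 : forall z, z <> a -> dq G a z = ((z - a) * f z)%C).
  { intros z N. rewrite dq_neq by exact N. unfold G. rewrite q0, qn by exact N. field. now apply Cminus_neq_0. }
  assert (E0 : dq G a a = 0).
  { rewrite dq_eq, <- q0. apply cder_C_derive. apply cder_intro with (r := 1); [lra|exact Cq|].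
    intros w _. unfold G. ring. }
  exists (dq (dq G a) a). split.
  - intros z Hz. apply dq_cdiff; [now apply anal_dq|]. apply dq_cdiff; [exact AG|now apply DG].
  - intros z [Hz _]. assert (N : z <> a) by (intros ->; rewrite Cmod_self in Hz; lra).
    rewrite dq_neq, E1, E0 by exact N. field. now apply Cminus_neq_0.
Qed.

(** Local extensions around each point agree with [f] off the centre and can be glued; the bound
    passes to the centre by continuity. *)
Lemma removable_disk (f : C -> C) (k : R) :
  (forall a, disk a -> exists e, 0 < e /\
    forall z, 0 < Cmod (z - a) < e -> disk z /\ cdiff f z /\ Cmod (f z) <= k) ->
  exists F, holoD F /\ (forall z, disk z -> Cmod (F z) <= k) /\
    forall z, disk z -> cdiff f z -> F z = f z.
Proof.
  intros H.
  assert (Ex : forall a, exists G, disk a -> exists e, 0 < e /\ (forall z, Cmod (z - a) < e -> cdiff G z) /\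
    forall z, 0 < Cmod (z - a) < e -> G z = f z /\ disk z /\ cdiff f z /\ Cmod (f z) <= k).
  { intros a. destruct (classic (disk a)) as [D|N]; [|exists f; contradiction].
    destruct (H a D) as [e [He Hz]].
    destruct (removable f a e k He) as [G [G1 G2]].
    - intros z Hze. destruct (Hz z Hze) as [_ [A B]]. now split.
    - exists G. intros _. exists e. split; [exact He|]. split; [exact G1|]. intros z Hze. split; [now apply G2|now apply Hz]. }
  set (G := fun a => proj1_sig (constructive_indefinite_description _ (Ex a))).
  assert (HG : forall a, disk a -> exists e, 0 < e /\ (forall z, Cmod (z - a) < e -> cdiff (G a) z) /\
    forall z, 0 < Cmod (z - a) < e -> G a z = f z /\ disk z /\ cdiff f z /\ Cmod (f z) <= k).
  { intros a. exact (proj2_sig (constructive_indefinite_description _ (Ex a))). }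
  clearbody G.
  assert (EF : forall z, disk z -> cdiff f z -> G z z = f z).
  { intros z Hz Hf. destruct (HG z Hz) as [e [He [D E]]].
    apply cont_unique with (r := e); [exact He|apply cdiff_cont, D; rewrite Cmod_self; exact He|now apply cdiff_cont|].
    intros w Hw. now apply E. }
  (* At each point the extension centred there is used; near [a] this coincides with [G a]. *)
  exists (fun z => G z z). split; [|split; [|exact EF]].
  - intros a Ha. destruct (HG a Ha) as [e [He [D E]]].
    apply cdiff_local with (g := G a) (r := e); [exact He| |apply D; rewrite Cmod_self; exact He].
    intros z Hz. destruct (Ceq_dec z a) as [->|N]; [reflexivity|].
    assert (P := proj1 (Cmod_gt_0 _) (Cminus_neq_0 _ _ N)).
    destruct (E z (conj P Hz)) as [-> [Dz [Cz _]]]. now apply EF.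
  - intros a Ha. destruct (HG a Ha) as [e [He [D E]]].
    assert (Ca : cont (G a) a) by (apply cdiff_cont, D; rewrite Cmod_self; exact He).
    apply Rnot_lt_le. intros Hlt. destruct (Ca (Cmod (G a a) - k)) as [d [Hd Hw]]; [lra|].
    set (s := Rmin d e / 2). assert (L1 := Rmin_l d e). assert (L2 := Rmin_r d e).
    assert (L3 : 0 < Rmin d e) by now apply Rmin_glb_lt.
    assert (Hs : Cmod (a + RtoC s - a) = s).
    { replace (a + RtoC s - a)%C with (RtoC s) by ring. rewrite Cmod_R, Rabs_pos_eq; unfold s; lra. }
    specialize (Hw (a + RtoC s)%C ltac:(rewrite Hs; unfold s; lra)).
    destruct (E (a + RtoC s)%C) as [E1 [_ [_ B]]]; [rewrite Hs; unfold s; lra|]. rewrite <- E1 in B.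
    assert (T := Cmod_reverse (G a a) (G a (a + RtoC s)%C)). rewrite Cmod_minus_sym in T. lra.
Qed.

Lemma meromorphic_finite_near (f : C -> Chat) (a : C) : meromorphic_in_disk f -> disk a ->
  exists e, 0 < e /\ forall z, 0 < Cmod (z - a) < e -> f z <> None.
Proof.
  intros H Ha. destruct (H a Ha) as [[e [He Hz]]|[n [_ [_ [F [e [He [_ [_ Hz]]]]]]]]]; exists e; (split; [exact He|]);
  intros z Hze.
  - now apply Hz.
  - rewrite Hz by exact Hze. discriminate.
Qed.

(** * The dilatation and the coefficients of the co-analytic part *)

Section Dilatation.

Variables (K : R) (h g : C -> Chat).
Hypothesis Hqc : sense_preserving_qc_harmonic K h g.

Let k := (K - 1) / (K + 1).
Let h1 := fun z => fin (h z).
Let g1 := fun z => fin (g z).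

Lemma finite_near (a : C) : disk a -> exists e, 0 < e /\
  forall z, 0 < Cmod (z - a) < e -> disk z /\ h z <> None /\ g z <> None.
Proof.
  intros Ha. destruct Hqc as [Hh [Hg _]].
  destruct (meromorphic_finite_near h a Hh Ha) as [e1 [E1 P1]].
  destruct (meromorphic_finite_near g a Hg Ha) as [e2 [E2 P2]].
  destruct (disk_near a Ha) as [e3 [E3 P3]].
  exists (Rmin e1 (Rmin e2 e3)). split; [repeat apply Rmin_glb_lt; assumption|].
  intros z [Z1 Z2]. assert (L1 := Rmin_l e1 (Rmin e2 e3)). assert (L2 := Rmin_r e1 (Rmin e2 e3)).
  assert (L3 := Rmin_l e2 e3). assert (L4 := Rmin_r e2 e3).
  split; [apply P3; lra|]. split; [apply P1; lra|apply P2; lra].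
Qed.

Lemma dilatation_at (z : C) : disk z -> h z <> None -> g z <> None ->
  anal h1 z /\ anal g1 z /\ C_derive h1 z <> 0 /\ Cmod (C_derive g1 z / C_derive h1 z) <= k.
Proof.
  intros Hz Hh Hg. destruct Hqc as [_ [_ H]].
  assert (P : forall w, disk w -> h w <> None -> g w <> None -> cdiff h1 w /\ cdiff g1 w /\
    C_derive h1 w <> 0 /\ Cmod (C_derive g1 w / C_derive h1 w) <= k).
  { intros w Dw W1 W2. destruct (H w Dw W1 W2) as [dh [dg [H1 [H2 [H3 [_ H4]]]]]].
    apply cder_is_derive in H1. apply cder_is_derive in H2.
    fold h1 in H1. fold g1 in H2.
    rewrite (cder_C_derive _ _ _ H1), (cder_C_derive _ _ _ H2).
    split; [now exists dh|]. split; [now exists dg|]. now split. }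
  destruct (finite_near z Hz) as [e [He Hw]].
  assert (Q : forall w, Cmod (w - z) < e -> disk w /\ h w <> None /\ g w <> None).
  { intros w Hwe. destruct (Ceq_dec w z) as [->|N]; [auto|].
    apply Hw. split; [|exact Hwe]. apply Cmod_gt_0. now apply Cminus_neq_0. }
  destruct (P z Hz Hh Hg) as [_ [_ R]]. split; [|split; [|exact R]];
  exists e; (split; [exact He|]); intros w Hwe; destruct (Q w Hwe) as [Q1 [Q2 Q3]]; now apply P.
Qed.

(** The poles of [h] and [g] are isolated and the quotient [g' / h'] is bounded by [k] off them, so
    these singularities are removable. Bohr's inequality needs a function holomorphic in the full
    disk. *)
Lemma dilatation_extends : exists om, holoD om /\ (forall z, disk z -> Cmod (om z) <= k) /\
  forall z, disk z -> h z <> None -> g z <> None -> C_derive g1 z = (om z * C_derive h1 z)%C.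
Proof.
  set (f := fun z => (C_derive g1 z / C_derive h1 z)%C).
  assert (Df : forall z, disk z -> h z <> None -> g z <> None -> cdiff f z).
  { intros z Hz Hh Hg. destruct (dilatation_at z Hz Hh Hg) as [A1 [A2 [A3 _]]].
    apply cdiff_div; [now apply C_derive_cdiff|now apply C_derive_cdiff|exact A3]. }
  destruct (removable_disk f k) as [om [O1 [O2 O3]]].
  - intros a Ha. destruct (finite_near a Ha) as [e [He Hz]]. exists e. split; [exact He|].
    intros z Hze. destruct (Hz z Hze) as [D [H1 H2]].
    split; [exact D|]. split; [now apply Df|]. now apply dilatation_at.
  - exists om. split; [exact O1|]. split; [exact O2|]. intros z Hz Hh Hg.
    rewrite O3 by (auto; now apply Df). unfold f. field. now apply dilatation_at.
Qed.

(** Comparing coefficients in [g' = om h'], [n b_n] is a convolution of the coefficients of [om]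
    with the [j a_j], [j <= n]; the ratios [j / n] are at most [1], so [b] is dominated by the
    convolution with the [a_j] themselves. *)
Lemma coanalytic_majorant (s : R) (N : nat) :
  nearC 0 (fun z => h z <> None /\ g z <> None) -> 0 <= s <= 1 / 3 ->
  Mr N (fun n => Cmod (tc g1 (S n))) s <= k * Mr N (fun n => Cmod (tc h1 (S n))) s.
Proof.
  intros Hn Hs. destruct dilatation_extends as [om [O1 [O2 O3]]].
  destruct (nearC_at _ _ Hn) as [Hh Hg].
  destruct (dilatation_at 0 disk_0 Hh Hg) as [Ah [Ag _]].
  assert (Ao : anal om 0) by (apply holoD_anal; [exact O1|exact disk_0]).
  assert (Ah' := anal_C_derive h1 0 Ah).
  assert (E : forall n, Cmod (tc g1 (S n)) <= rconv (fun j => Cmod (tc om j)) (fun j => Cmod (tc h1 (S j))) n).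
  { intros n.
    assert (T : (RtoC (INR (S n)) * tc g1 (S n))%C = conv (tc om) (fun j => RtoC (INR (S j)) * tc h1 (S j))%C n).
    { rewrite <- tc_C_derive by exact Ag.
      rewrite (tc_germ _ (fun z => om z * C_derive h1 z)%C).
      - rewrite tc_mult by assumption. apply conv_ext; [reflexivity|]. intros j. now apply tc_C_derive.
      - now apply anal_mult.
      - apply (nearC_imp _ (fun z => disk z /\ (h z <> None /\ g z <> None))).
        + intros z [D [Z1 Z2]]. now apply O3.
        + apply nearC_and; [apply disk_near, disk_0|exact Hn]. }
    assert (Pn : 0 < INR (S n)) by (apply lt_0_INR; lia).
    apply Rmult_le_reg_l with (INR (S n)); [exact Pn|].
    assert (B := Cmod_conv_weighted (tc om) (fun j => tc h1 (S j)) (fun j => INR (S j)) (INR (S n)) n).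
    cbv beta in B. rewrite <- T, Cmod_mult, Cmod_R, Rabs_pos_eq in B by lra. apply B.
    intros j Hj. split; [apply pos_INR|apply le_INR; lia]. }
  eapply Rle_trans; [apply Mr_le; [lra|exact E]|].
  eapply Rle_trans; [apply Mr_rconv; [lra|intros; apply Cmod_ge_0..]|].
  apply Rmult_le_compat_r; [apply Mr_ge_0; [lra|intros; apply Cmod_ge_0]|].
  change (MF N om s <= k). now apply bohr.
Qed.

End Dilatation.

(** * The Bohr-type inequality *)

Lemma kp_lt (p x y : R) : 0 < p < 1 -> 0 <= x < y -> y < p -> kp p x < kp p y.
Proof.
  intros Hp Hx Hy. unfold kp.
  assert (D1 : 0 < 1 - p * x) by nra. assert (D2 : 0 < 1 - p * y) by nra.
  assert (P1 : 0 < (p - x) * (1 - p * x)) by (apply Rmult_lt_0_compat; lra).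
  assert (P2 : 0 < (p - y) * (1 - p * y)) by (apply Rmult_lt_0_compat; lra).
  apply Rlt_0_minus.
  replace (p * y / ((p - y) * (1 - p * y)) - p * x / ((p - x) * (1 - p * x)))
    with (p * (p * ((y - x) * (1 - x * y))) / ((p - y) * (1 - p * y) * ((p - x) * (1 - p * x))))
    by (field; repeat split; lra).
  apply Rdiv_lt_0_compat; [|now apply Rmult_lt_0_compat].
  repeat apply Rmult_lt_0_compat; try lra. nra.
Qed.

Lemma kp_le (p x y : R) : 0 < p < 1 -> 0 <= x <= y -> y < p -> kp p x <= kp p y.
Proof.
  intros Hp Hx Hy. destruct (Rle_lt_or_eq_dec x y (proj2 Hx)) as [H|H]; [|subst; lra].
  left. apply kp_lt; lra.
Qed.

Lemma kp_0 (p : R) : kp p 0 = 0.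
Proof. unfold kp, Rdiv. ring. Qed.

Lemma kp_ge_0 (p x : R) : 0 < p < 1 -> 0 <= x < p -> 0 <= kp p x.
Proof. intros Hp Hx. rewrite <- (kp_0 p). apply kp_le; lra. Qed.

Lemma pow_le_self (r : R) (m : nat) : 0 <= r <= 1 -> (1 <= m)%nat -> 0 <= r ^ m <= r.
Proof.
  intros Hr Hm. destruct m as [|m]; [lia|]. simpl.
  assert (P := pow_le r m (proj1 Hr)). assert (Q := pow_incr r 1 m Hr). rewrite pow1 in Q. nra.
Qed.

(** * The equation for the radius *)

Section Root.

Variables (L p : R) (m : nat).
Hypothesis HL : 0 < L.
Hypothesis Hp : 0 < p < 1.
Hypothesis Hm : (1 <= m)%nat.

(** The variable part of the radius equation, with [L] standing for [2 K lambda / (K + 1)]. *)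
Definition growth (r : R) : R := kp p (r ^ m) + L * kp p r.

Lemma growth_lt (x y : R) : 0 <= x < y -> y < p -> growth x < growth y.
Proof.
  intros Hx Hy. unfold growth.
  assert (X := pow_le_self x m ltac:(lra) Hm). assert (Y := pow_le_self y m ltac:(lra) Hm).
  assert (I := pow_incr x y m ltac:(lra)).
  assert (A := kp_le p (x ^ m) (y ^ m) Hp ltac:(lra) ltac:(lra)).
  assert (B := kp_lt p x y Hp Hx Hy).
  assert (L * kp p x < L * kp p y) by (apply Rmult_lt_compat_l; lra). lra.
Qed.

Lemma growth_le (x y : R) : 0 <= x <= y -> y < p -> growth x <= growth y.
Proof.
  intros Hx Hy. destruct (Rle_lt_or_eq_dec x y (proj2 Hx)) as [H|H]; [|subst; lra].
  left. apply growth_lt; lra.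
Qed.

Lemma kp_continuity (x : R) : 0 <= x < p -> continuity_pt (kp p) x.
Proof.
  intros Hx. unfold kp. assert (D1 : 0 < 1 - p * x) by nra.
  apply continuity_pt_filterlim.
  change (continuous (fun y => p * y / ((p - y) * (1 - p * y))) x).
  apply (ex_derive_continuous (K := R_AbsRing) (V := R_NormedModule)). auto_derive.
  assert (N : 0 < (p - x) * (1 - p * x)) by (apply Rmult_lt_0_compat; lra). lra.
Qed.

Lemma growth_continuity (x : R) : 0 <= x < p -> continuity_pt growth x.
Proof.
  intros Hx. assert (X := pow_le_self x m ltac:(lra) Hm).
  apply (continuity_pt_plus (fun r => kp p (r ^ m)) (fun r => L * kp p r)).
  - apply (continuity_pt_comp (fun r => r ^ m) (kp p)); [apply derivable_continuous_pt, derivable_pt_pow|].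
    apply kp_continuity. lra.
  - apply (continuity_pt_mult (fun _ => L) (kp p)); [apply continuity_pt_const; now intros u v|].
    now apply kp_continuity.
Qed.

Lemma growth_root (c : R) : 0 < c < 1 -> exists r, 0 < r < p /\ growth r = c.
Proof.
  intros Hc.
  (* At [r1 = p - d] one has [r1 >= p / 2] and [d <= L p^2 / 4], so [L * kp p r1] is at least [2]
     and exceeds [c]. *)
  set (d := Rmin (p / 2) (L * p ^ 2 / 4)).
  assert (Lp : 0 < L * p ^ 2) by (apply Rmult_lt_0_compat; [exact HL|apply pow_lt; lra]).
  assert (D1 : d <= p / 2) by apply Rmin_l. assert (D2 : d <= L * p ^ 2 / 4) by apply Rmin_r.
  assert (D0 : 0 < d) by (apply Rmin_glb_lt; lra).
  set (r1 := p - d).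
  assert (X := pow_le_self r1 m ltac:(unfold r1; lra) Hm).
  assert (G0 : growth 0 = 0).
  { unfold growth. rewrite kp_0, pow_i, kp_0 by lia. ring. }
  assert (G1 : 1 < growth r1).
  { assert (A := kp_ge_0 p (r1 ^ m) Hp ltac:(unfold r1 in *; lra)).
    assert (B : 1 < L * kp p r1); [|unfold growth; lra].
    assert (Q : 0 < 1 - p * r1 <= 1) by (unfold r1 in *; nra).
    unfold kp. replace (p - r1) with d by (unfold r1; ring).
    apply Rmult_lt_reg_r with (d * (1 - p * r1)); [apply Rmult_lt_0_compat; lra|].
    replace (L * (p * r1 / (d * (1 - p * r1))) * (d * (1 - p * r1))) with (L * p * r1) by (field; lra).
    assert (0 < L * p) by (apply Rmult_lt_0_compat; lra).
    assert (L * p * (p / 2) <= L * p * r1) by (apply Rmult_le_compat_l; unfold r1; lra).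
    nra. }
  destruct (IVT_interv (fun r => growth r - c) 0 r1) as [r [R1 R2]].
  - intros a Ha. apply continuity_pt_minus; [apply growth_continuity; unfold r1 in *; lra|].
    apply continuity_pt_const. now intros u v.
  - unfold r1; lra.
  - lra.
  - lra.
  - exists r. split; [|lra]. split; [|unfold r1 in *; lra].
    destruct (Rle_lt_or_eq_dec 0 r (proj1 R1)) as [H|H]; [exact H|]. rewrite <- H, G0 in R2. lra.
Qed.

End Root.

Lemma radius_root_growth (K p lambda r : R) (m : nat) :
  radius_root K m p lambda r <->
  0 < r < p /\ growth (2 * K * lambda / (K + 1)) p m r = p / (1 + p) ^ 2.
Proof. unfold radius_root, growth. split; intros [H1 H2]; split; lra. Qed.

Lemma radius_factor_pos (K lambda : R) : 1 <= K -> 0 < lambda -> 0 < 2 * K * lambda / (K + 1).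
Proof.
  intros HK Hl. apply Rdiv_lt_0_compat; [|lra]. apply Rmult_lt_0_compat; lra.
Qed.

Lemma radius_root_unique_exists (K p lambda : R) (m : nat) :
  1 <= K -> 0 < p < 1 -> 0 < lambda -> (1 <= m)%nat ->
  exists r, unique (radius_root K m p lambda) r.
Proof.
  intros HK Hp Hl Hm. assert (HL := radius_factor_pos K lambda HK Hl).
  destruct (growth_root _ p m HL Hp Hm (p / (1 + p) ^ 2)) as [r [R1 R2]].
  { split; [apply Rdiv_lt_0_compat; [lra|apply pow_lt; lra]|].
    apply Rmult_lt_reg_r with ((1 + p) ^ 2); [apply pow_lt; lra|].
    unfold Rdiv. rewrite Rmult_assoc, Rinv_l by (apply pow_nonzero; lra). nra. }
  exists r. split; [now apply radius_root_growth|].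
  intros r' H. apply radius_root_growth in H. destruct H as [S1 S2].
  destruct (Rtotal_order r r') as [H|[H|H]]; [|exact H|].
  - assert (T := growth_lt _ p m HL Hp Hm r r' ltac:(lra) ltac:(lra)). lra.
  - assert (T := growth_lt _ p m HL Hp Hm r' r ltac:(lra) ltac:(lra)). lra.
Qed.

Lemma nonneg_series_bound (u : nat -> R) (B : R) : (forall n, 0 <= u n) -> (forall N, sum_n u N <= B) ->
  ex_series u /\ Series u <= B.
Proof.
  intros Hu HB.
  assert (F : ex_finite_lim_seq (sum_n u)).
  { apply ex_finite_lim_seq_incr with (M := B); [|exact HB]. intros n. rewrite sum_Sn.
    specialize (Hu (S n)). change (sum_n u n <= sum_n u n + u (S n)). lra. }
  destruct F as [l Hl].
  assert (S : is_series u l) by exact Hl.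
  split; [now exists l|]. rewrite (is_series_unique _ _ S).
  apply (is_lim_seq_le (sum_n u) (fun _ => B) l B HB Hl). apply is_lim_seq_const.
Qed.

Lemma sum_n_Mr (v : nat -> R) (r : R) (N : nat) : sum_n (fun n => v n * r ^ S n) N = r * Mr N v r.
Proof.
  induction N as [|N IH].
  - rewrite sum_O. simpl. ring.
  - rewrite sum_Sn, IH, Mr_S. change (r * Mr N v r + v (S N) * r ^ S (S N) = r * (Mr N v r + v (S N) * r ^ S N)).
    simpl. ring.
Qed.

Lemma bohr_inequality_root (K p lambda rho : R) (m : nat) :
  1 <= K -> 0 < p < 1 -> 0 < lambda -> (1 <= m)%nat -> radius_root K m p lambda rho ->
  bohr_inequality K m p lambda (Rmin (1 / 3) rho).
Proof.
  intros HK Hp Hl Hm Hroot phi h g a b Hphi Hqc Ha Hb b0 Hsub z Hz Hzr u.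
  apply radius_root_growth in Hroot. destruct Hroot as [Hrho Hroot].
  set (r := Cmod z) in *. assert (Pr : 0 <= r) by apply Cmod_ge_0.
  assert (R1 : r <= 1 / 3) by (eapply Rle_trans; [exact Hzr|apply Rmin_l]).
  assert (R2 : r <= rho) by (eapply Rle_trans; [exact Hzr|apply Rmin_r]).
  set (k := (K - 1) / (K + 1)). assert (Hk : 0 <= k) by (apply Rdiv_le_0_compat; lra).
  set (D := dist_to_boundary phi).
  assert (HD : 0 <= D) by now apply (dist_to_boundary_ge_0 p).
  (* The reciprocal of the constant in the radius equation: at the root the total factor of [D]
     becomes [1]. *)
  set (ka := (1 + p) ^ 2 / p).
  assert (Hka : 0 < ka) by (apply Rdiv_lt_0_compat; [apply pow_lt; lra|lra]).
  assert (Hn : nearC 0 (fun z => h z <> None /\ g z <> None)).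
  { exists p. split; [lra|]. intros w Hw. rewrite Cmod_minus_0 in Hw.
    destruct (Ha w Hw) as [s [-> _]]. destruct (Hb w Hw) as [t [-> _]]. split; discriminate. }
  destruct (nearC_at _ _ Hn) as [Hh0 Hg0].
  destruct (dilatation_at K h g Hqc 0 disk_0 Hh0 Hg0) as [Ah [Ag _]].
  assert (Ta : forall n, tc (fun z => fin (h z)) n = a n).
  { intros n. apply expands_tc; [exact Ah|]. apply (has_expansion_expands p); [lra|exact Ha]. }
  assert (Tb : forall n, tc (fun z => fin (g z)) n = b n).
  { intros n. apply expands_tc; [exact Ag|]. apply (has_expansion_expands p); [lra|exact Hb]. }
  assert (MA : forall s N, 0 <= s <= 1 / 3 -> s < p ->
    s * Mr N (fun n => Cmod (a (S n))) s <= D * (ka * kp p s)).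
  { intros s N Hs Hsp. rewrite (Mr_ext N _ (fun n => Cmod (tc (fun z => fin (h z)) (S n)))) by (intros; now rewrite Ta).
    now apply coefficient_bound. }
  assert (MB : forall N, Mr N (fun n => Cmod (b (S n))) r <= k * Mr N (fun n => Cmod (a (S n))) r).
  { intros N. rewrite (Mr_ext N _ (fun n => Cmod (tc (fun z => fin (g z)) (S n)))) by (intros; now rewrite Tb).
    rewrite (Mr_ext N (fun n => Cmod (a (S n))) (fun n => Cmod (tc (fun z => fin (h z)) (S n)))) by (intros; now rewrite Ta).
    apply coanalytic_majorant; [exact Hqc|exact Hn|lra]. }
  set (B := (1 + k) * (D * (ka * kp p r))).
  destruct (nonneg_series_bound u B) as [S1 S2].
  { intros n. unfold u. apply Rmult_le_pos; [|apply pow_le; exact Pr].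
    apply Rplus_le_le_0_compat; apply Cmod_ge_0. }
  { intros N. unfold u. rewrite sum_n_Mr, Mr_plus. specialize (MB N). specialize (MA r N ltac:(lra) ltac:(lra)).
    unfold B. set (X := Mr N (fun n => Cmod (a (S n))) r) in *.
    assert (T : r * Mr N (fun n => Cmod (b (S n))) r <= k * (r * X)).
    { replace (k * (r * X)) with (r * (k * X)) by ring. now apply Rmult_le_compat_l. }
    assert (T2 : k * (r * X) <= k * (D * (ka * kp p r))) by now apply Rmult_le_compat_l.
    lra. }
  split; [exact S1|].
  assert (Rm := pow_le_self r m ltac:(lra) Hm).
  (* The coefficient bound is applied at radius [r^m], which is admissible because [r^m <= r] for
     [m >= 1]. *)
  assert (H1 : Cmod (fin (h (Cpow z m))) <= Cmod (fin (phi 0)) + D * (ka * kp p (r ^ m))).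
  { destruct (subordinate_analytic p h phi Hp Hphi Hsub) as [_ E0]. rewrite <- E0.
    replace (fin (h 0)) with (a 0%nat) by (symmetry; exact (Ta 0%nat)).
    apply (has_expansion_bound p h a); [exact Ha|rewrite Cmod_pow; fold r; lra|].
    intros N. rewrite Cmod_pow. fold r. apply MA; lra. }
  assert (Hg : growth (2 * K * lambda / (K + 1)) p m r <= p / (1 + p) ^ 2).
  { rewrite <- Hroot. apply growth_le; try assumption; try lra. now apply radius_factor_pos. }
  assert (Ek : 2 * K * lambda / (K + 1) = lambda * (1 + k)) by (unfold k; field; lra).
  rewrite Ek in Hg. unfold growth in Hg.
  assert (Eb : D * (ka * kp p (r ^ m)) + lambda * B = D * (ka * (kp p (r ^ m) + lambda * (1 + k) * kp p r)))
    by (unfold B; ring).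
  assert (T3 : ka * (kp p (r ^ m) + lambda * (1 + k) * kp p r) <= 1).
  { apply Rle_trans with (ka * (p / (1 + p) ^ 2)); [apply Rmult_le_compat_l; lra|].
    right. unfold ka. field. lra. }
  assert (T4 : D * (ka * (kp p (r ^ m) + lambda * (1 + k) * kp p r)) <= D * 1) by (apply Rmult_le_compat_l; lra).
  assert (T5 : lambda * Series u <= lambda * B) by (apply Rmult_le_compat_l; lra).
  lra.
Qed.

(** * Sharpness *)

Lemma complex_sqrt (c : C) : exists w, (w * w)%C = c.
Proof.
  destruct c as [x y]. set (n := Cmod (x, y)).
  assert (N2 : n * n = x * x + y * y).
  { assert (T := Cmod2_alt (x, y)). fold n in T. simpl in T. lra. }
  assert (N0 : 0 <= n) by apply Cmod_ge_0.
  assert (X : - n <= x <= n) by (apply Rabs_le_between, (re_le_Cmod (x, y))).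
  set (a := sqrt ((n + x) / 2)). set (b := sqrt ((n - x) / 2)).
  assert (Ea : a * a = (n + x) / 2) by (apply sqrt_sqrt; lra).
  assert (Eb : b * b = (n - x) / 2) by (apply sqrt_sqrt; lra).
  assert (Eab : 2 * (a * b) = Rabs y).
  { unfold a, b. rewrite <- sqrt_mult by lra. rewrite <- sqrt_Rsqr_abs.
    replace ((n + x) / 2 * ((n - x) / 2)) with (Rsqr (y / 2)).
    - rewrite !sqrt_Rsqr_abs. unfold Rdiv. rewrite Rabs_mult, (Rabs_pos_eq (/ 2)) by lra. field.
    - unfold Rsqr. nra. }
  destruct (Rle_dec 0 y) as [Hy|Hy].
  - exists (a, b). rewrite Rabs_pos_eq in Eab by exact Hy.
    apply injective_projections; simpl; lra.
  - exists (a, - b). rewrite Rabs_left in Eab by lra.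
    apply injective_projections; simpl; lra.
Qed.

(** The two roots have product [1]: either one of them lies in the disk, or they are
    conjugate points of the unit circle. *)
Lemma joukowski (s : C) : (exists z, disk z /\ (z * z - s * z + 1)%C = 0) \/
  exists x : R, -1 <= x <= 1 /\ s = RtoC (2 * x).
Proof.
  destruct (complex_sqrt (s * s - RtoC 4)%C) as [w Hw].
  assert (N2 : RtoC 2 <> 0) by (intros E; apply RtoC_inj in E; lra).
  set (z1 := ((s + w) / RtoC 2)%C). set (z2 := ((s - w) / RtoC 2)%C).
  assert (P : (z1 * z2)%C = 1).
  { unfold z1, z2. replace ((s + w) / RtoC 2 * ((s - w) / RtoC 2))%C with ((s * s - w * w) / RtoC 4)%C.
    - rewrite Hw. field.
    - field. }
  assert (S : (z1 + z2)%C = s) by (unfold z1, z2; field; exact N2).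
  assert (Q1 : (z1 * z1 - s * z1 + 1)%C = 0) by (rewrite <- S, <- P; ring).
  assert (Q2 : (z2 * z2 - s * z2 + 1)%C = 0) by (rewrite <- S, <- P; ring).
  assert (M : Cmod z1 * Cmod z2 = 1) by (rewrite <- Cmod_mult, P; apply Cmod_1).
  assert (P1 := Cmod_ge_0 z1). assert (P2 := Cmod_ge_0 z2).
  destruct (Rtotal_order (Cmod z1) 1) as [H|[H|H]].
  - left. exists z1. now split.
  - right. exists (Re z1).
    assert (B := re_le_Cmod z1). rewrite H in B. apply Rabs_le_between in B. split; [exact B|].
    assert (C1 : (z1 * Cconj z1)%C = 1) by (rewrite <- Cmod2_conj, H; f_equal; ring).
    assert (E : z2 = Cconj z1).
    { replace z2 with (z1 * z2 * Cconj z1)%C; [rewrite P; ring|].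
      replace (z1 * z2 * Cconj z1)%C with (z1 * Cconj z1 * z2)%C by ring. rewrite C1. ring. }
    rewrite <- S, E. apply injective_projections; simpl; unfold Re; ring.
  - left. exists z2. split; [|exact Q2]. unfold disk. nra.
Qed.

Lemma pconv_geometric (al z : C) : Cmod (al * z) < 1 -> pconv (Cpow al) z (/ (1 - al * z)).
Proof.
  intros H e He. set (q := (al * z)%C) in *.
  assert (N : (1 - q)%C <> 0).
  { intros E. apply Cminus_eq_0 in E. rewrite <- E, Cmod_1 in H. lra. }
  assert (P := proj1 (Cmod_gt_0 _) N).
  assert (E : forall M, (psum M (Cpow al) z - / (1 - q))%C = (- Cpow q (S M) / (1 - q))%C).
  { induction M as [|M IH].
    - simpl. field. exact N.
    - rewrite psum_S. replace (psum M (Cpow al) z + Cpow al (S M) * Cpow z (S M) - / (1 - q))%C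
        with ((psum M (Cpow al) z - / (1 - q)) + Cpow al (S M) * Cpow z (S M))%C by ring.
      rewrite IH, <- Cpow_mult_l. fold q. rewrite (Cpow_S q (S M)). field. exact N. }
  destruct (pow_lt_1_zero (Cmod q)) with (y := e * Cmod (1 - q)) as [N0 H0].
  { rewrite Rabs_pos_eq; [exact H|apply Cmod_ge_0]. }
  { now apply Rmult_lt_0_compat. }
  exists N0. intros M HM. rewrite E, Cmod_div, Cmod_opp, Cmod_pow by exact N.
  specialize (H0 (S M) ltac:(lia)). rewrite Rabs_pos_eq in H0 by (apply pow_le, Cmod_ge_0).
  apply Rmult_lt_reg_r with (Cmod (1 - q)); [exact P|].
  unfold Rdiv. rewrite Rmult_assoc, Rinv_l by lra. lra.
Qed.

Lemma pconv_scal_minus (k : C) (c d : nat -> C) (z l m : C) : pconv c z l -> pconv d z m ->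
  pconv (fun n => k * (c n - d n))%C z (k * (l - m))%C.
Proof.
  intros H1 H2 e He. set (K := Cmod k + 1). assert (HK : 0 < K) by (unfold K; assert (T := Cmod_ge_0 k); lra).
  destruct (H1 (e / (2 * K))) as [N1 B1]; [apply Rdiv_lt_0_compat; lra|].
  destruct (H2 (e / (2 * K))) as [N2 B2]; [apply Rdiv_lt_0_compat; lra|].
  exists (max N1 N2). intros N HN.
  assert (E : forall N c d, psum N (fun n => k * (c n - d n))%C z = (k * (psum N c z - psum N d z))%C).
  { clear. induction N as [|N IH]; intros c d; simpl; [ring|].
    unfold shift. rewrite (IH (fun n => c (S n)) (fun n => d (S n))). ring. }
  rewrite E. specialize (B1 N ltac:(lia)). specialize (B2 N ltac:(lia)).
  replace (k * (psum N c z - psum N d z) - k * (l - m))%C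
    with (k * ((psum N c z - l) + - (psum N d z - m)))%C by ring.
  rewrite Cmod_mult. assert (T := Cmod_triangle (psum N c z - l) (- (psum N d z - m))). rewrite Cmod_opp in T.
  assert (T2 : Cmod (psum N c z - l + - (psum N d z - m)) < e / K).
  { replace (e / K) with (e / (2 * K) + e / (2 * K)) by (field; lra). lra. }
  apply Rle_lt_trans with (K * Cmod (psum N c z - l + - (psum N d z - m))).
  - apply Rmult_le_compat_r; [apply Cmod_ge_0|unfold K; lra].
  - replace e with (K * (e / K)) by (field; lra). now apply Rmult_lt_compat_l.
Qed.

(** * The extremal function *)

Section Koebe.

Variable p : R.
Hypothesis Hp : 0 < p < 1.

(** The factor [k] serves both parts of the extremal mapping: [1] for [h] and [(K - 1) / (K + 1)]
    for [g]. *)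
Definition koebe_val (k : R) (z : C) : C :=
  (RtoC k * (RtoC p * z) / ((RtoC p - z) * (1 - RtoC p * z)))%C.

Definition koebe (k : R) (z : C) : Chat :=
  if Ceq_dec z (RtoC p) then None else Some (koebe_val k z).

Lemma koebe_at_p (k : R) : koebe k (RtoC p) = None.
Proof. unfold koebe. now destruct (Ceq_dec (RtoC p) (RtoC p)). Qed.

Lemma koebe_neq (k : R) (z : C) : z <> RtoC p -> koebe k z = Some (koebe_val k z).
Proof. intros N. unfold koebe. now destruct (Ceq_dec z (RtoC p)). Qed.

Lemma koebe_factors (z : C) : disk z -> z <> RtoC p ->
  (RtoC p - z)%C <> 0 /\ (1 - RtoC p * z)%C <> 0.
Proof.
  intros Hz N. split; [apply Cminus_neq_0; auto|].
  apply one_minus_pz_neq_0; [lra|unfold disk in Hz; lra].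
Qed.

Lemma koebe_cder (k : R) (z : C) : disk z -> z <> RtoC p ->
  cder (koebe_val k) z (RtoC k * (RtoC p * RtoC p) * (1 - z * z)
    / (((RtoC p - z) * (1 - RtoC p * z)) * ((RtoC p - z) * (1 - RtoC p * z))))%C.
Proof.
  intros Hz N. destruct (koebe_factors z Hz N) as [N1 N2].
  assert (N3 : ((RtoC p - z) * (1 - RtoC p * z))%C <> 0).
  { intros E. destruct (Cmult_integral _ _ E); contradiction. }
  unfold koebe_val. eapply cder_eq; [|apply cder_div; [| |exact N3]].
  2: apply cder_mult; [apply cder_const|apply cder_mult; [apply cder_const|apply cder_id]].
  2: apply cder_mult; (apply cder_minus; [apply cder_const|]);
    [apply cder_id|apply cder_mult; [apply cder_const|apply cder_id]].
  cbv beta. f_equal. ring.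
Qed.

Lemma koebe_near (z : C) : z <> RtoC p -> nearC z (fun w => w <> RtoC p).
Proof.
  intros N. assert (P := proj1 (Cmod_gt_0 _) (Cminus_neq_0 _ _ N)).
  exists (Cmod (z - RtoC p)). split; [exact P|]. intros w Hw ->. rewrite Cmod_minus_sym in Hw. lra.
Qed.

Lemma fin_koebe_cder (k : R) (z : C) : disk z -> z <> RtoC p ->
  cder (fun w => fin (koebe k w)) z (RtoC k * (RtoC p * RtoC p) * (1 - z * z)
    / (((RtoC p - z) * (1 - RtoC p * z)) * ((RtoC p - z) * (1 - RtoC p * z))))%C.
Proof.
  intros Hz N. destruct (koebe_near z N) as [e [He H]].
  apply cder_local with (g := koebe_val k) (r := e); [exact He| |now apply koebe_cder].
  intros w Hw. now rewrite (koebe_neq k w (H w Hw)).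
Qed.

Lemma koebe_analytic (k : R) (z : C) : disk z -> z <> RtoC p -> analytic_at (koebe k) z.
Proof.
  intros Hz N. destruct (nearC_and _ _ _ (disk_near z Hz) (koebe_near z N)) as [e [He H]].
  exists e. split; [exact He|]. intros w Hw. destruct (H w Hw) as [H1 H2].
  split; [rewrite koebe_neq by exact H2; discriminate|].
  apply cdiff_iff. eexists. apply fin_koebe_cder; assumption.
Qed.

Lemma koebe_pole (k : R) : k <> 0 -> simple_pole (koebe k) (RtoC p).
Proof.
  intros Hk. split; [apply koebe_at_p|].
  exists (fun w => - (RtoC k * (RtoC p * w)) / (1 - RtoC p * w))%C, (1 - p).
  assert (D : forall w, Cmod (w - RtoC p) < 1 - p -> disk w).
  { intros w Hw. apply (disk_in (RtoC p)). rewrite Cmod_R, Rabs_pos_eq by lra. exact Hw. }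
  assert (N : forall w, disk w -> (1 - RtoC p * w)%C <> 0).
  { intros w Hw. apply one_minus_pz_neq_0; [lra|unfold disk in Hw; lra]. }
  assert (Np : RtoC p <> 0) by (intros E; apply RtoC_inj in E; lra).
  assert (Nk : RtoC k <> 0) by (intros E; apply RtoC_inj in E; lra).
  split; [lra|]. split; [|split].
  - assert (Dp : disk (RtoC p)) by (apply D; rewrite Cmod_self; lra).
    intros E. assert (F : (RtoC k * (RtoC p * RtoC p))%C = 0).
    { replace (RtoC k * (RtoC p * RtoC p))%C
        with (- (- (RtoC k * (RtoC p * RtoC p)) / (1 - RtoC p * RtoC p)) * (1 - RtoC p * RtoC p))%C
        by (field; now apply N).
      rewrite E. ring. }
    destruct (Cmult_integral _ _ F) as [F1|F1]; [contradiction|].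
    destruct (Cmult_integral _ _ F1); contradiction.
  - intros w Hw. apply cdiff_iff. apply cdiff_div; [| |now apply N, D].
    + apply cdiff_opp. apply cdiff_mult; [apply cdiff_const|apply cdiff_mult; [apply cdiff_const|apply cdiff_id]].
    + apply cdiff_minus; [apply cdiff_const|apply cdiff_mult; [apply cdiff_const|apply cdiff_id]].
  - intros w [W1 W2]. assert (Nw : w <> RtoC p) by (intros ->; rewrite Cmod_self in W1; lra).
    rewrite koebe_neq by exact Nw. f_equal. unfold koebe_val.
    destruct (koebe_factors w (D w W2) Nw) as [N1 N2]. simpl. field.
    repeat split; first [exact N1|exact N2|now apply Cminus_neq_0].
Qed.

Lemma koebe_meromorphic (k : R) : k <> 0 -> meromorphic_in_disk (koebe k).
Proof.
  intros Hk z Hz. destruct (Ceq_dec z (RtoC p)) as [->|N].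
  - right. exists 1%nat. split; [lia|now apply koebe_pole].
  - left. now apply koebe_analytic.
Qed.

Lemma koebe_univalent : univalent_in_disk (koebe 1).
Proof.
  intros z w Hz Hw E.
  destruct (Ceq_dec z (RtoC p)) as [->|Nz], (Ceq_dec w (RtoC p)) as [->|Nw]; [reflexivity| | |].
  - rewrite koebe_at_p, koebe_neq in E by exact Nw. discriminate.
  - rewrite koebe_at_p, koebe_neq in E by exact Nz. discriminate.
  - rewrite !koebe_neq in E by assumption.
    assert (E' : koebe_val 1 z = koebe_val 1 w) by congruence.
    destruct (koebe_factors z Hz Nz) as [Z1 Z2]. destruct (koebe_factors w Hw Nw) as [W1 W2].
    assert (Np : RtoC p <> 0) by (intros F; apply RtoC_inj in F; lra).
    (* The numerator of the difference of two values is [p^2 (z - w) (1 - z w)], and [z w] cannot be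
       [1] in the disk. *)
    assert (F : (RtoC p * (RtoC p * ((z - w) * (1 - z * w))))%C = 0).
    { replace (RtoC p * (RtoC p * ((z - w) * (1 - z * w))))%C
        with ((koebe_val 1 z - koebe_val 1 w) * (((RtoC p - z) * (1 - RtoC p * z)) * ((RtoC p - w) * (1 - RtoC p * w))))%C
        by (unfold koebe_val; field; repeat split; assumption).
      rewrite E'. ring. }
    destruct (Cmult_integral _ _ F) as [F1|F1]; [contradiction|].
    destruct (Cmult_integral _ _ F1) as [F2|F2]; [contradiction|].
    destruct (Cmult_integral _ _ F2) as [F3|F3]; [now apply Cminus_eq_0|].
    exfalso. apply Cminus_eq_0 in F3. assert (A := Cmod_1). rewrite F3, Cmod_mult in A.
    unfold disk in Hz, Hw. assert (P1 := Cmod_ge_0 z). assert (P2 := Cmod_ge_0 w). nra.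
Qed.

(** The values of [k_p] on the unit circle. Since [1 / k_p + (1 + p^2) / p = z + 1/z], which is
    [2 x] at a point of the circle with real part [x], the value there is
    [-p / (1 + p^2 - 2 p x)]. *)
Definition slit (c : C) : Prop := exists x, -1 <= x <= 1 /\ c = RtoC (- p / (1 + p ^ 2 - 2 * p * x)).

Lemma slit_den (x : R) : -1 <= x <= 1 -> 0 < 1 + p ^ 2 - 2 * p * x.
Proof. intros Hx. nra. Qed.

Lemma koebe_omits_slit (c : C) : slit c -> ~ image_disk (koebe 1) (Some c).
Proof.
  intros [x [Hx ->]] [z [Hz E]].
  assert (Nz : z <> RtoC p) by (intros ->; rewrite koebe_at_p in E; discriminate).
  rewrite koebe_neq in E by exact Nz.
  set (d := 1 + p ^ 2 - 2 * p * x) in *. assert (Hd : 0 < d) by now apply slit_den.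
  assert (E' : koebe_val 1 z = RtoC (- p / d)) by congruence.
  destruct (koebe_factors z Hz Nz) as [Z1 Z2].
  assert (Np : RtoC p <> 0) by (intros F; apply RtoC_inj in F; lra).
  assert (Nd : RtoC d <> 0) by (intros F; apply RtoC_inj in F; lra).
  assert (Ed : RtoC d = (1 + RtoC p * RtoC p - RtoC 2 * RtoC p * RtoC x)%C).
  { unfold d. rewrite !RtoC_minus, !RtoC_plus, !RtoC_mult. simpl. rewrite Rmult_1_r, RtoC_mult. reflexivity. }
  assert (F : (RtoC p * (RtoC p * (z * z - RtoC 2 * RtoC x * z + 1)))%C = 0).
  { transitivity ((koebe_val 1 z + RtoC p / RtoC d) * RtoC d * ((RtoC p - z) * (1 - RtoC p * z)))%C.
    - unfold koebe_val.
      replace ((RtoC 1 * (RtoC p * z) / ((RtoC p - z) * (1 - RtoC p * z)) + RtoC p / RtoC d) * RtoC d * ((RtoC p - z) * (1 - RtoC p * z)))%C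
        with (RtoC p * z * RtoC d + RtoC p * ((RtoC p - z) * (1 - RtoC p * z)))%C by (field; repeat split; assumption).
      rewrite Ed. ring.
    - rewrite E', RtoC_div, RtoC_opp by lra. field. exact Nd. }
  destruct (Cmult_integral _ _ F) as [F1|F1]; [contradiction|].
  destruct (Cmult_integral _ _ F1) as [F2|F2]; [contradiction|].
  assert (M := Cmod2_alt z). unfold disk in Hz. assert (Pz := Cmod_ge_0 z).
  assert (M1 : Re z ^ 2 + Im z ^ 2 < 1) by (rewrite <- M; nra).
  destruct z as [u v]. simpl in M1.
  assert (G1 := f_equal fst F2). assert (G2 := f_equal snd F2). simpl in G1, G2.
  assert (G3 : v * (u - x) = 0) by lra.
  (* The roots of [z^2 - 2 x z + 1] with [|x| <= 1] have modulus [1]: a real root gives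
     [(1 - u^2)^2 <= 0], and otherwise the real part of [z] is [x] and [x^2 + v^2 = 1]. *)
  destruct (Rmult_integral _ _ G3) as [G|G].
  - subst v.
    assert (E1 : 2 * x * u = u * u + 1) by lra. assert (X2 : x * x <= 1) by nra.
    assert (E2 : (u * u + 1) * (u * u + 1) <= 4 * (u * u)).
    { rewrite <- E1. replace (2 * x * u * (2 * x * u)) with (x * x * (4 * (u * u))) by ring.
      rewrite <- (Rmult_1_l (4 * (u * u))) at 2. apply Rmult_le_compat_r; [nra|exact X2]. }
    assert (E3 : 0 < (1 - u * u) * (1 - u * u)) by (apply Rmult_lt_0_compat; lra).
    lra.
  - assert (u = x) by lra. subst u. lra.
Qed.

(** For [c] different from [0], [k_p(z) = c] is equivalent to [z + 1/z = s] with
    [s = 1/c + (1 + p^2) / p]; the exceptional alternative of [joukowski] says precisely that [c] is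
    on the slit. *)
Lemma koebe_covers (c : C) : ~ slit c -> image_disk (koebe 1) (Some c).
Proof.
  intros Hc.
  assert (Np : RtoC p <> 0) by (intros F; apply RtoC_inj in F; lra).
  destruct (Ceq_dec c 0) as [->|Nc].
  - exists 0. split; [exact disk_0|]. rewrite koebe_neq by auto. f_equal. unfold koebe_val.
    field. exact Np.
  - set (s := (/ c + (1 + RtoC p * RtoC p) / RtoC p)%C).
    destruct (joukowski s) as [[z [Hz Q]]|[x [Hx Es]]].
    + assert (Q' : ((RtoC p - z) * (1 - RtoC p * z) * c)%C = (RtoC p * z)%C).
      { apply Cminus_eq_0. transitivity (RtoC p * c * (z * z - s * z + 1))%C.
        - unfold s. field. split; assumption.
        - rewrite Q. ring. }
      assert (Nz0 : z <> 0).
      { intros ->. apply (f_equal Cmod) in Q. replace (0 * 0 - s * 0 + 1)%C with (RtoC 1) in Q by ring.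
        rewrite Cmod_1, Cmod_0 in Q. lra. }
      assert (Nz : z <> RtoC p).
      { intros E. rewrite E in Q'. replace ((RtoC p - RtoC p) * (1 - RtoC p * RtoC p) * c)%C with (RtoC 0) in Q' by ring.
        symmetry in Q'. destruct (Cmult_integral _ _ Q'); contradiction. }
      exists z. split; [exact Hz|]. rewrite koebe_neq by exact Nz. f_equal. unfold koebe_val.
      destruct (koebe_factors z Hz Nz) as [Z1 Z2].
      replace (RtoC 1 * (RtoC p * z))%C with ((RtoC p - z) * (1 - RtoC p * z) * c)%C by (rewrite Q'; ring).
      field. split; assumption.
    + exfalso. apply Hc. exists x. split; [exact Hx|].
      assert (Hd := slit_den x Hx).
      assert (Ei : (/ c)%C = RtoC (- (1 + p ^ 2 - 2 * p * x) / p)).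
      { replace (/ c)%C with (s - (1 + RtoC p * RtoC p) / RtoC p)%C by (unfold s; ring).
        rewrite Es. replace (1 + RtoC p * RtoC p)%C with (RtoC (1 + p * p)) by (now rewrite RtoC_plus, RtoC_mult).
        rewrite <- RtoC_div, <- RtoC_minus by lra. f_equal. field. lra. }
      replace c with (/ / c)%C by (field; exact Nc). rewrite Ei.
      assert (- (1 + p ^ 2 - 2 * p * x) / p <> 0).
      { apply Rlt_not_eq. unfold Rdiv. rewrite Ropp_mult_distr_l_reverse.
        apply Ropp_lt_gt_0_contravar, Rmult_lt_0_compat; [exact Hd|apply Rinv_0_lt_compat; lra]. }
      rewrite <- RtoC_inv by assumption. f_equal. field. lra.
Qed.

Lemma slit_iff (c : C) : ~ image_disk (koebe 1) (Some c) <-> slit c.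
Proof.
  split; intros H; [|now apply koebe_omits_slit].
  apply NNPP. intros N. now apply H, koebe_covers.
Qed.

(** As a real interval the slit is visibly convex, and its endpoint nearest to [0 = k_p(0)] can be
    read off. *)
Lemma slit_real (c : C) : slit c <-> exists y, - p / (1 - p) ^ 2 <= y <= - p / (1 + p) ^ 2 /\ c = RtoC y.
Proof.
  split.
  - intros [x [Hx ->]]. assert (Hd := slit_den x Hx). eexists. split; [|reflexivity].
    assert (Q1 : 0 < (1 - p) ^ 2) by (apply pow_lt; lra).
    assert (I1 : / (1 + p ^ 2 - 2 * p * x) <= / (1 - p) ^ 2) by (apply Rinv_le_contravar; nra).
    assert (I2 : / (1 + p) ^ 2 <= / (1 + p ^ 2 - 2 * p * x)) by (apply Rinv_le_contravar; nra).
    unfold Rdiv. nra.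
  - intros [y [Hy ->]].
    assert (Q1 : 0 < (1 - p) ^ 2) by (apply pow_lt; lra).
    assert (Q2 : 0 < (1 + p) ^ 2) by (apply pow_lt; lra).
    assert (Y1 : - y * (1 - p) ^ 2 <= p).
    { replace p with (- (- p / (1 - p) ^ 2) * (1 - p) ^ 2) at 2 by (field; lra). apply Rmult_le_compat_r; lra. }
    assert (Y2 : p <= - y * (1 + p) ^ 2).
    { replace p with (- (- p / (1 + p) ^ 2) * (1 + p) ^ 2) at 1 by (field; lra). apply Rmult_le_compat_r; lra. }
    assert (Yn : 0 < - y) by nra.
    exists ((1 + p ^ 2 + p / y) / (2 * p)). split.
    + split.
      * apply Rmult_le_reg_r with (2 * p * - y); [apply Rmult_lt_0_compat; lra|].
        replace ((1 + p ^ 2 + p / y) / (2 * p) * (2 * p * - y)) with (- y * (1 + p ^ 2) - p) by (field; lra). nra.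
      * apply Rmult_le_reg_r with (2 * p * - y); [apply Rmult_lt_0_compat; lra|].
        replace ((1 + p ^ 2 + p / y) / (2 * p) * (2 * p * - y)) with (- y * (1 + p ^ 2) - p) by (field; lra). nra.
    + f_equal. field. split; [lra|]. split; lra.
Qed.

Lemma koebe_concave : concave_class p (koebe 1).
Proof.
  split; [apply koebe_meromorphic; lra|]. split; [exact koebe_univalent|].
  split; [intros z Hz N; now apply koebe_analytic|]. split; [apply koebe_pole; lra|].
  intros x y t Hx Hy Ht. apply slit_iff in Hx. apply slit_iff in Hy. apply slit_iff.
  apply slit_real in Hx. apply slit_real in Hy. apply slit_real.
  destruct Hx as [a [Ha ->]]. destruct Hy as [b [Hb ->]].
  exists (t * a + (1 - t) * b). split; [|now rewrite RtoC_plus, !RtoC_mult].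
  set (l := - p / (1 - p) ^ 2) in *. set (u := - p / (1 + p) ^ 2) in *. nra.
Qed.

(** The right endpoint of the slit is a boundary point at distance [p / (1 + p)^2] from
    [k_p(0) = 0]. An upper bound is what sharpness calls for, as the distance stands on the larger
    side of the inequality. *)
Lemma koebe_dist : dist_to_boundary (koebe 1) <= p / (1 + p) ^ 2.
Proof.
  assert (Np : RtoC p <> 0) by (intros F; apply RtoC_inj in F; lra).
  assert (Q2 : 0 < (1 + p) ^ 2) by (apply pow_lt; lra).
  assert (D : 0 < p / (1 + p) ^ 2) by (apply Rdiv_lt_0_compat; lra).
  destruct (dist_to_set_spec (fin (koebe 1 0)) (boundary (fun c => image_disk (koebe 1) (Some c)))
    (boundary_image_nonempty p _ Hp koebe_concave)) as [_ [H _]].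
  assert (E0 : fin (koebe 1 0) = 0).
  { rewrite koebe_neq by auto. simpl. unfold koebe_val. field. exact Np. }
  unfold dist_to_boundary. eapply Rle_trans; [apply (H (RtoC (- p / (1 + p) ^ 2)))|].
  - intros e He. split.
    + exists (RtoC (- p / (1 + p) ^ 2 + e / 2)). split.
      * rewrite <- RtoC_minus. replace (- p / (1 + p) ^ 2 + e / 2 - - p / (1 + p) ^ 2) with (e / 2) by ring.
        rewrite Cmod_R, Rabs_pos_eq; lra.
      * apply koebe_covers. intros S. apply slit_real in S. destruct S as [y [Hy E]].
        apply RtoC_inj in E. lra.
    + exists (RtoC (- p / (1 + p) ^ 2)). split; [rewrite Cmod_self; exact He|].
      apply koebe_omits_slit, slit_real. eexists. split; [|reflexivity]. split; [|lra].
      assert (I : / (1 + p) ^ 2 <= / (1 - p) ^ 2) by (apply Rinv_le_contravar; [apply pow_lt; lra|nra]).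
      unfold Rdiv. nra.
  - rewrite E0. right. replace (0 - RtoC (- p / (1 + p) ^ 2))%C with (RtoC (p / (1 + p) ^ 2)).
    + rewrite Cmod_R. apply Rabs_pos_eq. lra.
    + replace (- p / (1 + p) ^ 2) with (- (p / (1 + p) ^ 2)) by (field; lra). rewrite RtoC_opp. ring.
Qed.

(** From the partial fractions [k_p = p / (1 - p^2) (1 / (1 - z/p) - 1 / (1 - p z))]. *)
Definition koebe_coef (k : R) (n : nat) : C :=
  (RtoC (k * (p / (1 - p ^ 2))) * (Cpow (RtoC (/ p)) n - Cpow (RtoC p) n))%C.

Lemma koebe_pconv (k : R) (z : C) : Cmod z < p -> pconv (koebe_coef k) z (koebe_val k z).
Proof.
  intros Hz. assert (Pz := Cmod_ge_0 z).
  assert (D : disk z) by (unfold disk; lra).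
  assert (N : z <> RtoC p) by (intros ->; rewrite Cmod_R, Rabs_pos_eq in Hz; lra).
  destruct (koebe_factors z D N) as [N1 N2].
  assert (Np : RtoC p <> 0) by (intros F; apply RtoC_inj in F; lra).
  assert (Hd : 1 - p ^ 2 <> 0) by nra.
  replace (koebe_val k z)
    with (RtoC (k * (p / (1 - p ^ 2))) * (/ (1 - RtoC (/ p) * z) - / (1 - RtoC p * z)))%C.
  - apply pconv_scal_minus; apply pconv_geometric; rewrite Cmod_mult, Cmod_R.
    + rewrite Rabs_pos_eq by (left; apply Rinv_0_lt_compat; lra).
      apply Rmult_lt_reg_l with p; [lra|]. rewrite <- Rmult_assoc, Rinv_r; lra.
    + rewrite Rabs_pos_eq; nra.
  - rewrite RtoC_mult, RtoC_div, RtoC_inv by lra.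
    assert (Ed : RtoC (1 - p ^ 2) = (1 - RtoC p * RtoC p)%C).
    { rewrite RtoC_minus. simpl. now rewrite Rmult_1_r, RtoC_mult. }
    assert (Nd : (1 - RtoC p * RtoC p)%C <> 0) by (rewrite <- Ed; intros F; apply RtoC_inj in F; lra).
    rewrite Ed. unfold koebe_val. field. repeat split; try assumption.
Qed.

Lemma koebe_expansion (k : R) : has_expansion p (koebe k) (koebe_coef k).
Proof.
  intros z Hz. exists (koebe_val k z).
  assert (N : z <> RtoC p) by (intros ->; rewrite Cmod_R, Rabs_pos_eq in Hz; lra).
  split; [now apply koebe_neq|]. apply is_pseries_pconv. now apply koebe_pconv.
Qed.

Lemma koebe_val_real (k r : R) : 0 <= r < p -> koebe_val k (RtoC r) = RtoC (k * kp p r).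
Proof.
  intros Hr. unfold koebe_val, kp. rewrite !RtoC_mult, RtoC_div, !RtoC_mult, !RtoC_minus, !RtoC_mult.
  - unfold Cdiv. ring.
  - apply Rmult_integral_contrapositive. split; nra.
Qed.

Lemma koebe_coef_real (k : R) (n : nat) : 0 <= k ->
  koebe_coef k n = RtoC (Cmod (koebe_coef k n)).
Proof.
  intros Hk. unfold koebe_coef. rewrite <- !RtoC_pow, <- RtoC_minus, <- RtoC_mult, Cmod_R.
  f_equal. symmetry. apply Rabs_pos_eq. apply Rmult_le_pos.
  - apply Rmult_le_pos; [exact Hk|]. apply Rdiv_le_0_compat; nra.
  - assert (I : p ^ n <= (/ p) ^ n); [|lra]. apply pow_incr. split; [lra|].
    apply Rmult_le_reg_r with p; [lra|]. rewrite Rinv_l; nra.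
Qed.

Lemma koebe_coef_0 (k : R) : koebe_coef k 0 = 0.
Proof. unfold koebe_coef. simpl. ring. Qed.

(** The coefficients are nonnegative, so the majorant series at [r] is the value of the function at
    [r]; this is why the estimates are attained. *)
Lemma koebe_series (k r : R) : 0 <= k -> 0 <= r < p ->
  is_series (fun n => Cmod (koebe_coef k (S n)) * r ^ S n) (k * kp p r).
Proof.
  intros Hk Hr.
  assert (H : pconv (koebe_coef k) (RtoC r) (RtoC (k * kp p r))).
  { rewrite <- koebe_val_real by exact Hr. apply koebe_pconv. rewrite Cmod_R, Rabs_pos_eq; lra. }
  assert (E : forall N c, (forall n, c n = RtoC (Cmod (c n))) -> psum N c (RtoC r) = RtoC (Mr N (fun n => Cmod (c n)) r)).
  { clear. induction N as [|N IH]; intros c Hc; simpl; [apply Hc|].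
    rewrite (IH (shift c)) by (intros n; apply Hc). rewrite RtoC_plus, RtoC_mult, <- Hc. reflexivity. }
  apply (filterlim_locally (F := eventually) (U := R_UniformSpace)). intros [e He]. destruct (H e He) as [N0 H0].
  exists N0. intros N HN. specialize (H0 (S N) ltac:(lia)).
  rewrite E in H0 by (intros; now apply koebe_coef_real).
  rewrite <- RtoC_minus, Cmod_R in H0.
  change (Rabs (sum_n (fun n => Cmod (koebe_coef k (S n)) * r ^ S n) N - k * kp p r) < e).
  rewrite (sum_n_Mr (fun n => Cmod (koebe_coef k (S n)))).
  simpl in H0. rewrite koebe_coef_0, Cmod_0, Rplus_0_l in H0. exact H0.
Qed.

Lemma koebe_derivative_neq_0 (z : C) : disk z -> z <> RtoC p ->
  (RtoC 1 * (RtoC p * RtoC p) * (1 - z * z)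
    / (((RtoC p - z) * (1 - RtoC p * z)) * ((RtoC p - z) * (1 - RtoC p * z))))%C <> 0.
Proof.
  intros Hz N E. destruct (koebe_factors z Hz N) as [N1 N2].
  assert (Np : RtoC p <> 0) by (intros F; apply RtoC_inj in F; lra).
  assert (F : (RtoC p * (RtoC p * (1 - z * z)))%C = 0).
  { set (D := ((RtoC p - z) * (1 - RtoC p * z) * ((RtoC p - z) * (1 - RtoC p * z)))%C) in *.
    assert (N3 : ((RtoC p - z) * (1 - RtoC p * z))%C <> 0).
    { intros F. destruct (Cmult_integral _ _ F); contradiction. }
    assert (ND : D <> 0) by (intros F; destruct (Cmult_integral _ _ F); contradiction).
    replace (RtoC p * (RtoC p * (1 - z * z)))%C with (RtoC 1 * (RtoC p * RtoC p) * (1 - z * z) / D * D)%C by (field; exact ND).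
    rewrite E. ring. }
  destruct (Cmult_integral _ _ F) as [F1|F1]; [contradiction|].
  destruct (Cmult_integral _ _ F1) as [F2|F2]; [contradiction|].
  apply Cminus_eq_0 in F2. assert (A := Cmod_1). rewrite F2, Cmod_mult in A.
  unfold disk in Hz. assert (P := Cmod_ge_0 z). nra.
Qed.

(** For [K = 1] the function [koebe 0] would have a spurious pole at [p]. *)
Definition koebe_co (k : R) : C -> Chat :=
  if Req_dec_T k 0 then fun _ => Some (RtoC 0) else koebe k.

Lemma koebe_co_expansion (k : R) : has_expansion p (koebe_co k) (koebe_coef k).
Proof.
  unfold koebe_co. destruct (Req_dec_T k 0) as [->|N]; [|apply koebe_expansion].
  intros z Hz. exists 0. split; [reflexivity|]. apply is_pseries_pconv.
  assert (P := koebe_pconv 0 z Hz).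
  replace (koebe_val 0 z) with (RtoC 0) in P by (unfold koebe_val, Cdiv; ring). exact P.
Qed.

Lemma koebe_sense_preserving (K : R) : 1 <= K ->
  sense_preserving_qc_harmonic K (koebe 1) (koebe_co ((K - 1) / (K + 1))).
Proof.
  intros HK. set (k := (K - 1) / (K + 1)).
  assert (Hk : 0 <= k < 1).
  { unfold k. split; [apply Rdiv_le_0_compat; lra|]. apply Rmult_lt_reg_r with (K + 1); [lra|].
    unfold Rdiv. rewrite Rmult_assoc, Rinv_l; lra. }
  split; [apply koebe_meromorphic; lra|]. split.
  - unfold koebe_co. destruct (Req_dec_T k 0) as [E|N]; [|now apply koebe_meromorphic].
    intros z _. left. exists 1. split; [lra|]. intros w _. split; [discriminate|].
    apply cdiff_iff, cdiff_const.
  - intros z Hz Hh _.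
    assert (N : z <> RtoC p) by (intros ->; apply Hh, koebe_at_p).
    set (dh := (RtoC 1 * (RtoC p * RtoC p) * (1 - z * z)
      / (((RtoC p - z) * (1 - RtoC p * z)) * ((RtoC p - z) * (1 - RtoC p * z))))%C).
    assert (Nh : dh <> 0) by now apply koebe_derivative_neq_0.
    exists dh, (RtoC k * dh)%C.
    assert (E : Cmod (RtoC k * dh / dh) = k).
    { replace (RtoC k * dh / dh)%C with (RtoC k) by (field; exact Nh). rewrite Cmod_R. apply Rabs_pos_eq. lra. }
    split; [apply cder_is_derive; now apply fin_koebe_cder|]. split; [|rewrite E; repeat split; [exact Nh|lra|apply Rle_refl]].
    apply cder_is_derive. unfold koebe_co. destruct (Req_dec_T k 0) as [E0|_].
    + rewrite E0. eapply cder_eq; [|apply cder_const]. ring.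
    + eapply cder_eq; [|now apply fin_koebe_cder]. unfold dh, Cdiv. ring.
Qed.

Lemma koebe_subordinate : subordinate (koebe 1) (koebe 1).
Proof.
  exists (fun z => z). split; [|split; reflexivity].
  intros z Hz. split; [exact Hz|apply cdiff_iff, cdiff_id].
Qed.

Lemma koebe_sharp (K lambda rho rstar : R) (m : nat) :
  1 <= K -> 0 < lambda -> (1 <= m)%nat -> radius_root K m p lambda rstar -> rstar < rho ->
  ~ bohr_inequality K m p lambda rho.
Proof.
  intros HK Hl Hm Hroot Hrho HB.
  apply radius_root_growth in Hroot. destruct Hroot as [Hr Hroot].
  set (k := (K - 1) / (K + 1)).
  assert (Hk : 0 <= k) by (apply Rdiv_le_0_compat; lra).
  (* [rho] may exceed [p], while the inequality concerns only points with modulus below [p]; this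
     [r] lies strictly between [rstar] and [p]. *)
  set (r := Rmin rho ((rstar + p) / 2)).
  assert (R1 : r <= rho) by apply Rmin_l. assert (R2 : r <= (rstar + p) / 2) by apply Rmin_r.
  assert (R3 : rstar < r) by (apply Rmin_glb_lt; lra).
  assert (Cr : Cmod (RtoC r) = r) by (rewrite Cmod_R, Rabs_pos_eq; lra).
  destruct (HB (koebe 1) (koebe 1) (koebe_co k) (koebe_coef 1) (koebe_coef k) koebe_concave
    (koebe_sense_preserving K HK) (koebe_expansion 1) (koebe_co_expansion k) (koebe_coef_0 k)
    koebe_subordinate (RtoC r)) as [_ H]; [rewrite Cr; lra|rewrite Cr; exact R1|].
  cbv zeta in H.
  assert (S1 := koebe_series 1 r ltac:(lra) ltac:(lra)).
  assert (S2 := koebe_series k r Hk ltac:(lra)).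
  assert (ES : Series (fun n => (Cmod (koebe_coef 1 (S n)) + Cmod (koebe_coef k (S n))) * Cmod (RtoC r) ^ S n)
    = (1 + k) * kp p r).
  { apply is_series_unique. rewrite Cr.
    replace ((1 + k) * kp p r) with (1 * kp p r + k * kp p r) by ring.
    apply is_series_ext with (2 := is_series_plus _ _ _ _ S1 S2). intros n.
    change (Cmod (koebe_coef 1 (S n)) * r ^ S n + Cmod (koebe_coef k (S n)) * r ^ S n =
      (Cmod (koebe_coef 1 (S n)) + Cmod (koebe_coef k (S n))) * r ^ S n). ring. }
  rewrite ES in H.
  assert (Rm := pow_le_self r m ltac:(lra) Hm).
  assert (Np : RtoC p <> 0) by (intros F; apply RtoC_inj in F; lra).
  assert (E0 : Cmod (fin (koebe 1 0)) = 0).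
  { rewrite koebe_neq by auto. simpl. unfold koebe_val.
    replace (1 * (RtoC p * 0) / ((RtoC p - 0) * (1 - RtoC p * 0)))%C with (RtoC 0); [apply Cmod_0|]. field. exact Np. }
  assert (Em : Cmod (fin (koebe 1 (Cpow (RtoC r) m))) = kp p (r ^ m)).
  { rewrite <- RtoC_pow. rewrite koebe_neq by (intros E; apply RtoC_inj in E; lra). simpl.
    rewrite koebe_val_real, Cmod_R, Rabs_pos_eq by (try rewrite Rmult_1_l; try apply kp_ge_0; lra). ring. }
  rewrite E0, Em in H.
  assert (D := koebe_dist).
  (* Beyond the root the left side of the inequality, which is exactly [growth] at [r], exceeds
     [p / (1 + p)^2]. *)
  assert (G := growth_lt _ p m (radius_factor_pos K lambda HK Hl) Hp Hm rstar r ltac:(lra) ltac:(lra)).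
  rewrite Hroot in G. unfold growth in G.
  replace (2 * K * lambda / (K + 1)) with (lambda * (1 + k)) in G by (unfold k; field; lra). lra.
Qed.

End Koebe.

Theorem theorem3p2 :
  forall (K p lambda : R) (m : nat),
    1 <= K -> 0 < p < 1 -> 0 < lambda -> (1 <= m)%nat ->
    exists Rstar : R,
      unique (radius_root K m p lambda) Rstar /\
      bohr_inequality K m p lambda (Rmin (1 / 3) Rstar) /\
      (Rstar <= 1 / 3 ->
       forall rho : R, Rstar < rho -> ~ bohr_inequality K m p lambda rho).
Proof.
  intros K p lambda m HK Hp Hl Hm.
  destruct (radius_root_unique_exists K p lambda m HK Hp Hl Hm) as [r Hr].
  exists r. split; [exact Hr|]. split.
  - now apply bohr_inequality_root; [..|apply Hr].
  - intros _ rho Hrho. apply (koebe_sharp p Hp K lambda rho r m HK Hl Hm); [apply Hr|exact Hrho].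
Qed.
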